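(* Let $(a_n)_{n\in\mathbb{N}}$ be a separated sequence in $\mathbb{T}$ and let $m\in\,]0,1[$. Then there exists a sequence $(\eta_n)_{n\in\mathbb{N}}$ of strictly positive numbers such that any sequence $(b_n)_{n\in\mathbb{N}}$ in $\mathbb{D}$ satisfying $|b_n-a_n|<\eta_n$ for all $n$ is an interpolating sequence with Carleson constant no smaller than $m$, i.e. $\inf_{k}\prod_{j\ne k}\left|\frac{b_k-b_j}{1-\overline{b_k}b_j}\right|\ge m$. Moreover, for any such sequence $(b_n)_n$, the functions $$g_k(z)=\frac{1-|b_k|^2}{1-\overline{b_k}z}\,\frac{B_k(z)}{B_k(b_k)},\qquad k\in\mathbb{N},$$ where $B_k$ is the Blaschke product with zeros $b_n$, $n\neq k$, generate a weak*-copy of $\ell^\infty$ in $H^\infty$ with $(g_n)_n$ as an $\ell^\infty$-basis; that is, there is a linear map $T:\ell^\infty\to H^\infty$ with $T\epsilon_n=g_n$ for all $n$ which is a weak*-homeomorphism from $\ell^\infty$ onto a weak*-closed subspace of $H^\infty$.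
   Context: $\mathbb{D}$ is the open unit disk, $\mathbb{T}$ the unit circle. The sequence $(a_n)_n$ is separated if its terms are distinct and each is an isolated point of $\{a_j;j\in\mathbb{N}\}$, i.e. for every $n$ the distance from $a_n$ to $\{a_j;\,j\ne n\}$ is positive. $H^\infty$ is the space of bounded analytic functions on $\mathbb{D}$, with weak* topology from the duality $H^\infty=(L^1/H^1_0)^*$, $\langle[f],h\rangle=\int_{\mathbb{T}}fh$ (normalized Lebesgue measure; $H^1_0$ = functions in the Hardy space $H^1$ vanishing at $0$); $\ell^\infty=(\ell^1)^*$ with its weak* topology and $\epsilon_n$ the canonical unit sequences. A sequence $(b_n)_n$ in $\mathbb{D}$ is interpolating if $h\mapsto(h(b_n))_n$ maps $H^\infty$ onto $\ell^\infty$. $B_k(z)=\prod_{n\neq k}\frac{|b_n|}{b_n}\frac{b_n-z}{1-\overline{b_n}z}$, with the factor read as $z$ when $b_n=0$. *)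

(* Defs.v *)
From HB Require Import structures.
From mathcomp Require Import all_boot all_order all_algebra.
From mathcomp Require Import all_classical all_reals all_analysis.
From mathcomp Require Import complex.

Set Implicit Arguments.
Unset Strict Implicit.
Unset Printing Implicit Defensive.

Import Order.TTheory GRing.Theory Num.Theory.
Import numFieldNormedType.Exports.
Import numFieldTopology.Exports.

Local Open Scope classical_set_scope.
Local Open Scope ring_scope.
Local Open Scope complex_scope.

(* R[i] seen as a closed numeric field: MathComp-Analysis attaches to the type  *)
(* Cx R the topology of the modulus and the normed space structure over Cx R    *)
(* itself, so that derivable f z 1 is complex differentiability.                *)
Definition Cx (R : realType) : numClosedFieldType := R[i].

Definition disk (R : realType) : set (Cx R) := [set z | `|z| < 1].
Definition circle (R : realType) : set (Cx R) := [set z | `|z| = 1].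

Definition expi (R : realType) (t : R) : Cx R := cos t +i* sin t.

Section Linf.
Variable R : realType.
Local Notation C := (Cx R).

Definition linf_pred : {pred nat -> C} :=
  [pred x | `[< exists M : C, forall n, `|x n| <= M >]].

Lemma linf_submod_closed : submod_closed linf_pred.
Proof.
split; first by apply/asboolP; exists 0 => n; rewrite normr0.
move=> a x y /asboolP[M hM] /asboolP[N hN]; apply/asboolP.
exists (`|a| * M + N) => n; apply: le_trans (ler_normD _ _) _.
by apply: lerD => //; rewrite normrM ler_wpM2l.
Qed.

HB.instance Definition _ :=
  GRing.isSubmodClosed.Build C (nat -> C) linf_pred linf_submod_closed.

Record linf := Linf { linf_val :> nat -> C; _ : linf_val \in linf_pred }.

HB.instance Definition _ := [isSub for linf_val].
HB.instance Definition _ := [Choice of linf by <:].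
HB.instance Definition _ := [SubChoice_isSubLmodule of linf by <:].

Lemma linf_unit_subproof (k : nat) :
  (fun n => (n == k)%:R : C) \in linf_pred.
Proof.
by apply/asboolP; exists 1 => n; case: (n == k); rewrite ?normr1 ?normr0.
Qed.

Definition linf_unit (k : nat) : linf := Linf (linf_unit_subproof k).

Definition l1 : Type := {y : nat -> C | cvgn [normed series y]}.

Definition linf_pairing (y : l1) (x : linf) : C :=
  limn (series (fun n => sval y n * x n)).

End Linf.

(* Elements of H^oo are represented by their extension by 0 outside the disk,   *)
(* so that Leibniz equality in Hinf is equality of functions on the disk.       *)
Section Hinf.
Variable R : realType.
Local Notation C := (Cx R).

Definition Hinf_pred : {pred C -> C} :=
  [pred h : C -> C | `[< [/\ forall z, disk z -> derivable h z 1,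
                             exists M : C, forall z, disk z -> `|h z| <= M
                           & forall z, ~ disk z -> h z = 0] >]].

Lemma Hinf_submod_closed : submod_closed Hinf_pred.
Proof.
split.
  apply/asboolP; split=> [z _||//].
    exact: (@derivable_cst C C C 0).
  by exists 0 => z _; rewrite normr0.
move=> a f g /asboolP[df [M hM] f0] /asboolP[dg [N hN] g0].
apply/asboolP; split=> [z zD||z zD].
- by apply: derivableD; [apply: derivableZ; exact: df|exact: dg].
- exists (`|a| * M + N) => z zD; apply: le_trans (ler_normD _ _) _.
  by apply: lerD; [rewrite normrM ler_wpM2l// hM|exact: hN].
- have -> : (a *: f + g) z = a * f z + g z by [].
  by rewrite (f0 _ zD) (g0 _ zD) mulr0 addr0.
Qed.

HB.instance Definition _ :=
  GRing.isSubmodClosed.Build C (C -> C) Hinf_pred Hinf_submod_closed.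

Record Hinf := HInf { Hinf_val :> C -> C; _ : Hinf_val \in Hinf_pred }.

HB.instance Definition _ := [isSub for Hinf_val].
HB.instance Definition _ := [Choice of Hinf by <:].
HB.instance Definition _ := [SubChoice_isSubLmodule of Hinf by <:].

(* Radial limits, which exist at almost every point of the circle by Fatou's    *)
(* theorem; at the remaining points lim is a fixed default value.               *)
Definition boundary_value (h : Hinf) (z : C) : C :=
  lim (h ((r%:C : C) * z) @[r --> (1 : R)^'-]).

(* Functions integrable on the circle for normalized Lebesgue measure, i.e. for *)
(* the image of dt / (2 pi) on [0, 2 pi] under expi.                            *)
Definition L1circle : Type :=
  {f : C -> C |
     lebesgue_measure.-integrable `[0, 2 * pi]
       (EFin \o (fun t : R => complex.Re (f (expi t)))) /\
     lebesgue_measure.-integrable `[0, 2 * pi]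
       (EFin \o (fun t : R => complex.Im (f (expi t))))}.

Definition circle_integral (f : C -> C) : C :=
  (((2 * pi)^-1)%:C : C) *
  ((\int[lebesgue_measure]_(t in `[0, 2 * pi]) complex.Re (f (expi t))) +i*
   (\int[lebesgue_measure]_(t in `[0, 2 * pi]) complex.Im (f (expi t)))).

(* <[f], h>. It does not depend on the representative f of the class [f] modulo *)
(* H^1_0, so the functionals on H^oo given by L^1 / H^1_0 are indexed below by  *)
(* the integrable functions f themselves.                                       *)
Definition Hinf_pairing (f : L1circle) (h : Hinf) : C :=
  circle_integral (fun z => sval f z * boundary_value h z).

End Hinf.

(* Weak* topology on a space V of functionals on P: the initial topology of     *)
(* v |-> (p |-> <p, v>), with values in the product of copies of Cx R.          *)
Definition weak_star (R : realType) (V : choiceType) (P : Type)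
    (pairing : P -> V -> Cx R) : topologicalType :=
  initial_topology
    ((fun v p => pairing p v) : V -> prod_topology (fun _ : P => Cx R)).

Definition linf_ws (R : realType) : topologicalType :=
  weak_star (@linf_pairing R).
Definition Hinf_ws (R : realType) : topologicalType :=
  weak_star (@Hinf_pairing R).

(* (g_n)_n generates a weak*-copy of l^oo in H^oo, as an l^oo-basis. The map S  *)
(* below is the inverse of T on its range.                                      *)
Definition weak_star_copy_of_linf (R : realType) (g : nat -> Cx R -> Cx R) :=
  exists T : {linear linf R -> Hinf R},
    [/\ forall n z, disk z -> T (linf_unit R n) z = g n z,
        continuous (T : linf_ws R -> Hinf_ws R),
        exists S : Hinf R -> linf R, cancel T S /\
          {within (range T : set (Hinf_ws R)),
             continuous (S : Hinf_ws R -> linf_ws R)}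
      & closed (range T : set (Hinf_ws R))].

Section Sequences.
Variable R : realType.
Local Notation C := (Cx R).

Definition separated_seq (a : nat -> C) :=
  injective a /\ forall n, isolated (range a) (a n).

Definition interpolating (b : nat -> C) :=
  forall x : linf R, exists h : Hinf R, forall n, h (b n) = x n.

Definition Carleson_constant (b : nat -> C) : R :=
  inf (range (fun k => limn (fun N =>
    \prod_(j < N | j != k :> nat)
      Normc.normc ((b k - b j) / (1 - (b k)^* * b j)) : R))).

Definition blaschke_factor (w z : C) : C :=
  if w == 0 then z else `|w| / w * ((w - z) / (1 - w^* * z)).

Definition blaschke_except (b : nat -> C) (k : nat) (z : C) : C :=
  limn (fun N => \prod_(n < N | n != k :> nat) blaschke_factor (b n) z).

Definition gfun (b : nat -> C) (k : nat) (z : C) : C :=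
  (1 - `|b k| ^+ 2) / (1 - (b k)^* * z) *
  (blaschke_except b k z / blaschke_except b k (b k)).

End Sequences.

(* Main.v *)
(* Let [d n] be small compared with the distance from [a n] to the other points
   and let [e n > 0] have sum at most [1 - m]. If [b n] is close enough to [a n],
   then outside the disc [|z - a n| < d n] the Blaschke factor of [b n] is within
   [e n] of 1 and the kernel [(1 - |b n|^2) / (1 - conj (b n) z)] is at most
   [e n]. The product of the factors at [b k] is therefore at least
   [1 - sum e n >= m], and since the discs are disjoint, even after doubling the
   radii, [sum_n |g_n| <= 3 / m] on the disk. Hence [T x = sum_n x_n g_n] is
   bounded, and [S h = (h (b n))_n] is a left inverse of it.

   On a given radius of the disk at most one index is exceptional, so radial
   limits of [T x] can be taken term by term; this gives
   [<f, T x> = sum_n x_n <f, g_n>] with a summable sequence [<f, g_n>], that is,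
   weak-star continuity of [T]. By Fatou's theorem [h (w)] is the Poisson integral
   of the radial limits of [h], so [sum_n y_n h (b n)], for [y] in l^1, is the
   pairing of [h] with the integrable function [sum_n y_n P_(b n)], where [P_w]
   is the Poisson kernel. It follows that [S] is weak-star continuous and that
   the range of [T], which is cut out by the equations
   [h z = sum_n g_n z h (b n)], is weak-star closed. *)

From HB Require Import structures.
Require Import Defs.
From mathcomp Require Import all_boot all_order all_algebra.
From mathcomp Require Import all_classical all_reals all_analysis.
From mathcomp Require Import measurable_realfun.
From mathcomp Require Import complex.
From mathcomp Require Import ring lra.
Set Implicit Arguments.
Unset Strict Implicit.
Unset Printing Implicit Defensive.

Import Order.TTheory GRing.Theory Num.Theory.
Import numFieldNormedType.Exports numFieldTopology.Exports.

Local Open Scope classical_set_scope.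
Local Open Scope ring_scope.
Local Open Scope complex_scope.

(** * Complex limits and series *)

(** The definitions speak of pointwise complex differentiability, radial limits and Lebesgue
    integrals. What links them is Cauchy's formula (through Goursat's argument, as no continuity of
    the derivative is given), Taylor series, Parseval's identity and Fatou's theorem, all developed
    below.

    The discs are doubled because of radial limits: if [r z] lies within [d n] of [a n], with [z] on
    the circle, then [1 - r <= |r z - a n| < d n], so [z] lies within [2 d n] of [a n]. One majorant
    attached to the end point [z] thus serves for the whole radius, and its sum is bounded uniformly
    in [z]. Hence a multiple of [|f|] dominates all partial sums on the circle, for every integrable
    [f], and [T] is continuous on all of l^oo, not only on bounded sets.

    The [b n] tend to the circle, but Poisson kernels have mean 1 wherever their pole lies, so every
    l^1 combination of them is integrable. This makes the equations of the range weak-star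
    continuous, and closedness follows without the Krein-Smulian theorem. *)

Section ComplexModulus.
Variable R : realType.
Local Notation C := (Cx R).
Local Notation nrm := (@Normc.normc R).
Local Notation Re := (@complex.Re R).
Local Notation Im := (@complex.Im R).
Implicit Types z w : C.

(** The norm of [Cx R] takes its values in [Cx R] itself. Estimates are carried out with the
    real-valued modulus [nrm], and this equation passes between the two. *)
Lemma normCE z : `|z| = (nrm z)%:C.
Proof. by []. Qed.

Lemma nrmE z : nrm z = Num.sqrt (Re z ^+ 2 + Im z ^+ 2).
Proof. by case: z. Qed.

Lemma nrm_ge0 z : 0 <= nrm z.
Proof. by rewrite nrmE sqrtr_ge0. Qed.

Lemma nrmD z w : nrm (z + w) <= nrm z + nrm w.
Proof. exact: le_normcD. Qed.

Lemma nrmN z : nrm (- z) = nrm z.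
Proof. exact: normcN. Qed.

Lemma nrmB z w : nrm (z - w) = nrm (w - z).
Proof. by rewrite -nrmN opprB. Qed.

Lemma nrmM z w : nrm (z * w) = nrm z * nrm w.
Proof. exact: Normc.normcM. Qed.

Lemma nrmV z : nrm z^-1 = (nrm z)^-1.
Proof. exact: Normc.normcV. Qed.

Lemma nrm0 : nrm (0 : C) = 0.
Proof. exact: Normc.normc0. Qed.

Lemma nrm1 : nrm (1 : C) = 1.
Proof. exact: Normc.normc1. Qed.

Lemma nrmX z n : nrm (z ^+ n) = nrm z ^+ n.
Proof. by elim: n => [|n IHn]; rewrite ?expr0 ?nrm1// !exprS nrmM IHn. Qed.

Lemma nrm_eq0 z : (nrm z == 0) = (z == 0).
Proof.
apply/idP/idP => [/eqP/Normc.eq0_normc/eqP//|/eqP ->].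
by rewrite nrm0.
Qed.

Lemma nrm_gt0 z : (0 < nrm z) = (z != 0).
Proof. by rewrite lt_def nrm_ge0 andbT nrm_eq0. Qed.

Lemma nrm_real (x : R) : nrm (x%:C : C) = `|x|.
Proof. by rewrite nrmE /= expr0n addr0 sqrtr_sqr. Qed.

Lemma nrmJ z : nrm (Num.conj z) = nrm z.
Proof. by rewrite !nrmE; case: z => x y /=; rewrite sqrrN. Qed.

Lemma sqr_nrm z : nrm z ^+ 2 = Re z ^+ 2 + Im z ^+ 2.
Proof. by rewrite nrmE sqr_sqrtr// addr_ge0 ?sqr_ge0. Qed.

Lemma Re_le_nrm z : `|Re z| <= nrm z.
Proof.
rewrite -(ler_pXn2r (_ : 0 < 2)%N) ?nnegrE ?nrm_ge0//.
by rewrite sqr_nrm -normrX ger0_norm ?sqr_ge0// lerDl sqr_ge0.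
Qed.

Lemma Im_le_nrm z : `|Im z| <= nrm z.
Proof.
rewrite -(ler_pXn2r (_ : 0 < 2)%N) ?nnegrE ?nrm_ge0//.
by rewrite sqr_nrm -normrX ger0_norm ?sqr_ge0// lerDr sqr_ge0.
Qed.

Lemma nrm_le_ReIm z : nrm z <= `|Re z| + `|Im z|.
Proof.
rewrite -(ler_pXn2r (_ : 0 < 2)%N) ?nnegrE ?nrm_ge0 ?addr_ge0//.
rewrite sqr_nrm sqrrD !real_normK ?num_real// lerD2r lerDl.
by rewrite mulrn_wge0// mulr_ge0.
Qed.

Lemma le_nrm_sum (I : Type) (s : seq I) (P : pred I) (f : I -> C) :
  nrm (\sum_(i <- s | P i) f i) <= \sum_(i <- s | P i) nrm (f i).
Proof.
elim/big_ind2 : _ => [|x1 x2 y1 y2 h1 h2|//]; first by rewrite nrm0.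
exact: le_trans (nrmD _ _) (lerD h1 h2).
Qed.

Lemma nrm_sub_le z w : `|nrm z - nrm w| <= nrm (z - w).
Proof.
rewrite ler_distl lerBlDr; apply/andP; split.
  by have := nrmD (w - z) z; rewrite subrK nrmB addrC.
by have := nrmD (z - w) w; rewrite subrK addrC.
Qed.

Lemma nrm_le_bound z (M : C) : (`|z| <= M) -> nrm z <= Re M.
Proof. by rewrite normCE lecE => /andP[_]. Qed.

Lemma diskE z : disk z = (nrm z < 1).
Proof. by congr is_true; exact: (ltcR (nrm z) 1). Qed.

Lemma circleE z : circle z = (nrm z = 1).
Proof.
rewrite /circle /=; apply/propext; split => [/eqP|h].
  by rewrite normCE => /eqP/(congr1 Re).
by rewrite normCE h.
Qed.

Lemma cReD z w : Re (z + w) = Re z + Re w.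
Proof. by case: z; case: w. Qed.

Lemma cImD z w : Im (z + w) = Im z + Im w.
Proof. by case: z; case: w. Qed.

Lemma cReB z w : Re (z - w) = Re z - Re w.
Proof. by case: z; case: w. Qed.

Lemma cImB z w : Im (z - w) = Im z - Im w.
Proof. by case: z; case: w. Qed.

Lemma cReM z w : Re (z * w) =
  Re z * Re w - Im z * Im w.
Proof. by case: z; case: w. Qed.

Lemma cImM z w : Im (z * w) =
  Re z * Im w + Im z * Re w.
Proof. by case: z => a b; case: w => c d /=. Qed.

Lemma cReZ (x : R) z : Re (x%:C * z) = x * Re z.
Proof. by rewrite cReM /= mul0r subr0. Qed.

Lemma cImZ (x : R) z : Im (x%:C * z) = x * Im z.
Proof. by rewrite cImM /= mul0r addr0. Qed.

Lemma cReS (I : Type) (s : seq I) (P : pred I) (f : I -> C) :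
  Re (\sum_(i <- s | P i) f i) = \sum_(i <- s | P i) Re (f i).
Proof. by elim/big_ind2 : _ => // ? ? ? ? <- <-; rewrite cReD. Qed.

Lemma cImS (I : Type) (s : seq I) (P : pred I) (f : I -> C) :
  Im (\sum_(i <- s | P i) f i) = \sum_(i <- s | P i) Im (f i).
Proof. by elim/big_ind2 : _ => // ? ? ? ? <- <-; rewrite cImD. Qed.

Lemma cReJ z : Re (Num.conj z) = Re z.
Proof. by case: z. Qed.

Lemma cImJ z : Im (Num.conj z) = - Im z.
Proof. by case: z. Qed.

Lemma conj_real (x : R) : Num.conj (x%:C : C) = x%:C.
Proof. exact: conjc_real. Qed.

Lemma complex_eq z w : Re z = Re w ->
  Im z = Im w -> z = w.
Proof. by case: z => a b; case: w => c d /= -> ->. Qed.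

End ComplexModulus.

Section ComplexLimits.
Variable R : realType.
Local Notation C := (Cx R).
Local Notation nrm := (@Normc.normc R).
Local Notation Re := (@complex.Re R).
Local Notation Im := (@complex.Im R).
Context {T : Type} {F : set_system T} {FF : Filter F}.
Implicit Types (f : T -> C) (l : C).

(** Balls of [Cx R] have radii in [Cx R], but [0 < e] forces the imaginary part of [e] to vanish, so
    real radii give the same neighbourhoods. *)
Lemma ccvgP f l : f x @[x --> F] --> l <->
  nrm (f x - l) @[x --> F] --> (0 : R).
Proof.
split=> [/cvgrPdist_lt fl|/cvgrPdist_lt fl]; apply/cvgrPdist_lt => e e0.
  have e0' : 0 < (e%:C : C) by rewrite ltcR.
  apply: filterS (fl _ e0') => x; rewrite normCE ltcR => h.
  by rewrite sub0r normrN ger0_norm ?nrm_ge0// nrmB.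
have := fl (Re e); move: e0; rewrite ltcE /= => /andP[/eqP im re].
move=> /(_ re); apply: filterS => x.
rewrite sub0r normrN ger0_norm ?nrm_ge0// nrmB normCE => h.
by rewrite ltcE /= im eqxx.
Qed.

Lemma ccvg_lt f l : f x @[x --> F] --> l <->
  forall e : R, 0 < e -> \forall x \near F, nrm (f x - l) < e.
Proof.
rewrite ccvgP; split=> [/cvgrPdist_lt|] h.
  move=> e /h; apply: filterS => x.
  by rewrite sub0r normrN ger0_norm ?nrm_ge0.
apply/cvgrPdist_lt => e /h; apply: filterS => x.
by rewrite sub0r normrN ger0_norm ?nrm_ge0.
Qed.

Lemma ccvg_Re f l : f x @[x --> F] --> l ->
  Re (f x) @[x --> F] --> Re l.
Proof.
move/ccvg_lt => h; apply/cvgrPdist_lt => e /h; apply: filterS => x.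
by apply: le_lt_trans; rewrite distrC -cReB Re_le_nrm.
Qed.

Lemma ccvg_Im f l : f x @[x --> F] --> l ->
  Im (f x) @[x --> F] --> Im l.
Proof.
move/ccvg_lt => h; apply/cvgrPdist_lt => e /h; apply: filterS => x.
by apply: le_lt_trans; rewrite distrC -cImB Im_le_nrm.
Qed.

Lemma ccvg_ReIm f l : Re (f x) @[x --> F] --> Re l ->
  Im (f x) @[x --> F] --> Im l -> f x @[x --> F] --> l.
Proof.
move=> /cvgrPdist_lt re /cvgrPdist_lt im; apply/ccvg_lt => e e0.
have e2 : 0 < e / 2 by rewrite divr_gt0.
near=> x; apply: le_lt_trans (nrm_le_ReIm _) _.
rewrite cReB cImB [ltRHS]splitr ltrD// distrC.
  by near: x; exact: re.
by near: x; exact: im.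
Unshelve. all: by end_near. Qed.

Lemma ccvg_nrm f l : f x @[x --> F] --> l -> nrm (f x) @[x --> F] --> nrm l.
Proof.
move/ccvg_lt => h; apply/cvgrPdist_lt => e /h; apply: filterS => x.
by apply: le_lt_trans; rewrite distrC nrm_sub_le.
Qed.

Lemma ccvg_sum (I : Type) (s : seq I) (f : I -> T -> C) (l : I -> C) :
  (forall i, f i x @[x --> F] --> l i) ->
  (\sum_(i <- s) f i x) @[x --> F] --> \sum_(i <- s) l i.
Proof.
move=> fl; elim: s => [|i s IHs].
  by under eq_fun do rewrite big_nil; rewrite big_nil; exact: cvg_cst.
under eq_fun do rewrite big_cons.
by rewrite big_cons; apply: cvgD; [exact: fl|exact: IHs].
Qed.

Lemma ccvg_real (g : T -> R) (x : R) : g y @[y --> F] --> x ->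
  ((g y)%:C : C) @[y --> F] --> (x%:C : C).
Proof. by move=> h; apply: ccvg_ReIm => //=; exact: cvg_cst. Qed.

End ComplexLimits.

Section ComplexSeries.
Variable R : realType.
Local Notation C := (Cx R).
Local Notation nrm := (@Normc.normc R).
Local Notation Re := (@complex.Re R).
Local Notation Im := (@complex.Im R).
Implicit Types (u : nat -> C).

Definition csummable u := cvgn (series (fun n => nrm (u n))).
Definition csum u : C := limn (series u).

Lemma cvgn_le_summable (a b : nat -> R) : (forall n, 0 <= a n <= b n) ->
  cvgn (series b) -> cvgn (series a).
Proof.
move=> ab; apply: series_le_cvg => n; have /andP[//] := ab n.
by move=> a0 /(le_trans a0).
Qed.

Lemma series_Re u n : Re (series u n) = series (Re \o u) n.
Proof. by rewrite /series/= cReS. Qed.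

Lemma series_Im u n : Im (series u n) = series (Im \o u) n.
Proof. by rewrite /series/= cImS. Qed.

Lemma normed_rcvg (a : nat -> R) : cvgn (series (fun n => `|a n|)) ->
  cvgn (series a).
Proof. exact: normed_cvg. Qed.

Lemma csum_cvg u : csummable u -> series u @ \oo --> csum u.
Proof.
move=> su.
have re : cvgn (series (Re \o u)).
  apply: normed_rcvg; apply: cvgn_le_summable su => n.
  by rewrite normr_ge0 Re_le_nrm.
have im : cvgn (series (Im \o u)).
  apply: normed_rcvg; apply: cvgn_le_summable su => n.
  by rewrite normr_ge0 Im_le_nrm.
suff h : series u @ \oo -->
    (limn (series (Re \o u)) +i* limn (series (Im \o u)) : C).
  by rewrite /csum; apply: cvgP h.
apply: ccvg_ReIm => /=.
  by under eq_fun do rewrite series_Re.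
by under eq_fun do rewrite series_Im.
Qed.

Lemma ccvg_lim {T : Type} {F : set_system T} {FF : ProperFilter F}
    (f : T -> C) (l : C) :
  f x @[x --> F] --> l -> lim (f x @[x --> F]) = l.
Proof. by move=> h; apply/cvg_lim. Qed.

Lemma ccvg_cst_eq (f : nat -> C) (a l : C) : f n @[n --> \oo] --> l ->
  (forall n, f n = a) -> l = a.
Proof.
move=> fl /funext fa; have := ccvg_lim fl; rewrite fa => <-.
by apply: ccvg_lim; exact: cvg_cst.
Qed.

Lemma csumP u (l : C) : series u @ \oo --> l -> csum u = l.
Proof. exact: ccvg_lim. Qed.

Lemma nd_series (a : nat -> R) : (forall n, 0 <= a n) ->
  nondecreasing_seq (series a).
Proof.
move=> a0; apply/nondecreasing_seqP => n.
by rewrite /series/= big_nat_recr//= lerDl.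
Qed.

Lemma rsum_partial_le (a : nat -> R) n : (forall n, 0 <= a n) ->
  cvgn (series a) -> series a n <= limn (series a).
Proof. by move=> a0 h; apply: nondecreasing_cvgn_le => //; exact: nd_series. Qed.

Lemma rsum_term_le (a : nat -> R) n : (forall n, 0 <= a n) ->
  cvgn (series a) -> a n <= limn (series a).
Proof.
move=> a0 h; apply: le_trans (rsum_partial_le n.+1 a0 h).
by rewrite /series/= big_nat_recr//= lerDr sumr_ge0.
Qed.

Lemma rsum_bounded (a : nat -> R) M : (forall n, 0 <= a n) ->
  (forall n, series a n <= M) -> cvgn (series a).
Proof.
move=> a0 aM; apply: nondecreasing_is_cvgn; first exact: nd_series.
by exists M => _ [n _ <-].
Qed.

Lemma rsum_le (a : nat -> R) M : cvgn (series a) ->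
  (forall n, series a n <= M) -> limn (series a) <= M.
Proof. by move=> h aM; apply: limr_le => //; exact: nearW. Qed.

Lemma summable_le u (M : nat -> R) : cvgn (series M) ->
  (forall n, nrm (u n) <= M n) -> csummable u.
Proof.
move=> hM uM; apply: cvgn_le_summable hM => n.
by rewrite nrm_ge0 uM.
Qed.

Lemma nrm_series u n : nrm (series u n) <= series (fun n => nrm (u n)) n.
Proof. exact: le_nrm_sum. Qed.

Lemma csum_tail u (M : nat -> R) N : cvgn (series M) ->
  (forall n, nrm (u n) <= M n) ->
  nrm (csum u - series u N) <= limn (series M) - series M N.
Proof.
move=> hM uM; have su := summable_le hM uM.
have M0 n : 0 <= M n by apply: le_trans (uM n); exact: nrm_ge0.
have h : nrm (series u n - series u N) @[n --> \oo] -->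
    nrm (csum u - series u N).
  by apply: ccvg_nrm; apply: cvgB; [exact: csum_cvg|exact: cvg_cst].
rewrite -(cvg_lim _ h)//; apply: limr_le; first by apply: cvgP h.
near=> n; have Nn : (N <= n)%N by near: n; exact: nbhs_infty_ge.
rewrite sub_series Nn; apply: le_trans (le_nrm_sum _ _ _) _.
apply: (@le_trans _ _ (series M n - series M N)); last first.
  by rewrite lerD2r rsum_partial_le.
by rewrite sub_series Nn; exact: ler_sum.
Unshelve. all: by end_near. Qed.

Lemma nrm_csum u (M : nat -> R) : cvgn (series M) ->
  (forall n, nrm (u n) <= M n) -> nrm (csum u) <= limn (series M).
Proof.
move=> hM /(csum_tail 0 hM).
by rewrite /series/= !big_geq// !subr0.
Qed.

Lemma csumD u v : csummable u -> csummable v ->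
  csum (fun n => u n + v n) = csum u + csum v.
Proof.
move=> su sv; apply: csumP.
have -> : series (fun n => u n + v n) = series u \+ series v.
  by apply/funext => n; rewrite /series/= big_split.
by apply: cvgD; exact: csum_cvg.
Qed.

Lemma csumZ (a : C) u : csummable u -> csum (fun n => a * u n) = a * csum u.
Proof.
move=> su; apply: csumP.
have -> : series (fun n => a * u n) = (fun n => a * series u n).
  by apply/funext => n; rewrite /series/= mulr_sumr.
by apply: cvgM; [exact: cvg_cst|exact: csum_cvg].
Qed.

Lemma summableZ (a : C) u : csummable u -> csummable (fun n => a * u n).
Proof.
move=> su; rewrite /csummable.
have -> : series (fun n => nrm (a * u n)) =
    (fun n => nrm a * series (fun n => nrm (u n)) n).
  apply/funext => n; rewrite /series/= mulr_sumr.
  by apply: eq_bigr => i _; rewrite nrmM.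
by apply: is_cvgM => //; exact: is_cvg_cst.
Qed.

Lemma summableD u v : csummable u -> csummable v ->
  csummable (fun n => u n + v n).
Proof.
move=> su sv; apply: (@summable_le _ (fun n => nrm (u n) + nrm (v n))).
  have -> : series (fun n => nrm (u n) + nrm (v n)) =
      series (fun n => nrm (u n)) \+ series (fun n => nrm (v n)).
    by apply/funext => n; rewrite /series/= big_split.
  exact: is_cvgD.
by move=> n; exact: nrmD.
Qed.

Lemma csum_eq u v : u =1 v -> csum u = csum v.
Proof. by move=> /funext ->. Qed.

Lemma csum_single u k : (forall n, n != k -> u n = 0) -> csum u = u k.
Proof.
move=> h; apply: csumP; apply/ccvg_lt => e e0; near=> n.
have kn : (k < n)%N by near: n; exact: nbhs_infty_gt.
rewrite /series/= big_mkord (bigD1 (Ordinal kn))//= big1 ?addr0 ?subrr ?nrm0//.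
by move=> i ik; exact: h.
Unshelve. all: by end_near. Qed.

(** Dominated convergence for series: once [N] is such that the tail of [M] is below [e / 3], only
    finitely many terms have to converge. The filter is arbitrary because the lemma serves for
    continuity at a point, for sequences of functions and for radial limits. *)
Lemma tannery (T : Type) (F : set_system T) (FF : ProperFilter F)
    (f : nat -> T -> C) (l : nat -> C) (M : nat -> R) : cvgn (series M) ->
    (\forall x \near F, forall n, nrm (f n x) <= M n) ->
    (forall n, f n x @[x --> F] --> l n) ->
  csum (f ^~ x) @[x --> F] --> csum l.
Proof.
move=> hM fM fl.
have lM n : nrm (l n) <= M n.
  rewrite -(cvg_lim _ (ccvg_nrm (fl n)))//; apply: limr_le.
    by apply: cvgP (ccvg_nrm (fl n)).
  by apply: filterS fM => x; exact.
apply/ccvg_lt => e e0; have e3 : 0 < e / 3 by rewrite divr_gt0.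
have [N hN] : exists N, limn (series M) - series M N < e / 3.
  move/cvgrPdist_lt : (hM) => /(_ _ e3)[N _ /(_ N (leqnn N))/= h].
  by exists N; apply: le_lt_trans h; exact: ler_norm.
have fin : series (f ^~ x) N @[x --> F] --> series l N.
  have S g n : series g n.+1 = series g n + g n :> C.
    by rewrite /series/= big_nat_recr.
  have S0 g : series g 0 = 0 :> C by rewrite /series/= big_geq.
  elim: N {hN} => [|N IHN].
    by under eq_fun do rewrite S0; rewrite S0; exact: cvg_cst.
  under eq_fun do rewrite S.
  by rewrite S; apply: cvgD; [exact: IHN|exact: fl].
move/ccvg_lt : fin => /(_ _ e3) fin; near=> x.
have -> : csum (f ^~ x) - csum l = (csum (f ^~ x) - series (f ^~ x) N) +
  (series (f ^~ x) N - series l N) + (series l N - csum l) by ring.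
have -> : e = e / 3 + e / 3 + e / 3 by field.
apply: le_lt_trans (nrmD _ _) _; apply: ltr_leD; last first.
  by rewrite nrmB; apply: le_trans (csum_tail N hM lM) _; exact: ltW.
apply: le_lt_trans (nrmD _ _) _; apply: ler_ltD; last by near: x.
by apply: le_trans (csum_tail N hM _) _; [near: x|exact: ltW].
Unshelve. all: by end_near. Qed.

Lemma geometric_summable (r : R) : 0 <= r < 1 -> cvgn (series (fun n => r ^+ n)).
Proof.
move=> /andP[r0 r1].
have -> : (fun n => r ^+ n) = geometric 1 r.
  by apply/funext => n; rewrite /geometric/= mul1r.
by apply: is_cvg_geometric_series; rewrite ger0_norm.
Qed.

Lemma csum_geometric (z : C) : nrm z < 1 -> csum (fun n => z ^+ n) = (1 - z)^-1.
Proof.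
move=> z1.
have z1' : 1 - z != 0.
  by rewrite subr_eq0; apply: contraTneq z1 => <-; rewrite nrm1 ltxx.
apply: csumP.
have -> : series (fun n => z ^+ n) = (fun n => (1 - z)^-1 - (1 - z)^-1 * z ^+ n).
  apply/funext => n; rewrite /series/= big_mkord.
  apply: (mulfI z1').
  by rewrite mulrBr mulrA divff// mul1r -[X in X * _ = _]opprB mulNr -subrX1 opprB.
rewrite -[X in _ --> X]subr0; apply: cvgB; first exact: cvg_cst.
rewrite -[X in _ --> X](mulr0 (1 - z)^-1); apply: cvgM; first exact: cvg_cst.
apply/ccvgP; under eq_fun do rewrite subr0 nrmX.
by apply: cvg_expr; rewrite ger0_norm ?nrm_ge0.
Qed.

End ComplexSeries.

(** * Complex integrals *)

Section ComplexIntegral.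
Variable R : realType.
Local Notation C := (Cx R).
Local Notation nrm := (@Normc.normc R).
Local Notation Re := (@complex.Re R).
Local Notation Im := (@complex.Im R).
Local Notation mu := (@lebesgue_measure R).
Implicit Types (u v : R -> C).

Lemma lebesgue_aeS (P Q : R -> Prop) : (forall t, P t -> Q t) ->
  {ae mu, forall t, P t} -> {ae mu, forall t, Q t}.
Proof.
by move=> PQ; apply: (@filterS _ _ (ae_filter_ringOfSetsType mu)).
Qed.

Lemma lebesgue_aeI (P Q : R -> Prop) :
  {ae mu, forall t, P t} -> {ae mu, forall t, Q t} ->
  {ae mu, forall t, P t /\ Q t}.
Proof. exact: (@filterI _ _ (ae_filter_ringOfSetsType mu)). Qed.

Definition cint (D : set R) u : C :=
  (\int[mu]_(t in D) Re (u t)) +i* (\int[mu]_(t in D) Im (u t)).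

Definition cmeas (D : set R) u :=
  measurable_fun D (Re \o u) /\ measurable_fun D (Im \o u).

Definition cintegrable (D : set R) u :=
  mu.-integrable D (EFin \o (Re \o u)) /\ mu.-integrable D (EFin \o (Im \o u)).

Section Domain.
Variables (D : set R) (mD : measurable D).

Lemma le_integrable_real (f g : R -> R) : measurable_fun D f ->
  mu.-integrable D (EFin \o g) -> (forall t, D t -> `|f t| <= g t) ->
  mu.-integrable D (EFin \o f).
Proof.
move=> mf ig fg; apply: (@le_integrable _ _ _ mu D mD _ (EFin \o g)) => //.
  exact/measurable_EFinP.
move=> t Dt /=; rewrite lee_fin; apply: le_trans (fg _ Dt) _.
exact: ler_norm.
Qed.

Lemma cintegrable_meas u : cintegrable D u -> cmeas D u.
Proof.
by case=> /integrableP[/measurable_EFinP ? _] /integrableP[/measurable_EFinP ? _].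
Qed.

Lemma cintegrable_le u (g : R -> R) : cmeas D u -> mu.-integrable D (EFin \o g) ->
  (forall t, D t -> nrm (u t) <= g t) -> cintegrable D u.
Proof.
move=> [mr mi] ig ug; split; apply: (le_integrable_real _ ig) => // t Dt /=.
  by apply: le_trans (ug _ Dt); exact: Re_le_nrm.
by apply: le_trans (ug _ Dt); exact: Im_le_nrm.
Qed.

Lemma cmeas_cst (c : C) : cmeas D (fun=> c).
Proof. by split; exact: measurable_cst. Qed.

Lemma cmeasD u v : cmeas D u -> cmeas D v -> cmeas D (fun t => u t + v t).
Proof.
move=> [ur ui] [vr vi]; split.
  have -> : Re \o (fun t => u t + v t) = (Re \o u) \+ (Re \o v).
    by apply/funext => t; exact: cReD.
  exact: measurable_funD.
have -> : Im \o (fun t => u t + v t) = (Im \o u) \+ (Im \o v).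
  by apply/funext => t; exact: cImD.
exact: measurable_funD.
Qed.

Lemma cmeasM u v : cmeas D u -> cmeas D v -> cmeas D (fun t => u t * v t).
Proof.
move=> [ur ui] [vr vi]; split.
  have -> : Re \o (fun t => u t * v t) =
      (Re \o u) \* (Re \o v) \- (Im \o u) \* (Im \o v).
    by apply/funext => t; exact: cReM.
  by apply: measurable_funB; exact: measurable_funM.
have -> : Im \o (fun t => u t * v t) =
    (Re \o u) \* (Im \o v) \+ (Im \o u) \* (Re \o v).
  by apply/funext => t; exact: cImM.
by apply: measurable_funD; exact: measurable_funM.
Qed.

Lemma cmeasZ (c : C) u : cmeas D u -> cmeas D (fun t => c * u t).
Proof. by move=> mu'; apply: cmeasM => //; exact: cmeas_cst. Qed.

Lemma cmeas_real (f : R -> R) : measurable_fun D f ->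
  cmeas D (fun t => (f t)%:C : C).
Proof. by move=> mf; split => //; exact: measurable_cst. Qed.

Lemma cmeas_sum (I : Type) (s : seq I) (f : I -> R -> C) :
  (forall i, cmeas D (f i)) -> cmeas D (fun t => \sum_(i <- s) f i t).
Proof.
move=> mf; elim: s => [|a s IHs].
  by under eq_fun do rewrite big_nil; exact: cmeas_cst.
by under eq_fun do rewrite big_cons; exact: cmeasD.
Qed.

Lemma cmeas_eq u v : (forall t, D t -> u t = v t) -> cmeas D u -> cmeas D v.
Proof.
move=> uv [ur ui]; split.
  by apply: eq_measurable_fun ur => t /set_mem Dt /=; rewrite uv.
by apply: eq_measurable_fun ui => t /set_mem Dt /=; rewrite uv.
Qed.

Lemma cmeas_nrm u : cmeas D u -> measurable_fun D (fun t => nrm (u t)).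
Proof.
move=> [ur ui]; under eq_fun do rewrite nrmE.
have -> : (fun t => Num.sqrt (Re (u t) ^+ 2 + Im (u t) ^+ 2)) =
    (fun x => x `^ 2^-1) \o
      (fun t => (Re \o u) t ^+ 2 + (Im \o u) t ^+ 2).
  by apply/funext => t /=; rewrite powR12_sqrt// addr_ge0 ?sqr_ge0.
apply: measurableT_comp; first exact: measurable_powR.
by apply: measurable_funD; exact: measurable_funX.
Qed.

Lemma cmeas_cvg (f : nat -> R -> C) u : (forall n, cmeas D (f n)) ->
  (forall t, D t -> f n t @[n --> \oo] --> u t) -> cmeas D u.
Proof.
move=> mf fu; split.
  apply: (measurable_fun_cvg _ (h := fun n => Re \o f n)) => [n|t Dt].
    by case: (mf n).
  by apply: ccvg_Re; exact: fu.
apply: (measurable_fun_cvg _ (h := fun n => Im \o f n)) => [n|t Dt].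
  by case: (mf n).
by apply: ccvg_Im; exact: fu.
Qed.

Lemma cintegrableD u v : cintegrable D u -> cintegrable D v ->
  cintegrable D (fun t => u t + v t).
Proof.
move=> [ur ui] [vr vi]; split.
  have -> : EFin \o (Re \o (fun t => u t + v t)) =
      (EFin \o (Re \o u)) \+ (EFin \o (Re \o v)).
    by apply/funext => t; exact: (congr1 EFin (cReD _ _)).
  exact: integrableD.
have -> : EFin \o (Im \o (fun t => u t + v t)) =
    (EFin \o (Im \o u)) \+ (EFin \o (Im \o v)).
  by apply/funext => t; exact: (congr1 EFin (cImD _ _)).
exact: integrableD.
Qed.

Lemma integrable_nrm u : cintegrable D u ->
  mu.-integrable D (EFin \o (fun t => nrm (u t))).
Proof.
move=> iu; have [mr mi] := cintegrable_meas iu; case: iu => ir ii.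
apply: (@le_integrable_real _ (fun t => `|Re (u t)| + `|Im (u t)|)).
- exact: cmeas_nrm.
- have -> : EFin \o (fun t => `|Re (u t)| + `|Im (u t)|) =
      (abse \o (EFin \o (Re \o u))) \+ (abse \o (EFin \o (Im \o u))).
    by apply/funext.
  by apply: integrableD => //; exact: integrable_abse.
by move=> t _; rewrite ger0_norm ?nrm_ge0// nrm_le_ReIm.
Qed.

Lemma cintegrableZ (c : C) u : cintegrable D u ->
  cintegrable D (fun t => c * u t).
Proof.
move=> iu; have mu' := cintegrable_meas iu.
apply: (@cintegrable_le _ (fun t => nrm c * nrm (u t))).
- exact: cmeasZ.
- have -> : EFin \o (fun t => nrm c * nrm (u t)) =
      (fun t => ((nrm c)%:E * (EFin \o (fun t => nrm (u t))) t)%E) by [].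
  by apply: integrableZl => //; exact: integrable_nrm.
by move=> t _; rewrite nrmM.
Qed.

Lemma cintegrableB u v : cintegrable D u -> cintegrable D v ->
  cintegrable D (fun t => u t - v t).
Proof.
move=> iu iv; apply: cintegrableD => //.
by under eq_fun do rewrite -mulN1r; exact: cintegrableZ.
Qed.

Lemma eq_cint u v : (forall t, D t -> u t = v t) -> cint D u = cint D v.
Proof.
by move=> uv; congr Complex; apply: eq_Rintegral => t /set_mem Dt; rewrite uv.
Qed.

Lemma eq_cintegrable u v : (forall t, D t -> u t = v t) ->
  cintegrable D u -> cintegrable D v.
Proof.
move=> uv iu; apply: (@cintegrable_le _ (fun t => nrm (u t))).
- by apply: cmeas_eq uv _; exact: cintegrable_meas.
- exact: integrable_nrm.
- by move=> t Dt; rewrite uv.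
Qed.

Lemma cintD u v : cintegrable D u -> cintegrable D v ->
  cint D (fun t => u t + v t) = cint D u + cint D v.
Proof.
move=> [ur ui] [vr vi]; rewrite /cint; apply: complex_eq => /=.
  by under eq_Rintegral do rewrite cReD; rewrite RintegralD.
by under eq_Rintegral do rewrite cImD; rewrite RintegralD.
Qed.

Lemma cintZ (c : C) u : cintegrable D u ->
  cint D (fun t => c * u t) = c * cint D u.
Proof.
move=> [ur ui].
have iZ (a : R) (f : R -> R) : mu.-integrable D (EFin \o f) ->
    mu.-integrable D (EFin \o (fun t => a * f t)).
  move=> h; rewrite (_ : _ \o _ = (fun t => (a%:E * (EFin \o f) t)%E))//.
  exact: integrableZl.
apply: complex_eq => /=.
  under eq_Rintegral do rewrite cReM.
  rewrite RintegralB//; [|exact: (iZ _ (Re \o u))|exact: (iZ _ (Im \o u))].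
  by rewrite !RintegralZl// cReM.
under eq_Rintegral do rewrite cImM.
rewrite RintegralD//; [|exact: (iZ _ (Im \o u))|exact: (iZ _ (Re \o u))].
by rewrite !RintegralZl// cImM.
Qed.

Lemma cintB u v : cintegrable D u -> cintegrable D v ->
  cint D (fun t => u t - v t) = cint D u - cint D v.
Proof.
move=> iu iv; rewrite -[- cint D v]mulN1r -cintZ// -cintD//.
  by apply: eq_cint => t _; rewrite mulN1r.
exact: cintegrableZ.
Qed.

Lemma cintegrable0 : cintegrable D (fun=> 0 : C).
Proof.
by split; rewrite (_ : _ \o _ = cst 0%E)//; exact: integrable0.
Qed.

Lemma cint_series (f : nat -> R -> C) n : (forall n, cintegrable D (f n)) ->
  cintegrable D (fun t => series (f ^~ t) n) /\
  cint D (fun t => series (f ^~ t) n) = series (fun n => cint D (f n)) n.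
Proof.
move=> fi.
have S g k : series g k.+1 = series g k + g k :> C.
  by rewrite /series/= big_nat_recr.
have S0 g : series g 0 = 0 :> C by rewrite /series/= big_geq.
elim: n => [|n [IHi IH]].
  under eq_fun do rewrite S0; split; first exact: cintegrable0.
  rewrite S0 (eq_cint (v := fun=> 0 * 0)).
    by rewrite cintZ ?mul0r//; exact: cintegrable0.
  by move=> t _; rewrite mul0r.
under eq_fun do rewrite S; split; first exact: cintegrableD.
by rewrite S -IH -cintD.
Qed.

Lemma nrm_cint_le u (g : R -> R) : cintegrable D u ->
  mu.-integrable D (EFin \o g) -> (forall t, D t -> nrm (u t) <= g t) ->
  nrm (cint D u) <= \int[mu]_(t in D) g t.
Proof.
move=> iu ig ug.
have [u0|u0] := eqVneq (cint D u) 0.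
  rewrite u0 nrm0; apply: Rintegral_ge0 => t Dt.
  exact: le_trans (nrm_ge0 _) (ug _ Dt).
(* A unimodular factor that turns the integral into its modulus; the real inequality is then applied
   to [Re (c * u)]. *)
pose c : C := (nrm (cint D u))%:C / cint D u.
have c1 : nrm c = 1.
  by rewrite /c nrmM nrm_real nrmV ger0_norm ?nrm_ge0// divff// nrm_eq0.
have ciu := cintegrableZ c iu.
have -> : nrm (cint D u) = \int[mu]_(t in D) Re (c * u t).
  have := cintZ c iu; rewrite {2}/c divfK//.
  by move/(congr1 Re) => /= ->.
apply: le_Rintegral => //; first by case: ciu.
move=> t Dt; apply: le_trans (ug _ Dt).
by apply: le_trans (le_trans (ler_norm _) (Re_le_nrm _)) _; rewrite nrmM c1 mul1r.
Qed.

Lemma cint_dct (f : nat -> R -> C) u (g : R -> R) :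
  (forall n, cmeas D (f n)) -> cmeas D u ->
  {ae mu, forall t, D t -> f n t @[n --> \oo] --> u t} ->
  mu.-integrable D (EFin \o g) ->
  {ae mu, forall t, D t -> forall n, nrm (f n t) <= g t} ->
  cintegrable D u /\ cint D (f n) @[n --> \oo] --> cint D u.
Proof.
move=> mf mu' fu ig fg.
(* The real theorem is applied once, with [P] standing for either part. *)
have dct (P : C -> R) (PE : P = Re \/ P = Im) :
    mu.-integrable D (EFin \o (P \o u)) /\
    \int[mu]_(t in D) P (f n t) @[n --> \oo] --> \int[mu]_(t in D) P (u t).
  have PF : (forall n, measurable_fun D (P \o f n)) /\ measurable_fun D (P \o u).
    by case: PE => ->; split => // [n|]; [case: (mf n)|case: mu'
      |case: (mf n)|case: mu'].
  have Pc h l : h n @[n --> \oo] --> l -> P (h n) @[n --> \oo] --> P l.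
    by case: PE => ->; [exact: ccvg_Re|exact: ccvg_Im].
  have Pn z : `|P z| <= nrm z.
    by case: PE => ->; [exact: Re_le_nrm|exact: Im_le_nrm].
  have [|||||i1 _ i2] := @dominated_convergence _ _ R mu D mD
    (fun n => EFin \o (P \o f n)) (EFin \o (P \o u)) (EFin \o g).
  - by move=> n; apply/measurable_EFinP; exact: PF.1.
  - by apply/measurable_EFinP; exact: PF.2.
  - apply: lebesgue_aeS fu => t ft Dt; apply: cvg_EFin; first exact: nearW.
    by apply: Pc; exact: ft.
  - exact: ig.
  - apply: lebesgue_aeS fg => t ft n Dt; rewrite /= lee_fin.
    exact: le_trans (Pn _) (ft Dt n).
  split => //; apply: fine_cvg; rewrite fineK//.
  exact: integrable_fin_num.
have [ir cr] := dct Re (or_introl erefl); have [ii ci] := dct Im (or_intror erefl).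
by split; [split|apply: ccvg_ReIm].
Qed.

Lemma cint_dct_pt (f : nat -> R -> C) u (g : R -> R) :
  (forall n, cmeas D (f n)) ->
  (forall t, D t -> f n t @[n --> \oo] --> u t) ->
  mu.-integrable D (EFin \o g) ->
  (forall n t, D t -> nrm (f n t) <= g t) ->
  cintegrable D u /\ cint D (f n) @[n --> \oo] --> cint D u.
Proof.
move=> mf fu ig fg; apply: (cint_dct mf _ _ ig); first exact: cmeas_cvg fu.
  exact: aeW.
by apply: aeW => t Dt n; exact: fg.
Qed.

(* Completeness of L^1, in the form of an almost everywhere dominated limit of
   an absolutely convergent series. *)
Lemma ae_cvg_series_L1 (f : nat -> R -> C) (M : R) :
  (forall n, cintegrable D (f n)) ->
  (forall n, series (fun k => \int[mu]_(t in D) nrm (f k t)) n <= M) ->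
  exists g : R -> R, let F t := if `[< csummable (f ^~ t) >] then csum (f ^~ t) else 0 in
    [/\ cmeas D F, mu.-integrable D (EFin \o g) &
    {ae mu, forall t, D t -> series (f ^~ t) @ \oo --> F t /\
      forall n, nrm (series (f ^~ t) n) <= g t}].
Proof.
move=> fi fM.
pose G t : \bar R := (\sum_(0 <= k <oo) (nrm (f k t))%:E)%E.
have mf k : measurable_fun D (fun t => (nrm (f k t))%:E).
  by apply/measurable_EFinP; apply: cmeas_nrm; exact: cintegrable_meas.
have f0 k t : (0 <= (nrm (f k t))%:E)%E by rewrite lee_fin nrm_ge0.
have mG : measurable_fun D G by apply: ge0_emeasurable_sum => //.
have G0 t : (0 <= G t)%E by apply: nneseries_ge0.
have iG : mu.-integrable D G.
  apply/integrableP; split => //.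
  under eq_integral do rewrite gee0_abs//.
  rewrite integral_nneseries//; apply: (@le_lt_trans _ _ M%:E); last exact: ltry.
  apply: lime_le.
    by apply: is_cvg_nneseries => n _ _; apply: integral_ge0.
  apply: nearW => n; apply: (@le_trans _ _
      (series (fun k => \int[mu]_(t in D) nrm (f k t)) n)%:E); last first.
    by rewrite lee_fin.
  rewrite /series/= -sumEFin; apply: lee_sum => k _.
  by rewrite /Rintegral fineK//; apply: integrable_fin_num => //; exact: integrable_nrm.
(* [A] is where the moduli have a finite sum. On the rest of [D] the function [F] is 0 by its
   definition, so [F] is the indicator of [A] times the sum and is a limit of measurable functions
   at every point. *)
pose A := D `&` [set t | G t \is a fin_num].
have mA : measurable A by exact: emeasurable_fin_num.
have sumA t : A t -> csummable (f ^~ t) /\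
    forall n, nrm (series (f ^~ t) n) <= fine (G t).
  move=> [Dt Gt].
  have le n : series (fun k => nrm (f k t)) n <= fine (G t).
    rewrite -lee_fin fineK// /series/= -sumEFin.
    exact: (@nneseries_lim_ge R (fun k => (nrm (f k t))%:E) xpredT 0 n).
  split; first by apply: rsum_bounded le => n; exact: nrm_ge0.
  by move=> n; apply: le_trans (le n); exact: nrm_series.
have sumAV t : D t -> csummable (f ^~ t) -> A t.
  move=> Dt st; split => //; rewrite /= ge0_fin_numE//.
  apply: (@le_lt_trans _ _ (limn (series (fun k => nrm (f k t))))%:E); last exact: ltry.
  apply: lime_le; first by apply: is_cvg_nneseries => n _ _.
  apply: nearW => n; rewrite sumEFin lee_fin.
  by apply: rsum_partial_le => // k; exact: nrm_ge0.
exists (fine \o G) => F.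
have FE t : D t -> F t = ((\1_A t)%:C : C) * csum (f ^~ t).
  move=> Dt; rewrite /F indicE; case: asboolP => st.
    by rewrite mem_set ?mul1r//; exact: sumAV.
  by rewrite memNset ?mul0r// => /sumA[].
split.
- apply: (@cmeas_eq (fun t => ((\1_A t)%:C : C) * csum (f ^~ t))).
    by move=> t Dt; rewrite FE.
  apply: (cmeas_cvg (f := fun n t => ((\1_A t)%:C : C) * series (f ^~ t) n)).
    move=> n; apply: cmeasM; first by apply: cmeas_real; exact: measurable_indic.
    exact: cmeas_sum (fun k => cintegrable_meas (fi k)).
  move=> t Dt; have [At|At] := pselect (A t).
    apply: cvgM; first exact: cvg_cst.
    by apply: csum_cvg; have [] := sumA _ At.
  rewrite indicE memNset// mul0r; under eq_fun do rewrite mul0r.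
  exact: cvg_cst.
- apply: (@le_integrable _ _ _ mu D mD _ G) => //.
    by apply/measurable_EFinP; apply: measurableT_comp.
  by move=> t Dt /=; case: (G t) => [r| |] //=; rewrite leey.
have aeG : {ae mu, forall t, D t -> G t \is a fin_num} by exact: integrable_ae.
apply: lebesgue_aeS aeG => t Gt Dt.
have At : A t by split => //; exact: Gt.
have [st tb] := sumA _ At; split => //.
by rewrite FE// indicE mem_set// mul1r; exact: csum_cvg.
Qed.

End Domain.

Lemma lebesgue_ae_nat (P : nat -> R -> Prop) :
  (forall n, {ae mu, forall t, P n t}) -> {ae mu, forall t, forall n, P n t}.
Proof.
move=> h.
have : mu.-negligible (\bigcup_n ~` [set t | P n t]).
  by apply: negligible_bigcup => n; exact: h.
apply: negligibleS => t /= /existsNP[n Pn]; exists n => //.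
Qed.

End ComplexIntegral.

(** * Means over the circle *)

Section CircleMean.
Variable R : realType.
Local Notation C := (Cx R).
Local Notation nrm := (@Normc.normc R).
Local Notation Re := (@complex.Re R).
Local Notation Im := (@complex.Im R).
Local Notation mu := (@lebesgue_measure R).
Implicit Types (u v : R -> C).

Lemma expi0 : expi (0 : R) = 1.
Proof. by rewrite /expi cos0 sin0. Qed.

Lemma expiD (s t : R) : expi (s + t) = expi s * expi t.
Proof.
apply: complex_eq; rewrite ?cReM ?cImM /= ?cosD ?sinD//.
by rewrite addrC.
Qed.

Lemma expi_2pi : expi (2 * pi : R) = 1.
Proof. by rewrite /expi mulrC mulr_natr cos2pi sin2pi. Qed.

Lemma nrm_expi (t : R) : nrm (expi t) = 1.
Proof. by rewrite nrmE /= cos2Dsin2 sqrtr1. Qed.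

Lemma expi_neq0 (t : R) : expi t != 0.
Proof. by rewrite -nrm_eq0 nrm_expi oner_neq0. Qed.

Lemma expiN (t : R) : expi (- t) = (expi t)^-1.
Proof.
by apply: (mulfI (expi_neq0 t)); rewrite -expiD subrr expi0 divff// expi_neq0.
Qed.

Lemma expiJ (t : R) : Num.conj (expi t) = expi (- t).
Proof.
have -> : Num.conj (expi t) = conjc (expi t) by [].
by rewrite /expi /= cosN sinN. Qed.

Lemma cts_expi (t : R) : expi x @[x --> t] --> expi t.
Proof.
by apply: ccvg_ReIm => /=; [exact: continuous_cos|exact: continuous_sin].
Qed.

Lemma cts_cintegrable (a b : R) u :
  (forall t, a <= t <= b -> u x @[x --> t] --> u t) -> cintegrable `[a, b] u.
Proof.
move=> uc; split; (apply: continuous_compact_integrable;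
    [exact: segment_compact|apply: continuous_in_subspaceT]).
  move=> t; rewrite inE /= in_itv /= => ht.
  by apply: ccvg_Re; exact: uc.
move=> t; rewrite inE /= in_itv /= => ht.
by apply: ccvg_Im; exact: uc.
Qed.

Lemma cint_split (a m b : R) u : a <= m <= b -> cintegrable `[a, b] u ->
  cint `[a, b] u = cint `[a, m] u + cint `[m, b] u.
Proof.
move=> /andP[am mb] [ir ii].
have sp (f : R -> R) : mu.-integrable `[a, b] (EFin \o f) ->
    \int[mu]_(t in `[a, b]) f t =
    \int[mu]_(t in `[a, m]) f t + \int[mu]_(t in `[m, b]) f t.
  move=> fi; apply/eqP; rewrite addrC -subr_eq; apply/eqP.
  rewrite Rintegral_itvB//.
  apply: Rintegral_itv_obnd_cbnd.
  apply: (@integrableS _ _ _ mu `[a, b]) => //.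
  by apply: subset_itvr; rewrite bnd_simp.
by rewrite /cint (sp (Re \o u))// (sp (Im \o u)).
Qed.

Lemma cint_cst (a b : R) (c : C) : a <= b ->
  cint `[a, b] (fun=> c) = (b - a)%:C * c.
Proof.
move=> ab.
have len : fine (mu `[a, b]) = b - a.
  rewrite lebesgue_measure_itv/= lte_fin; move: ab.
  by rewrite le_eqVlt => /predU1P[->|->//]; rewrite ltxx subrr.
by apply: complex_eq => /=; rewrite ?cReZ ?cImZ Rintegral_cst// len mulrC.
Qed.

Lemma integrable_cst (a b c : R) : mu.-integrable `[a, b] (EFin \o (fun=> c)).
Proof.
apply: continuous_compact_integrable; first exact: segment_compact.
by apply: continuous_in_subspaceT => t _; exact: cvg_cst.
Qed.

Lemma nrm_cint_cst (a b M : R) u : a <= b -> cintegrable `[a, b] u ->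
  (forall t, a <= t <= b -> nrm (u t) <= M) ->
  nrm (cint `[a, b] u) <= M * (b - a).
Proof.
move=> ab iu uM.
have := @nrm_cint_le R `[a, b] (measurable_itv _) u (fun=> M) iu
  (integrable_cst a b M).
rewrite Rintegral_cst//= lebesgue_measure_itv/= lte_fin.
have -> : fine (if a < b then (b%:E - a%:E)%E else 0%E) = b - a.
  by move: ab; rewrite le_eqVlt => /predU1P[->|->//]; rewrite ltxx subrr.
by apply => t; rewrite /= in_itv/= => /uM.
Qed.

Local Notation I0 := [set` `[(0 : R), 2 * pi]].

(** This is [circle_integral] in the angular variable: the two agree by unfolding when [u] is a
    function on the circle composed with [expi]. *)
Definition cmean u : C := (((2 * pi)^-1)%:C : C) * cint I0 u.

Lemma pi2_gt0 : 0 < 2 * pi :> R.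
Proof. by rewrite mulr_gt0 ?pi_gt0. Qed.

Lemma pi2_ge0 : 0 <= 2 * pi :> R.
Proof. exact: ltW pi2_gt0. Qed.

Lemma cmeanD u v : cintegrable I0 u -> cintegrable I0 v ->
  cmean (fun t => u t + v t) = cmean u + cmean v.
Proof. by move=> iu iv; rewrite /cmean cintD// mulrDr. Qed.

Lemma cmeanB u v : cintegrable I0 u -> cintegrable I0 v ->
  cmean (fun t => u t - v t) = cmean u - cmean v.
Proof. by move=> iu iv; rewrite /cmean cintB// mulrBr. Qed.

Lemma cmeanZ (c : C) u : cintegrable I0 u ->
  cmean (fun t => c * u t) = c * cmean u.
Proof. by move=> iu; rewrite /cmean cintZ// mulrCA. Qed.

Lemma eq_cmean u v : (forall t, I0 t -> u t = v t) -> cmean u = cmean v.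
Proof. by move=> uv; rewrite /cmean (eq_cint uv). Qed.

Lemma cmean_cst (c : C) : cmean (fun=> c) = c.
Proof.
rewrite /cmean cint_cst ?pi2_ge0// subr0 mulrA -rmorphM mulVf ?mul1r//.
by rewrite gt_eqF ?pi2_gt0.
Qed.

Lemma nrm_cmean_le M u : cintegrable I0 u ->
  (forall t, 0 <= t <= 2 * pi -> nrm (u t) <= M) -> nrm (cmean u) <= M.
Proof.
move=> iu /(nrm_cint_cst (ltW pi2_gt0) iu); rewrite subr0 => h.
rewrite /cmean nrmM nrm_real ger0_norm ?invr_ge0 ?pi2_ge0//.
by rewrite ler_pdivrMl ?pi2_gt0// [leRHS]mulrC.
Qed.

Lemma cintegrable_cts u : (forall t, u x @[x --> t] --> u t) -> cintegrable I0 u.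
Proof. by move=> uc; apply: cts_cintegrable => t _; exact: (uc t). Qed.

Lemma cmean_dct (f : nat -> R -> C) u M : (forall n, cintegrable I0 (f n)) ->
  (forall t, f n t @[n --> \oo] --> u t) ->
  (forall n t, nrm (f n t) <= M) ->
  cintegrable I0 u /\ cmean (f n) @[n --> \oo] --> cmean u.
Proof.
move=> fi fu fM.
have fm n : cmeas I0 (f n) by apply: cintegrable_meas.
have [h1 h2] := cint_dct_pt (measurable_itv _) fm (fun t _ => fu t)
  (integrable_cst 0 (2 * pi) M) (fun n t _ => fM n t).
by split; [exact: h1|apply: cvgM; [exact: cvg_cst|exact: h2]].
Qed.

Lemma cmean_csum (f : nat -> R -> C) (M : nat -> R) : cvgn (series M) ->
  (forall n, cintegrable I0 (f n)) ->
  (forall n t, nrm (f n t) <= M n) ->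
  cintegrable I0 (fun t => csum (f ^~ t)) /\
  cmean (fun t => csum (f ^~ t)) = csum (fun n => cmean (f n)).
Proof.
move=> cM fi fM.
have M0 n : 0 <= M n := le_trans (nrm_ge0 _) (fM n 0).
have sfi n := cint_series (measurable_itv _) n fi.
have sM n t : nrm (series (f ^~ t) n) <= limn (series M).
  apply: le_trans (nrm_series _ _) _.
  by apply: le_trans (rsum_partial_le n M0 cM); apply: ler_sum => i _; exact: fM.
have sc t : series (f ^~ t) n @[n --> \oo] --> csum (f ^~ t).
  by apply: csum_cvg; apply: summable_le cM _ => n; exact: fM.
have [ci cl] := cmean_dct (fun n => (sfi n).1) sc sM.
split; first exact: ci.
apply/esym/csumP; move: cl.
rewrite (_ : (fun n => cmean _) = series (fun n => cmean (f n)))//.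
by apply/funext => n; rewrite /cmean (sfi n).2 /series/= mulr_sumr.
Qed.

End CircleMean.

(** * Cauchy's formula *)

Section ComplexDerivative.
Variable R : realType.
Local Notation C := (Cx R).
Local Notation nrm := (@Normc.normc R).
Local Notation Re := (@complex.Re R).
Implicit Types (k f g : C -> C) (z w A : C).

Lemma near_nrmP z (P : C -> Prop) : (\forall w \near z, P w) <->
  exists2 d : R, 0 < d & forall w, nrm (w - z) < d -> P w.
Proof.
split=> [/nbhs_ballP[e /= e0 eP]|[d d0 dP]].
  move: e0; rewrite ltcE /= => /andP[/eqP im re].
  exists (Re e) => // w wz; apply: eP; rewrite /ball /= normCE ltcE /=.
  by rewrite im eqxx nrmB.
apply/nbhs_ballP; exists (d%:C : C); first by rewrite /= ltcR.
by move=> w; rewrite /ball /= normCE ltcR nrmB; exact: dP.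
Qed.

Lemma near_dnrmP z (P : C -> Prop) : (\forall w \near z^', P w) <->
  exists2 d : R, 0 < d & forall w, w != z -> nrm (w - z) < d -> P w.
Proof.
split=> [/near_nrmP[d d0 dP]|[d d0 dP]].
  by exists d => // w wz wd; apply: dP.
by apply/near_nrmP; exists d => // w wd wz; exact: dP.
Qed.

(** Free of division, so that [w = z] needs no separate treatment. The error estimates of the change
    to polar coordinates and of Goursat's argument use differentiability in this form. *)
Definition cderiv k z A := forall e : R, 0 < e ->
  exists2 d : R, 0 < d & forall w, nrm (w - z) < d ->
    nrm (k w - k z - A * (w - z)) <= e * nrm (w - z).

Lemma cderivP k z : derivable k z 1 <-> exists A, cderiv k z A.
Proof.
split=> [dk|[A kA]].
  exists (lim (h^-1 *: ((k \o shift z) (h *: (1 : C)) - k z) @[h --> 0^'])).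
  set A := lim _; move/ccvg_lt : dk => dk e e0.
  have /near_dnrmP[d d0 dP] := dk e e0; exists d => // w wd.
  have [->|wz] := eqVneq w z; first by rewrite !subrr mulr0 subrr nrm0 mulr0.
  have hz : w - z != 0 by rewrite subr_eq0.
  have := dP (w - z) hz; rewrite subr0 => /(_ wd).
  rewrite /= /shift /= /GRing.scale /= mulr1 subrK -/A => h.
  have -> : k w - k z - A * (w - z) =
      ((w - z)^-1 * (k w - k z) - A) * (w - z).
    by rewrite mulrBl mulrAC mulVf// mul1r.
  by rewrite nrmM; apply: ler_wpM2r; [exact: nrm_ge0|exact: ltW].
apply/cvg_ex; exists A; apply/ccvg_lt => e e0; apply/near_dnrmP.
have e2 : 0 < e / 2 by rewrite divr_gt0.
have [d d0 dP] := kA _ e2; exists d => // h h0; rewrite subr0 => hd.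
rewrite /= /shift /= /GRing.scale /= mulr1.
have := dP (h + z); rewrite addrK => /(_ hd) hA.
have -> : h^-1 * (k (h + z) - k z) - A = h^-1 * (k (h + z) - k z - A * h).
  by rewrite [RHS]mulrBr [h^-1 * (A * h)]mulrC mulfK.
have nh : 0 < nrm h by rewrite nrm_gt0.
rewrite nrmM nrmV mulrC ltr_pdivrMr//; apply: le_lt_trans hA _.
by rewrite ltr_pM2r// ltr_pdivrMr// ltr_pMr// ltr1n.
Qed.

Lemma cderiv_cts k z A : cderiv k z A -> k w @[w --> z] --> k z.
Proof.
move=> kA; apply/(@ccvg_lt R _ (nbhs z)) => e e0; apply/near_nrmP.
have [d d0 dP] := kA 1 ltr01.
have nA : 0 < 1 + nrm A by rewrite ltr_pwDl// nrm_ge0.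
exists (Num.min d (e / (1 + nrm A))).
  by rewrite lt_min d0 divr_gt0.
move=> w; rewrite lt_min => /andP[/dP h1 h2].
have -> : k w - k z = (k w - k z - A * (w - z)) + A * (w - z) by ring.
apply: le_lt_trans (nrmD _ _) _; rewrite nrmM.
apply: le_lt_trans (lerD h1 (lexx _)) _; rewrite -mulrDl mulrC.
by rewrite -ltr_pdivlMr.
Qed.

Lemma derivable_cts k z : derivable k z 1 -> k w @[w --> z] --> k z.
Proof. by move=> /cderivP[A]; exact: cderiv_cts. Qed.

Lemma ccts_comp (T : Type) (F : set_system T) (FF : Filter F) (u : T -> C) k z :
  k w @[w --> z] --> k z -> u x @[x --> F] --> z -> k (u x) @[x --> F] --> k z.
Proof. by move=> kz uz; apply: cvg_comp uz kz. Qed.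

End ComplexDerivative.

(** * Goursat's theorem for rectangles *)

Section Goursat.
Variable R : realType.
Local Notation C := (Cx R).
Local Notation nrm := (@Normc.normc R).
Implicit Types (H : R -> R -> C).

Local Notation i2 := ('i%C : C).

Lemma nrm_i : nrm i2 = 1.
Proof. by rewrite nrmE /= expr0n expr1n add0r sqrtr1. Qed.

(* Integral of H(s + it) over the boundary of [a, a + l] x [c, c + k], with
   opposite sides paired. *)
Definition rect_int H (a c l k : R) : C :=
  cint `[a, a + l] (fun s => H s c - H s (c + k)) +
  i2 * cint `[c, c + k] (fun t => H (a + l) t - H a t).

(** Complex differentiability at [s0 + i t0] when [H] is read as a function of [s + i t]. *)
Definition diff_at H (s0 t0 : R) := exists A : C, forall e : R, 0 < e ->
  exists2 d : R, 0 < d & forall s t, `|s - s0| < d -> `|t - t0| < d ->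
    nrm (H s t - H s0 t0 - A * ((s - s0)%:C + i2 * (t - t0)%:C))
      <= e * (`|s - s0| + `|t - t0|).

Lemma nrm_st (s t : R) : nrm ((s%:C : C) + i2 * t%:C) <= `|s| + `|t|.
Proof. by apply: le_trans (nrmD _ _) _; rewrite nrmM nrm_i mul1r !nrm_real. Qed.

Lemma diff_at_lip H s0 t0 : diff_at H s0 t0 -> exists K d : R, [/\ 0 < K, 0 < d &
  forall s t, `|s - s0| < d -> `|t - t0| < d ->
    nrm (H s t - H s0 t0) <= K * (`|s - s0| + `|t - t0|)].
Proof.
move=> [A HA]; have [d d0 dP] := HA 1 ltr01.
exists (1 + nrm A), d; split => //; first by rewrite ltr_pwDl// nrm_ge0.
move=> s t sd td.
have -> : H s t - H s0 t0 =
  (H s t - H s0 t0 - A * ((s - s0)%:C + i2 * (t - t0)%:C)) +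
  A * ((s - s0)%:C + i2 * (t - t0)%:C) by ring.
apply: le_trans (nrmD _ _) _; rewrite mulrDl; apply: lerD; first exact: dP.
by rewrite nrmM; apply: ler_wpM2l (nrm_ge0 _) _ _ (nrm_st _ _).
Qed.

Lemma diff_at_cts H s0 t0 : diff_at H s0 t0 ->
  (H s t0 @[s --> s0] --> H s0 t0) /\ (H s0 t @[t --> t0] --> H s0 t0).
Proof.
move=> /diff_at_lip[K [d [K0 d0 dP]]].
have z0 : (0 : R) < d by [].
split.
  apply/(@ccvg_lt R _ (nbhs s0)) => e e0; apply/nbhs_ballP.
  exists (Num.min d (e / K)); first by rewrite /= lt_min d0 divr_gt0.
  move=> x; rewrite /ball /= lt_min distrC => /andP[xd xe].
  have := dP x t0 xd; rewrite subrr normr0 => /(_ d0).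
  by rewrite addr0 => /le_lt_trans; apply; rewrite mulrC -ltr_pdivlMr.
apply/(@ccvg_lt R _ (nbhs t0)) => e e0; apply/nbhs_ballP.
exists (Num.min d (e / K)); first by rewrite /= lt_min d0 divr_gt0.
move=> x; rewrite /ball /= lt_min distrC => /andP[xd xe].
have := dP s0 x; rewrite subrr normr0 => /(_ d0 xd).
by rewrite add0r => /le_lt_trans; apply; rewrite mulrC -ltr_pdivlMr.
Qed.

Let dist_le (a l s s0 : R) : a <= s <= a + l -> a <= s0 <= a + l ->
  `|s - s0| <= l.
Proof.
by move=> /andP[? ?] /andP[? ?]; rewrite ler_norml; apply/andP; split; lra.
Qed.

Let halves (a l : R) : 0 <= l -> [/\ 0 <= l / 2, a <= a + l / 2,
  a + l / 2 <= a + l & a + l / 2 + l / 2 <= a + l].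
Proof. by move=> ?; split; lra. Qed.

Let quarter_arith (x x1 x2 x3 x4 : R) : x <= x1 + x2 + (x3 + x4) ->
  x1 < x / 4 -> x2 < x / 4 -> x3 < x / 4 -> x / 4 <= x4.
Proof. by move=> *; lra. Qed.

(** Dependent choice in which the stage is carried along with the point, because both the invariant
    and the relation between successive points vary with [n]. *)
Let nested_choice (T : Type) (P : nat -> T -> Prop) (Q : nat -> T -> T -> Prop)
    (x0 : T) : P 0 x0 ->
    (forall n x, P n x -> exists y, P n.+1 y /\ Q n x y) ->
  exists x : nat -> T, (forall n, P n (x n)) /\ forall n, Q n (x n) (x n.+1).
Proof.
move=> P0 PQ.
have step (p : {nx : nat * T | P nx.1 nx.2}) : {q : {nx : nat * T | P nx.1 nx.2} |
    (sval q).1 = (sval p).1.+1 /\ Q (sval p).1 (sval p).2 (sval q).2}.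
  case: p => [[n x] Px] /=; have [y [Py Qy]] := cid (PQ _ _ Px).
  by exists (exist _ (n.+1, y) Py).
have [f [f0 fS]] := dependent_choice step (exist _ (0, x0) P0).
have fn n : (sval (f n)).1 = n.
  by elim: n => [|n IH]; [rewrite f0|rewrite (fS n).1 IH].
exists (fun n => (sval (f n)).2); split => n.
  by rewrite -{1}(fn n); exact: (svalP (f n)).
by have := (fS n).2; rewrite fn.
Qed.

Let final_arith (eta D : R) n : 0 < D ->
  2 * (eta / (4 * D ^+ 2) * (D / 2 ^+ n)) * (D / 2 ^+ n) = eta / 4 ^+ n / 2.
Proof.
move=> D0; rewrite (_ : (4 : R) ^+ n = (2 ^+ n) ^+ 2); last first.
  by rewrite -exprM mulnC exprM; congr (_ ^+ _); ring.
have n0 : (2 : R) ^+ n != 0 by rewrite expf_neq0.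
by have D1 : D != 0; [rewrite gt_eqF|field; rewrite n0 D1].
Qed.

Section Rectangle.
Variables (H : R -> R -> C) (a0 c0 l0 k0 : R).
Hypothesis Hd : forall s t, a0 <= s <= a0 + l0 -> c0 <= t <= c0 + k0 ->
  diff_at H s t.

Let inside a c l k := [/\ 0 <= l, 0 <= k, a0 <= a, a + l <= a0 + l0 &
  c0 <= c /\ c + k <= c0 + k0].

Let iH1 a c l k t : inside a c l k -> c <= t <= c + k ->
  cintegrable `[a, a + l] (H ^~ t).
Proof.
move=> [l_ge0 k_ge0 ha hal [hc hck]] /andP[ct tc].
apply: cts_cintegrable => s /andP[as_ sa].
have hs : a0 <= s <= a0 + l0 by apply/andP; split; lra.
have ht : c0 <= t <= c0 + k0 by apply/andP; split; lra.
exact: (diff_at_cts (Hd hs ht)).1.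
Qed.

Let iH2 a c l k s : inside a c l k -> a <= s <= a + l ->
  cintegrable `[c, c + k] (H s).
Proof.
move=> [l_ge0 k_ge0 ha hal [hc hck]] /andP[ct tc].
apply: cts_cintegrable => t /andP[as_ sa].
have hs : a0 <= s <= a0 + l0 by apply/andP; split; lra.
have ht : c0 <= t <= c0 + k0 by apply/andP; split; lra.
exact: (diff_at_cts (Hd hs ht)).2.
Qed.

(** The middle line [s = a + l / 2] is traversed in opposite directions by the two halves, so its
    contributions cancel. *)
Let split_s a c l k : inside a c l k ->
  rect_int H a c l k =
  rect_int H a c (l / 2) k + rect_int H (a + l / 2) c (l / 2) k.
Proof.
move=> ins; have [l_ge0 k_ge0 ha hal [hc hck]] := ins.
rewrite /rect_int.
have -> : a + l / 2 + l / 2 = a + l by field.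
rewrite (@cint_split _ a (a + l / 2)); first last.
- apply: cintegrableB => //; apply: (iH1 ins); apply/andP; split; lra.
- by apply/andP; split; lra.
have -> : cint `[c, c + k] (fun t => H (a + l) t - H a t) =
  cint `[c, c + k] (fun t => H (a + l / 2) t - H a t) +
  cint `[c, c + k] (fun t => H (a + l) t - H (a + l / 2) t).
  rewrite -cintD//; first by apply: eq_cint => t _; ring.
  - by apply: cintegrableB => //; apply: (iH2 ins); apply/andP; split; lra.
  - by apply: cintegrableB => //; apply: (iH2 ins); apply/andP; split; lra.
ring.
Qed.

Let split_t a c l k : inside a c l k ->
  rect_int H a c l k =
  rect_int H a c l (k / 2) + rect_int H a (c + k / 2) l (k / 2).
Proof.
move=> ins; have [l_ge0 k_ge0 ha hal [hc hck]] := ins.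
rewrite /rect_int.
have -> : c + k / 2 + k / 2 = c + k by field.
rewrite (@cint_split _ c (c + k / 2) (c + k)); first last.
- apply: cintegrableB => //; apply: (iH2 ins); apply/andP; split; lra.
- by apply/andP; split; lra.
have -> : cint `[a, a + l] (fun s => H s c - H s (c + k)) =
  cint `[a, a + l] (fun s => H s c - H s (c + k / 2)) +
  cint `[a, a + l] (fun s => H s (c + k / 2) - H s (c + k)).
  rewrite -cintD//; first by apply: eq_cint => t _; ring.
  - by apply: cintegrableB => //; apply: (iH1 ins); apply/andP; split; lra.
  - by apply: cintegrableB => //; apply: (iH1 ins); apply/andP; split; lra.
ring.
Qed.

(** Pigeonhole: the integrals over the four quarters add up to that over the rectangle, so their
    moduli cannot all be below a fourth of its modulus. *)
Let quarter a c l k : inside a c l k -> exists p : R * R,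
  [/\ inside p.1 p.2 (l / 2) (k / 2),
      a <= p.1 /\ p.1 + l / 2 <= a + l, c <= p.2 /\ p.2 + k / 2 <= c + k &
      nrm (rect_int H a c l k) / 4 <= nrm (rect_int H p.1 p.2 (l / 2) (k / 2))].
Proof.
move=> ins; have [l_ge0 k_ge0 ha hal [hc hck]] := ins.
have sub a' c' l' k' : 0 <= l' -> 0 <= k' -> a <= a' -> a' + l' <= a + l ->
    c <= c' -> c' + k' <= c + k -> inside a' c' l' k'.
  move=> ? ? ? al ? ck; split => //; [exact: le_trans ha _|exact: le_trans al hal|].
  by split; [exact: le_trans hc _|exact: le_trans ck hck].
have [l1 l2 l3 l4] := halves a l_ge0; have [k1 k2 k3 k4] := halves c k_ge0.
have i1 : inside a c (l / 2) k by apply: sub.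
have i2 : inside (a + l / 2) c (l / 2) k by apply: sub.
have j1 : inside a c (l / 2) (k / 2) by apply: sub.
have j2 : inside a (c + k / 2) (l / 2) (k / 2) by apply: sub.
have j3 : inside (a + l / 2) c (l / 2) (k / 2) by apply: sub.
have j4 : inside (a + l / 2) (c + k / 2) (l / 2) (k / 2) by apply: sub.
have := split_s ins; rewrite (split_t i1) (split_t i2).
set x := rect_int H a c l k.
set x1 := rect_int H a c _ _; set x2 := rect_int H a (c + _) _ _.
set x3 := rect_int H _ c _ _; set x4 := rect_int H _ (c + _) _ _.
move=> xE; have : nrm x <= nrm x1 + nrm x2 + (nrm x3 + nrm x4).
  by rewrite xE; apply: le_trans (nrmD _ _) _; apply: lerD; exact: nrmD.
move=> xle.
have [h1|h1] := leP (nrm x / 4) (nrm x1); first by exists (a, c).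
have [h2|h2] := leP (nrm x / 4) (nrm x2); first by exists (a, c + k / 2).
have [h3|h3] := leP (nrm x / 4) (nrm x3); first by exists (a + l / 2, c).
exists (a + l / 2, c + k / 2); split => //=.
exact: quarter_arith xle h1 h2 h3.
Qed.

Hypotheses (l0_ge0 : 0 <= l0) (k0_ge0 : 0 <= k0).

Let P n (p : R * R) := inside p.1 p.2 (l0 / 2 ^+ n) (k0 / 2 ^+ n) /\
  nrm (rect_int H a0 c0 l0 k0) / 4 ^+ n <=
    nrm (rect_int H p.1 p.2 (l0 / 2 ^+ n) (k0 / 2 ^+ n)).

Let nested : exists p : nat -> R * R, (forall n, P n (p n)) /\
  forall n, [/\ (p n).1 <= (p n.+1).1, (p n).2 <= (p n.+1).2,
   (p n.+1).1 + l0 / 2 ^+ n.+1 <= (p n).1 + l0 / 2 ^+ n &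
   (p n.+1).2 + k0 / 2 ^+ n.+1 <= (p n).2 + k0 / 2 ^+ n].
Proof.
have P0 : P 0 (a0, c0).
  by rewrite /P /= !expr0 !divr1; split => //; split.
apply: (nested_choice (Q := fun n p q =>
  [/\ p.1 <= q.1, p.2 <= q.2,
   q.1 + l0 / 2 ^+ n.+1 <= p.1 + l0 / 2 ^+ n &
   q.2 + k0 / 2 ^+ n.+1 <= p.2 + k0 / 2 ^+ n]) P0) => n p [ins big].
have [q [q1 [q2 q2'] [q3 q3'] q4]] := quarter ins.
have hl x : x / 2 ^+ n.+1 = x / 2 ^+ n / 2 :> R by rewrite exprSr invfM mulrA.
exists q; rewrite /P !hl; split; last by split.
split; first exact: q1.
apply: le_trans q4.
have -> : nrm (rect_int H a0 c0 l0 k0) / 4 ^+ n.+1 =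
          nrm (rect_int H a0 c0 l0 k0) / 4 ^+ n / 4.
  by rewrite exprSr invfM mulrA.
by rewrite ler_pM2r ?invr_gt0.
Qed.

Let limit_pt (u : nat -> R) (l a b : R) : 0 <= l -> a <= b ->
  (forall n, u n <= u n.+1) -> (forall n, u n.+1 + l / 2 ^+ n.+1 <= u n + l / 2 ^+ n) ->
  (forall n, a <= u n /\ u n + l / 2 ^+ n <= b) ->
  exists2 x : R, a <= x <= b & forall n, u n <= x <= u n + l / 2 ^+ n.
Proof.
move=> l_ge0 ab ui ud uab.
have lp n : 0 <= l / 2 ^+ n by rewrite divr_ge0// exprn_ge0.
have nd : nondecreasing_seq u by apply/nondecreasing_seqP.
have ni : nonincreasing_seq (fun n => u n + l / 2 ^+ n) by apply/nonincreasing_seqP.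
have ub m n : u m <= u n + l / 2 ^+ n.
  have [mn|nm] := leqP m n.
    by apply: le_trans (nd _ _ mn) _; rewrite lerDl.
  apply: le_trans (ni _ _ (ltnW nm)); rewrite lerDl.
  exact: lp.
have cu : cvgn u.
  by apply: nondecreasing_is_cvgn => //; exists (u 0 + l / 2 ^+ 0) => _ [n _ <-].
have h n : u n <= limn u <= u n + l / 2 ^+ n.
  rewrite nondecreasing_cvgn_le//=; apply: limr_le => //.
  by apply: nearW => m; exact: ub.
exists (limn u) => //; have /andP[h1 h2] := h 0; have [h3 h4] := uab 0.
by rewrite (le_trans h3 h1) (le_trans h2 h4).
Qed.

(** If the integral had modulus [eta > 0], quartering would give rectangles shrinking to a point
    with integrals at least [eta / 4 ^+ n]. At that point [H] is affine up to an error [E] that is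
    small relative to the side lengths, and the affine part integrates to 0. This makes a late
    integral at most half of [eta / 4 ^+ n]. *)
Lemma goursat : rect_int H a0 c0 l0 k0 = 0.
Proof.
apply/eqP; rewrite -nrm_eq0; apply/negP => /negP nz.
have eta0 : 0 < nrm (rect_int H a0 c0 l0 k0) by rewrite lt_def nz nrm_ge0.
set eta := nrm (rect_int _ _ _ _ _) in eta0.
have [p [pP pm]] := nested.
have [s0 s0ab s0p] : exists2 x : R, a0 <= x <= a0 + l0 &
    forall n, (p n).1 <= x <= (p n).1 + l0 / 2 ^+ n.
  apply: limit_pt => [||n|n|n]; [exact: l0_ge0|by rewrite lerDl| | |].
  - by case: (pm n).
  - by case: (pm n).
  - by case: (pP n) => -[].
have [t0 t0ab t0p] : exists2 x : R, c0 <= x <= c0 + k0 &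
    forall n, (p n).2 <= x <= (p n).2 + k0 / 2 ^+ n.
  apply: limit_pt => [||n|n|n]; [exact: k0_ge0|by rewrite lerDl| | |].
  - by case: (pm n).
  - by case: (pm n).
  - by case: (pP n) => -[_ _ _ _ [] ].
have [A HA] := Hd s0ab t0ab.
(* Adding 1 keeps [D] positive for a degenerate rectangle. With the next choice of [e], the bound
   [2 e (D / 2 ^ n) ^ 2] for the boundary integral of [E] is exactly half of [eta / 4 ^ n]. *)
pose D := l0 + k0 + 1; have D0 : 0 < D by rewrite /D; lra.
pose e := eta / (4 * D ^+ 2).
have e0 : 0 < e by rewrite divr_gt0// mulr_gt0// exprn_gt0.
have [d d0 dP] := HA _ e0.
have [n hn] : exists n, D / 2 ^+ n < d.
  have : (fun n => D * 2^-1 ^+ n) @ \oo --> (0 : R).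
    rewrite -[X in _ --> X](mulr0 D); apply: cvgM; first exact: cvg_cst.
    by apply: cvg_expr; rewrite ger0_norm// invf_lt1// ltr1n.
  move=> /cvgrPdist_lt/(_ _ d0)[n _ /(_ n (leqnn n))/=].
  rewrite sub0r normrN ger0_norm ?mulr_ge0 ?exprn_ge0 ?(ltW D0)// exprVn => ?.
  by exists n.
have [ins big] := pP n; have [l_ge0 k_ge0 ha hal [hc hck]] := ins.
move: ins big l_ge0 k_ge0 ha hal hc hck (s0p n) (t0p n).
set a := (p n).1; set c := (p n).2; set l := l0 / _; set k := k0 / _.
move=> ins big l_ge0 k_ge0 ha hal hc hck /andP[as0 s0a] /andP[ct0 t0c].
have lkD : l + k <= D / 2 ^+ n.
  by rewrite /l /k -mulrDl ler_pM2r ?invr_gt0 ?exprn_gt0// /D lerDl.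
pose E s t := H s t - H s0 t0 - A * ((s - s0)%:C + i2 * (t - t0)%:C).
have Eb s t : a <= s <= a + l -> c <= t <= c + k -> nrm (E s t) <= e * (D / 2 ^+ n).
  move=> /andP[s1 s2] /andP[t1 t2].
  have hs : `|s - s0| <= l by apply: (dist_le (a := a)); rewrite ?s1 ?s2 ?as0.
  have ht : `|t - t0| <= k by apply: (dist_le (a := c)); rewrite ?t1 ?t2 ?ct0.
  apply: le_trans (dP s t _ _) _.
  - apply: le_lt_trans hs _; apply: le_lt_trans hn; apply: le_trans lkD.
    by rewrite lerDl.
  - apply: le_lt_trans ht _; apply: le_lt_trans hn; apply: le_trans lkD.
    by rewrite lerDr.
  by rewrite ler_pM2l//; apply: le_trans lkD; exact: lerD.
have al : a <= a + l by rewrite lerDl.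
have ck : c <= c + k by rewrite lerDl.
have ac1 : c <= c <= c + k by rewrite lexx.
have ac2 : c <= c + k <= c + k by rewrite lexx andbT.
have aa1 : a <= a <= a + l by rewrite lexx.
have aa2 : a <= a + l <= a + l by rewrite lexx andbT.
have iHs := cintegrableB (measurable_itv _) (iH1 ins ac1) (iH1 ins ac2).
have iHt := cintegrableB (measurable_itv _) (iH2 ins aa2) (iH2 ins aa1).
have cc x y (w : C) : x <= y -> cintegrable `[x, y] (fun=> w).
  by move=> xy; apply: cts_cintegrable => z _; exact: cvg_cst.
(* The affine part drops out: on the horizontal sides it leaves a multiple [k l] of [i A], on the
   vertical sides the opposite one. *)
have R1 : rect_int H a c l k =
   cint `[a, a + l] (fun s => E s c - E s (c + k)) +
   i2 * cint `[c, c + k] (fun t => E (a + l) t - E a t).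
  have -> : cint `[a, a + l] (fun s => E s c - E s (c + k)) =
      cint `[a, a + l] (fun s => (H s c - H s (c + k)) - - (A * (i2 * k%:C))).
    apply: eq_cint => s _; rewrite /E.
    have -> : c + k - t0 = (c - t0) + k by ring.
    by rewrite rmorphD /=; ring.
  have -> : cint `[c, c + k] (fun t => E (a + l) t - E a t) =
      cint `[c, c + k] (fun t => (H (a + l) t - H a t) - A * l%:C).
    apply: eq_cint => t _; rewrite /E.
    have -> : a + l - s0 = (a - s0) + l by ring.
    by rewrite rmorphD /=; ring.
  rewrite (cintB (measurable_itv _) iHs (cc _ _ _ al)).
  rewrite (cintB (measurable_itv _) iHt (cc _ _ _ ck)).
  rewrite !cint_cst// /rect_int.
  have -> : a + l - a = l by ring.
  have -> : c + k - c = k by ring.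
  ring.
have EI1 : cintegrable `[a, a + l] (fun s => E s c - E s (c + k)).
  apply: (eq_cintegrable _ _ (cintegrableB (measurable_itv _) iHs
     (cc _ _ (- (A * (i2 * k%:C))) al))) => // s _; rewrite /E.
  have -> : c + k - t0 = (c - t0) + k by ring.
  by rewrite rmorphD /=; ring.
have EI2 : cintegrable `[c, c + k] (fun t => E (a + l) t - E a t).
  apply: (eq_cintegrable _ _ (cintegrableB (measurable_itv _) iHt
     (cc _ _ (A * l%:C) ck))) => // t _; rewrite /E.
  have -> : a + l - s0 = (a - s0) + l by ring.
  by rewrite rmorphD /=; ring.
set x := e * (D / 2 ^+ n) in Eb.
have := nrm_cint_cst al EI1 (M := 2 * x); rewrite -addrA addrCA subrr addr0 => B1.
have := nrm_cint_cst ck EI2 (M := 2 * x); rewrite -addrA addrCA subrr addr0 => B2.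
have dbl u v : nrm u <= x -> nrm v <= x -> nrm (u - v) <= 2 * x.
  move=> ux vx; apply: le_trans (nrmD _ _) _; rewrite nrmN.
  by rewrite mulr_natl mulr2n lerD.
have : eta / 4 ^+ n <= 2 * x * (l + k).
  apply: le_trans big _; rewrite R1; apply: le_trans (nrmD _ _) _.
  rewrite nrmM nrm_i mul1r mulrDr; apply: lerD.
    by apply: B1 => s hs; apply: dbl; exact: Eb.
  by apply: B2 => s hs; apply: dbl; exact: Eb.
have x0 : 0 <= 2 * x.
  apply: mulr_ge0 => //; apply: mulr_ge0; first exact: ltW.
  by apply: divr_ge0; [exact: ltW|exact: exprn_ge0].
move=> /le_trans/(_ (ler_wpM2l x0 lkD)); apply/negP; rewrite -ltNge.
have -> : 2 * x * (D / 2 ^+ n) = eta / 4 ^+ n / 2 by exact: final_arith.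
have q0 : 0 < eta / 4 ^+ n by rewrite divr_gt0// exprn_gt0.
by rewrite ltr_pdivrMr// ltr_pMr// ltr1n.
Qed.

End Rectangle.
End Goursat.

(** * Circular means on an annulus *)

Section PolarCoordinates.
Variable R : realType.
Local Notation C := (Cx R).
Local Notation nrm := (@Normc.normc R).
Local Notation Re := (@complex.Re R).
Local Notation Im := (@complex.Im R).
Local Notation I0 := [set` `[(0 : R), 2 * pi]].
Local Notation i2 := ('i%C : C).
Implicit Types (k h : C -> C) (z w A : C).

Lemma is_derive0_expansion (f : R -> R) (f' : R) : is_derive (0 : R) 1 f f' ->
  forall e : R, 0 < e -> exists2 d : R, 0 < d &
    forall x, `|x| < d -> `|f x - f 0 - f' * x| <= e * `|x|.
Proof.
move=> [df vf] e e0; move: df; rewrite /derivable => /cvgrPdist_lt/(_ e e0).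
rewrite -[lim _]/('D_1 f 0) vf => /nbhs_ballP[d /= d0 dP].
exists d => // x xd; have [->|x0] := eqVneq x 0.
  by rewrite subrr mulr0 subrr normr0 mulr0.
have := dP x; rewrite /ball /= sub0r normrN => /(_ xd x0).
rewrite /= /shift /= addr0 /GRing.scale /= mulr1 => h.
have -> : f x - f 0 - f' * x = - ((f' - x^-1 * (f x - f 0)) * x).
  by rewrite mulrBl mulrAC mulVf// mul1r opprB.
by rewrite normrN normrM ler_wpM2r// ltW.
Qed.

Lemma expR_expi_expansion (e : R) : 0 < e -> exists2 d : R, 0 < d &
  forall x y : R, `|x| < d -> `|y| < d ->
    nrm ((expR x)%:C * expi y - 1 - (x%:C + i2 * y%:C)) <= e * (`|x| + `|y|).
Proof.
(* The error terms below add up to [5 e1 |x| + 3 e1 |y|], hence the 8. *)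
move=> e0; pose e1 := e / 8; have e10 : 0 < e1 by rewrite divr_gt0.
have [d1 d10 h1] := is_derive0_expansion (is_derive_expR 0) e10.
have [d2 d20 h2] := is_derive0_expansion (is_derive_sin 0) e10.
have [d3 d30 h3] := is_derive0_expansion (is_derive_cos 0) e10.
have [d4 d40 h4] := is_derive0_expansion (is_derive_expR 0) (ltr01 : 0 < (1 : R)).
have [d5 d50 h5] := is_derive0_expansion (is_derive_sin 0) (ltr01 : 0 < (1 : R)).
exists (Num.min (Num.min (Num.min d1 d2) (Num.min d3 d4))
                (Num.min (Num.min d5 1) e1)).
  by rewrite !lt_min d10 d20 d30 d40 d50 ltr01 e10.
move=> x y; rewrite !lt_min.
move=> /andP[/andP[/andP[x1 x2] /andP[x3 x4]] /andP[/andP[x5 x6] x7]].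
move=> /andP[/andP[/andP[y1 y2] /andP[y3 y4]] /andP[/andP[y5 y6] y7]].
have := h1 x x1; have := h2 y y2; have := h3 y y3; have := h4 x x4.
rewrite /expi.
have := h5 y y5; rewrite expR0 sin0 cos0 !(oppr0, mul0r, addr0, mul1r).
move: (expR x) (sin y) (cos y) (cos_max y) => X S K K1 hS hX hK hS' hX'.
apply: le_trans (nrm_le_ReIm _) _.
have -> : Re ((X%:C : C) * (K +i* S) - 1 - (x%:C + i2 * y%:C)) =
    (X - 1 - x) * K + (1 + x) * (K - 1).
  by rewrite !(cReB, cReD, cReM) /=; ring.
have -> : Im ((X%:C : C) * (K +i* S) - 1 - (x%:C + i2 * y%:C)) =
    (X - 1) * S + (S - y).
  by rewrite !(cImB, cImD, cImM) /=; ring.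
have nx : 0 <= `|x| by []; have ny : 0 <= `|y| by [].
have b1 : `|(X - 1 - x) * K| <= e1 * `|x|.
  by rewrite normrM -[leRHS]mulr1; apply: ler_pM.
have b2 : `|(1 + x) * (K - 1)| <= 2 * (e1 * `|y|).
  rewrite normrM; apply: ler_pM => //.
  apply: le_trans (ler_normD _ _) _; rewrite normr1 [leRHS](_ : 2 = 1 + 1)//.
  by rewrite lerD2l; exact: ltW.
have b3 : `|X - 1| <= 2 * `|x|.
  have -> : X - 1 = (X - 1 - x) + x by ring.
  by apply: le_trans (ler_normD _ _) _; rewrite mulr_natl mulr2n lerD2r.
have b4 : `|S| <= 2 * `|y|.
  have -> : S = (S - y) + y by ring.
  by apply: le_trans (ler_normD _ _) _; rewrite mulr_natl mulr2n lerD2r.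
have b5 : `|(X - 1) * S| <= 2 * `|x| * (2 * e1).
  rewrite normrM; apply: ler_pM => //.
  by apply: le_trans b4 _; rewrite ler_pM2l// ltW.
apply: le_trans (lerD (ler_normD _ _) (ler_normD _ _)) _.
have e1E : e = 8 * e1 by rewrite /e1; field.
rewrite e1E; have ex : 0 <= e1 * `|x| by rewrite mulr_ge0 // ltW.
have ey : 0 <= e1 * `|y| by rewrite mulr_ge0 // ltW.
have -> : 8 * e1 * (`|x| + `|y|) = 8 * (e1 * `|x|) + 8 * (e1 * `|y|) by ring.
rewrite -mulrA in b5.
apply: (@le_trans _ _ ((e1 * `|x| + 2 * (e1 * `|y|)) +
    (4 * (e1 * `|x|) + e1 * `|y|))).
  apply: lerD; first exact: lerD.
  apply: lerD => //; apply: le_trans b5 _.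
  by rewrite [leRHS](_ : _ = 2 * (`|x| * (2 * e1)))//; ring.
move: (e1 * `|x|) (e1 * `|y|) ex ey; clear => p q *; lra.
Qed.

(** Chain rule for [exp (s + i t)], whose derivative is its own value [z]; hence the derivative
    [A * z]. *)
Lemma polar_diff k (s0 t0 : R) A : cderiv k ((expR s0)%:C * expi t0) A ->
  diff_at (fun s t => k ((expR s)%:C * expi t)) s0 t0.
Proof.
set z := _ * _ => kA; exists (A * z) => e e0.
have z0 := nrm_ge0 z; have A0 := nrm_ge0 A.
have a0 : 0 < 2 * (nrm A * nrm z + 1).
  by rewrite mulr_gt0// ltr_wpDl// mulr_ge0.
have b0 : 0 < 4 * (nrm z + 1) by rewrite mulr_gt0// ltr_wpDl.
pose e1 := Num.min 1 (e / (2 * (nrm A * nrm z + 1))).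
have e10 : 0 < e1 by rewrite lt_min ltr01 divr_gt0.
pose e2 := e / (4 * (nrm z + 1)); have e20 : 0 < e2 by rewrite divr_gt0.
have [d1 d10 h1] := expR_expi_expansion e10.
have [d2 d20 h2] := kA _ e20.
(* With both increments that small, their sum [N] is below [d2 / (4 (|z| + 1))], and
   [|z E - z| <= 2 |z| N] stays below [d2]. *)
exists (Num.min d1 (d2 / (8 * (nrm z + 1)))).
  by rewrite lt_min d10 divr_gt0// mulr_gt0// ltr_wpDl.
move=> s t; rewrite !lt_min => /andP[s1 s2] /andP[t1 t2].
have := h1 _ _ s1 t1; set N := `|_| + `|_|; 
set zt : C := (s - s0)%:C + i2 * (t - t0)%:C => hE.
have N0 : 0 <= N by rewrite addr_ge0.
set E := (expR (s - s0))%:C * expi (t - t0) in hE.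
have EE : (expR s)%:C * expi t = z * E.
  have -> : s = s0 + (s - s0) by ring.
  have -> : t = t0 + (t - t0) by ring.
  rewrite expRD expiD rmorphM /= /z /E.
  ring.
have nE : nrm (z * E - z) <= nrm z * (2 * N).
  have -> : z * E - z = z * ((E - 1 - zt) + zt) by ring.
  rewrite nrmM ler_wpM2l//; apply: le_trans (nrmD _ _) _.
  rewrite mulr_natl mulr2n; apply: lerD; last exact: nrm_st.
  apply: le_trans hE _; rewrite ler_piMl// /e1.
  by rewrite ge_min lexx.
rewrite EE.
have -> : k (z * E) - k z - A * z * zt =
  (k (z * E) - k z - A * (z * E - z)) + A * z * (E - 1 - zt) by ring.
apply: le_trans (nrmD _ _) _.
have q1 : nrm (k (z * E) - k z - A * (z * E - z)) <= e / 2 * N.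
  apply: le_trans (h2 _ _) _.
    apply: le_lt_trans nE _.
    have N2 : N < d2 / (4 * (nrm z + 1)).
      have -> : d2 / (4 * (nrm z + 1)) = d2 / (8 * (nrm z + 1)) + d2 / (8 * (nrm z + 1)).
        by field; rewrite gt_eqF// ltr_wpDl.
      exact: ltrD.
    apply: (@le_lt_trans _ _ ((nrm z + 1) * (2 * N))).
      by rewrite ler_wpM2r ?mulr_ge0// lerDl.
    apply: (@lt_le_trans _ _ ((nrm z + 1) * (2 * (d2 / (4 * (nrm z + 1)))))).
      by rewrite ltr_pM2l ?ltr_wpDl// ltr_pM2l.
    have -> : (nrm z + 1) * (2 * (d2 / (4 * (nrm z + 1)))) = d2 / 2.
      by field; rewrite gt_eqF// ltr_wpDl.
    by rewrite ler_pdivrMr// ler_peMr ?(ltW d20)// ler1n.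
  apply: le_trans (ler_wpM2l (ltW e20) nE) _.
  rewrite mulrA mulrA ler_wpM2r//.
  apply: (@le_trans _ _ (e2 * (nrm z + 1) * 2)).
    by rewrite ler_pM2r// ler_pM2l// lerDl.
  rewrite /e2.
  have -> : e / (4 * (nrm z + 1)) * (nrm z + 1) * 2 = e / 2.
    by field; rewrite gt_eqF// ltr_wpDl.
  exact: lexx.
have q2 : nrm (A * z * (E - 1 - zt)) <= e / 2 * N.
  rewrite nrmM nrmM; apply: le_trans (ler_wpM2l _ hE) _; first exact: mulr_ge0.
  rewrite mulrA ler_wpM2r//.
  apply: (@le_trans _ _ ((nrm A * nrm z + 1) * (e / (2 * (nrm A * nrm z + 1))))).
    apply: ler_pM => //; [exact: mulr_ge0|exact: ltW|by rewrite lerDl|].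
    by rewrite /e1 ge_min lexx orbT.
  have -> : (nrm A * nrm z + 1) * (e / (2 * (nrm A * nrm z + 1))) = e / 2.
    by field; rewrite gt_eqF// ltr_wpDl// mulr_ge0.
  exact: lexx.
apply: le_trans (lerD q1 q2) _.
by have -> : e / 2 * N + e / 2 * N = e * N by field.
Qed.

Lemma nrm_circ (r t : R) : 0 <= r -> nrm (r%:C * expi t) = r.
Proof. by move=> r0; rewrite nrmM nrm_real nrm_expi mulr1 ger0_norm. Qed.

(** In logarithmic polar coordinates the annulus between the two circles is the rectangle
    [[ln r, ln r'] x [0, 2 pi]]. In [goursat] the sides at angles 0 and [2 pi] cancel by
    periodicity, and what remains says that the means over the two circles agree. No Jacobian
    appears because [dz / z = ds + i dt]. *)
Lemma cmean_annulus k (r1 r2 r r' : R) : 0 <= r1 ->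
  (forall z, r1 < nrm z < r2 -> derivable k z 1) ->
  r1 < r -> r <= r' -> r' < r2 ->
  cmean (fun t => k (r%:C * expi t)) = cmean (fun t => k (r'%:C * expi t)).
Proof.
move=> r10 dk r1r rr' r'r2.
have r0 : 0 < r by exact: le_lt_trans r10 r1r.
have r'0 : 0 < r' by exact: lt_le_trans r0 rr'.
have lnrr : 0 <= ln r' - ln r by rewrite subr_ge0 ler_ln.
have Hd s t : ln r <= s <= ln r + (ln r' - ln r) -> 0 <= t <= 0 + 2 * pi ->
    diff_at (fun s t => k ((expR s)%:C * expi t)) s t.
  rewrite addrC subrK => /andP[s1 s2] _.
  have /cderivP[A kA] : derivable k ((expR s)%:C * expi t) 1.
    apply: dk; rewrite nrm_circ ?expR_ge0//; apply/andP; split.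
      by apply: lt_le_trans r1r _; rewrite -[leLHS](lnK r0) ler_expR.
    by apply: le_lt_trans r'r2; rewrite -[leRHS](lnK r'0) ler_expR.
  exact: polar_diff kA.
have := goursat Hd lnrr (pi2_ge0 R).
have lnE : ln r + (ln r' - ln r) = ln r' by rewrite addrC subrK.
rewrite /rect_int add0r lnE !lnK//.
have -> : cint `[ln r, ln r'] (fun s => k ((expR s)%:C * expi 0) -
    k ((expR s)%:C * expi (2 * pi))) = 0.
  rewrite (@eq_cint _ _ _ (fun=> 0)); last first.
    by move=> s _; rewrite expi_2pi expi0 subrr.
  by rewrite cint_cst ?mulr0// ler_ln.
move/eqP; rewrite add0r mulf_eq0 -nrm_eq0 nrm_i oner_eq0 /= => /eqP.
have ic x : r <= x <= r' -> cintegrable I0 (fun t => k (x%:C * expi t)).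
  move=> /andP[rx xr]; apply: cintegrable_cts => t.
  apply: (@ccts_comp R R (nbhs t) _ (fun t => x%:C * expi t) k).
    apply: derivable_cts; apply: dk; rewrite nrm_circ.
      by rewrite (lt_le_trans r1r rx) (le_lt_trans xr r'r2).
    by apply: le_trans rx; exact: ltW.
  by apply: cvgM; [exact: cvg_cst|exact: cts_expi].
rewrite cintB; [|exact: measurable_itv|by apply: ic; rewrite rr' lexx|
  by apply: ic; rewrite lexx rr'].
by move/eqP; rewrite subr_eq0 /cmean => /eqP ->.
Qed.

End PolarCoordinates.

Section CauchyFormula.
Variable R : realType.
Local Notation C := (Cx R).
Local Notation nrm := (@Normc.normc R).
Local Notation Re := (@complex.Re R).
Local Notation I0 := [set` `[(0 : R), 2 * pi]].
Implicit Types (k h : C -> C) (z w A : C).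

Lemma derivable_expn n z : derivable (fun w : C => w ^+ n) z 1.
Proof.
have -> : (fun w : C => w ^+ n) = (@id C) ^+ n.
  by apply/funext => w; rewrite fctE.
by apply: derivableX; exact: derivable_id.
Qed.

Lemma cts_circ (r t : R) : ((r%:C : C) * expi x) @[x --> t] --> (r%:C * expi t : C).
Proof. by apply: cvgM; [exact: cvg_cst|exact: cts_expi]. Qed.

Lemma cts_circn (r t : R) n :
  (((r%:C : C) * expi x) ^+ n) @[x --> t] --> ((r%:C * expi t) ^+ n : C).
Proof.
apply: (@ccts_comp R R (nbhs t) _ (fun t => r%:C * expi t) (fun z => z ^+ n)).
  by apply: derivable_cts; exact: derivable_expn.
exact: cts_circ.
Qed.

(** By [cmean_annulus] the means of [z ^+ n] over the circles of radius 1 and 2 agree, while by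
    homogeneity the second is [2 ^+ n] times the first. *)
Lemma cmean_expi_pos n : (0 < n)%N -> cmean (fun t : R => expi t ^+ n) = 0.
Proof.
move=> n0; have := @cmean_annulus R (fun z => z ^+ n) 0 3 1 2 (lexx 0)
  (fun z _ => @derivable_expn n z) ltr01 (ler1n _ 2) (ltr_nat _ 2 3).
have ci : cintegrable I0 (fun t : R => expi t ^+ n).
  apply: cintegrable_cts => t.
  by have := @cts_circn 1 t n; under eq_fun do rewrite mul1r; rewrite mul1r.
rewrite (@eq_cmean _ _ (fun t => expi t ^+ n)); last by move=> t _; rewrite mul1r.
rewrite [RHS](@eq_cmean _ _ (fun t => (2 : R)%:C ^+ n * expi t ^+ n));
  last by move=> t _; rewrite exprMn.
rewrite cmeanZ// => /eqP; rewrite -{1}[cmean _]mul1r -subr_eq0 -mulrBl mulf_eq0.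
case/orP => [/eqP h|/eqP//]; exfalso.
have : (1 : R) < 2 ^+ n by rewrite exprn_egt1 ?ltr1n// -lt0n.
move: h => /(congr1 Re); rewrite -rmorphXn /= => h.
by rewrite -subr_lt0 h ltxx.
Qed.

Lemma cmeanJ (u : R -> C) : cintegrable I0 u ->
  cmean (fun t => Num.conj (u t)) = Num.conj (cmean u).
Proof.
move=> [ur ui]; have -> : cmean (fun t => Num.conj (u t)) =
    ((2 * pi)^-1)%:C * Num.conj (cint I0 u).
  rewrite /cmean; congr (_ * _); rewrite /cint; apply: complex_eq.
    by rewrite cReJ /=; apply: eq_Rintegral => t _; rewrite cReJ.
  rewrite cImJ /= -mulN1r -RintegralZl//.
  by apply: eq_Rintegral => t _; rewrite cImJ mulN1r.
by rewrite /cmean [RHS]rmorphM; congr (_ * _); exact/esym/conj_real.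
Qed.

Lemma expiX (t : R) n : Num.conj (expi t ^+ n) = (expi t)^-1 ^+ n.
Proof. by rewrite rmorphXn /= expiJ expiN. Qed.

Lemma cts_expiX (t : R) n : (expi x ^+ n : C) @[x --> t] --> (expi t ^+ n : C).
Proof.
by have := @cts_circn 1 t n; under eq_fun do rewrite mul1r; rewrite mul1r.
Qed.

Lemma cintegrable_expiX n : cintegrable I0 (fun t : R => expi t ^+ n).
Proof. by apply: cintegrable_cts => t; exact: cts_expiX. Qed.

Lemma cmean_expi_neg n : (0 < n)%N -> cmean (fun t : R => (expi t)^-1 ^+ n) = 0.
Proof.
move=> n0; rewrite (@eq_cmean _ _ (fun t => Num.conj (expi t ^+ n))); last first.
  by move=> t _; rewrite expiX.
by rewrite cmeanJ ?cmean_expi_pos ?rmorph0//; exact: cintegrable_expiX.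
Qed.

Lemma cts_expiVX (t : R) n :
  ((expi x)^-1 ^+ n : C) @[x --> t] --> ((expi t)^-1 ^+ n : C).
Proof.
apply: ccvg_ReIm.
  under eq_fun do rewrite -expiX cReJ.
  by rewrite -expiX cReJ; apply: ccvg_Re; exact: cts_expiX.
under eq_fun do rewrite -expiX cImJ.
by rewrite -expiX cImJ; apply: cvgN; apply: ccvg_Im; exact: cts_expiX.
Qed.

Lemma cintegrable_expiVX n : cintegrable I0 (fun t : R => (expi t)^-1 ^+ n).
Proof. by apply: cintegrable_cts => t; exact: cts_expiVX. Qed.

Lemma le_small_eq0 (x B rho : R) : 0 <= x -> 0 < rho -> 0 <= B ->
  (forall r, 0 < r -> r < rho -> x <= B * r) -> x = 0.
Proof.
move=> x0 rho0 B0 h; apply/eqP; rewrite eq_le x0 andbT.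
apply/ler_addgt0Pr => e e0; rewrite add0r.
have B1 : 0 < B + 1 by rewrite ltr_wpDl.
pose r := Num.min (rho / 2) (e / (B + 1)).
have r0 : 0 < r by rewrite lt_min !divr_gt0.
apply: le_trans (h r r0 _) _; first by rewrite gt_min ltr_pdivrMr// ltr_pMr// ltr1n.
apply: (@le_trans _ _ ((B + 1) * (e / (B + 1)))).
  by apply: ler_pM => //; [exact: ltW|rewrite lerDl|rewrite ge_min lexx orbT].
by rewrite mulrC divfK// gt_eqF.
Qed.

(** * Cauchy's formula from the difference quotient at [w] *)

Section DifferenceQuotient.
Variables (h : C -> C) (M : R) (w : C).
Hypothesis dh : forall z, nrm z < 1 -> derivable h z 1.
Hypothesis hM : forall z, nrm z < 1 -> nrm (h z) <= M.
Hypothesis w1 : nrm w < 1.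

Let A : C := xget 0 [set A | cderiv h w A].

Let hA : cderiv h w A.
Proof.
have [B hB] : exists A, cderiv h w A by apply/cderivP; exact: dh.
by rewrite /A; case: xgetP => [? -> //|/(_ B)].
Qed.

(** The value at [w] makes [Q] continuous there, but says nothing about its differentiability at
    [w]. The means [I r] are therefore compared on each side of the circle [|z| = |w|] and joined by
    continuity in [r]. *)
Let Q (z : C) : C := if z == w then A else (h z - h w) / (z - w).

Let Q_bound : exists2 B : R, 0 <= B & forall z, nrm z < 1 -> nrm (Q z) <= B.
Proof.
have M0 : 0 <= M := le_trans (nrm_ge0 _) (hM w1).
have [d d0 dP] := hA ltr01.
have A0 := nrm_ge0 A.
exists (nrm A + 1 + 2 * M / d).
  by rewrite addr_ge0// ?addr_ge0// divr_ge0// ?(ltW d0)// mulr_ge0.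
have q0 : 0 <= 2 * M / d by rewrite divr_ge0// ?(ltW d0)// mulr_ge0.
move=> z z1; rewrite /Q; case: eqVneq => [_|zw].
  by rewrite -addrA lerDl addr_ge0.
have nz : 0 < nrm (z - w) by rewrite nrm_gt0 subr_eq0.
rewrite nrmM nrmV ler_pdivrMr//.
have [zd|zd] := ltP (nrm (z - w)) d.
  have -> : h z - h w = A * (z - w) + (h z - h w - A * (z - w)) by ring.
  apply: le_trans (nrmD _ _) _; rewrite nrmM mulrDl mulrDl -[leLHS]addr0.
  by apply: lerD; [rewrite lerD2l dP|rewrite mulr_ge0// ltW].
apply: (@le_trans _ _ (2 * M)).
  apply: le_trans (nrmD _ _) _; rewrite nrmN mulr_natl mulr2n.
  by apply: lerD; exact: hM.
rewrite [leRHS]mulrDl -[leLHS]add0r; apply: lerD.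
  by rewrite mulr_ge0 ?addr_ge0 ?(ltW nz).
by rewrite -[leRHS]mulrA ler_peMr ?mulr_ge0// mulrC ler_pdivlMr// mul1r.
Qed.

Let Q_cts z : nrm z < 1 -> Q x @[x --> z] --> Q z.
Proof.
move=> z1; have [->|zw] := eqVneq z w.
  apply/(@ccvg_lt R _ (nbhs w)) => e e0; apply/near_nrmP.
  have e2 : 0 < e / 2 by rewrite divr_gt0.
  have [d d0 dP] := hA e2; exists d => // x xd; rewrite /Q eqxx.
  case: eqVneq => [_|xw]; first by rewrite subrr nrm0.
  have nx : 0 < nrm (x - w) by rewrite nrm_gt0 subr_eq0.
  have xw0 : x - w != 0 by rewrite subr_eq0.
  have -> : (h x - h w) / (x - w) - A = (h x - h w - A * (x - w)) / (x - w).
    by rewrite [RHS]mulrBl mulfK.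
  rewrite nrmM nrmV ltr_pdivrMr//; apply: le_lt_trans (dP _ xd) _.
  by rewrite ltr_pM2r// ltr_pdivrMr// ltr_pMr// ltr1n.
have zw0 : z - w != 0 by rewrite subr_eq0.
rewrite {2}/Q (negbTE zw).
have QE : \forall x \near z, (h x - h w) / (x - w) = Q x.
  apply/near_nrmP; exists (nrm (z - w)); first by rewrite nrm_gt0.
  move=> x xz; rewrite /Q; case: eqVneq => // xw.
  by move: xz; rewrite xw nrmB ltxx.
apply: cvg_trans (near_eq_cvg QE) _.
apply: cvgM.
  by apply: cvgB; [apply: derivable_cts; exact: dh|exact: cvg_cst].
by apply: cvgV => //; apply: cvgB; [exact: cvg_id|exact: cvg_cst].
Qed.

Let I (r : R) := cmean (fun t => Q (r%:C * expi t) * (r%:C * expi t)).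

Let circ1 (r t : R) : 0 <= r -> r < 1 -> nrm (r%:C * expi t) < 1.
Proof. by move=> r0 r1; rewrite nrm_circ. Qed.

Let cts_I (r t : R) : 0 <= r -> r < 1 ->
  (Q (r%:C * expi x) * (r%:C * expi x) : C) @[x --> t] -->
  (Q (r%:C * expi t) * (r%:C * expi t) : C).
Proof.
move=> r0 r1; apply: cvgM; last exact: cts_circ.
apply: (@ccts_comp R R (nbhs t) _ (fun t => r%:C * expi t) Q).
  by apply: Q_cts; exact: circ1.
exact: cts_circ.
Qed.

Let I_const (r r' : R) : 0 < r -> r <= r' -> r' < 1 ->
  r' < nrm w \/ nrm w < r -> I r = I r'.
Proof.
move=> r0 rr' r'1 rw.
(* An annulus that contains both circles and misses the circle through [w]; on it [Q] is a quotient
   of differentiable functions. *)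
have [lo [up [lo0 lor r'up up1 out]]] : exists lo up : R, [/\ 0 <= lo, lo < r, r' < up,
    up <= 1 & forall z, lo < nrm z < up -> nrm z != nrm w].
  case: rw => rw.
    exists 0, (nrm w); split => //; first exact: ltW.
    by move=> z /andP[_ zw]; rewrite lt_eqF.
  exists (nrm w), 1; split => //; first exact: nrm_ge0.
  by move=> z /andP[zw _]; rewrite gt_eqF.
pose k z := (h z - h w) / (z - w) * z.
have zw z : lo < nrm z < up -> z != w.
  by move=> /out; apply: contraNneq => ->.
have kE x t : r <= x <= r' -> k (x%:C * expi t) =
    Q (x%:C * expi t) * (x%:C * expi t).
  move=> /andP[rx xr']; rewrite /k /Q ifN// zw// nrm_circ.
    by rewrite (lt_le_trans lor rx) (le_lt_trans xr' r'up).
  by apply: le_trans rx; exact: ltW.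
have Er x : r <= x <= r' -> I x = cmean (fun t => k (x%:C * expi t)).
  by move=> rx; apply: eq_cmean => t _; rewrite kE.
have rr1 : r <= r <= r' by rewrite lexx.
have rr2 : r <= r' <= r' by rewrite lexx andbT.
rewrite (Er _ rr1) (Er _ rr2).
apply: (cmean_annulus lo0 _ lor rr' r'up) => z lz.
have z1 : nrm z < 1 by case/andP: lz => _ /lt_le_trans; apply.
have zw0 : z - w != 0 by rewrite subr_eq0 zw.
have -> : k = ((h - cst (h w)) * (fun z => (z - w)^-1)) * id.
  by apply/funext => x; rewrite /k !fctE.
apply: derivableM; last exact: derivable_id.
apply: derivableM; first by apply: derivableB; [exact: dh|exact: derivable_cst].
exact: derivableV.
Qed.

Let I_small : exists2 B : R, 0 <= B & forall r : R, 0 < r -> r < 1 -> nrm (I r) <= B * r.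
Proof.
have [B B0 BP] := Q_bound; exists B => // r r0 r1.
apply: nrm_cmean_le.
  by apply: cintegrable_cts => t; apply: cts_I => //; exact: ltW.
move=> t _; rewrite nrmM [X in _ * X <= _]nrm_circ; last exact: ltW.
by rewrite ler_pM2r// BP// circ1// ltW.
Qed.

Let I_cts (r_ : nat -> R) (r : R) : (forall n, 0 < r_ n /\ r_ n < 1) -> 0 <= r -> r < 1 ->
  r_ @ \oo --> r -> I (r_ n) @[n --> \oo] --> I r.
Proof.
move=> r_01 r0 r1 rr; have [B B0 BP] := Q_bound.
have fi n : cintegrable I0 (fun t => Q ((r_ n)%:C * expi t) * ((r_ n)%:C * expi t)).
  apply: cintegrable_cts => t; have [? ?] := r_01 n.
  by apply: cts_I => //; exact: ltW.
have cv (t : R) : ((r_ n)%:C * expi t : C) @[n --> \oo] --> (r%:C * expi t : C).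
  by apply: cvgM; [exact: ccvg_real|exact: cvg_cst].
have fc (t : R) : (Q ((r_ n)%:C * expi t) * ((r_ n)%:C * expi t) : C) @[n --> \oo]
    --> (Q (r%:C * expi t) * (r%:C * expi t) : C).
  apply: cvgM; last exact: cv.
  apply: (@ccts_comp R nat _ _ (fun n => (r_ n)%:C * expi t) Q).
    by apply: Q_cts; exact: circ1.
  exact: cv.
have fb n (t : R) : nrm (Q ((r_ n)%:C * expi t) * ((r_ n)%:C * expi t)) <= B.
  have [? ?] := r_01 n; have c1 : nrm ((r_ n)%:C * expi t) < 1.
    by apply: circ1 => //; exact: ltW.
  rewrite nrmM -[leRHS]mulr1; apply: ler_pM; rewrite ?nrm_ge0//.
    exact: BP.
  exact: ltW.
exact: (cmean_dct fi fc fb).2.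
Qed.

(** [I] is constant on []0, r]] and is [O(x)] at radius [x], because [Q] is bounded. For [w = 0] no
    positive radius meets the circle through [w], hence the alternative. *)
Let I0_lo (r : R) : 0 < r -> r < 1 -> (r < nrm w \/ nrm w = 0) -> I r = 0.
Proof.
move=> r0 r1 rw; have [B B0 BP] := I_small.
apply/eqP; rewrite -nrm_eq0; apply/eqP.
apply: (@le_small_eq0 _ B r) => //; first exact: nrm_ge0.
move=> x x0 xr; rewrite -(@I_const x r)//; [|exact: ltW|].
  by apply: BP => //; exact: lt_trans xr r1.
by case: rw => [?|->]; [left|right].
Qed.

Let geo_cvg (a b : R) : (fun n => a + b * 2^-1 ^+ n) @ \oo --> a.
Proof.
rewrite -[X in _ --> X]addr0; apply: cvgD; first exact: cvg_cst.
rewrite -[X in _ --> X](mulr0 b); apply: cvgM; first exact: cvg_cst.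
by apply: cvg_expr; rewrite ger0_norm// invf_lt1// ltr1n.
Qed.

(** Continuity carries the value 0 from the smaller radii to [nrm w]. Radii decreasing from [r] to
    [nrm w] then carry it outwards, since [I] is constant beyond [nrm w]. *)
Let I_eq0 (r : R) : nrm w < r -> r < 1 -> I r = 0.
Proof.
move=> wr r1; have r0 : 0 < r by exact: le_lt_trans (nrm_ge0 _) wr.
have [w0|w0] := eqVneq (nrm w) 0; first by apply: I0_lo => //; right.
have {}w0 : 0 < nrm w by rewrite lt_def w0 nrm_ge0.
have p n : 0 < (2 : R)^-1 ^+ n <= 1.
  by rewrite exprn_gt0//= exprn_ile1// invf_le1// ler1n.
have Iw : I (nrm w) = 0.
  have wlt n : 0 < nrm w + - (nrm w / 2) * 2^-1 ^+ n < nrm w.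
    have /andP[p0 p1] := p n; rewrite mulNr; apply/andP; split.
      rewrite subr_gt0; apply: (@le_lt_trans _ _ (nrm w / 2)).
        by rewrite ler_piMr// divr_ge0// ltW.
      by rewrite ltr_pdivrMr// ltr_pMr// ltr1n.
    by rewrite ltrBlDr ltrDl mulr_gt0// divr_gt0.
  have r01 n : 0 < nrm w + - (nrm w / 2) * 2^-1 ^+ n /\
      nrm w + - (nrm w / 2) * 2^-1 ^+ n < 1.
    by have /andP[? ?] := wlt n; split => //; exact: lt_trans w1.
  have cw := I_cts r01 (nrm_ge0 _) w1 (@geo_cvg _ _).
  apply: (ccvg_cst_eq cw) => n; have /andP[? wn] := wlt n.
  by apply: I0_lo => //; [exact: lt_trans wn w1|left].
have rgt n : nrm w < nrm w + (r - nrm w) * 2^-1 ^+ n <= r.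
  have /andP[p0 p1] := p n; apply/andP; split.
    by rewrite ltrDl mulr_gt0// subr_gt0.
  by rewrite -lerBrDl ler_piMr// subr_ge0 ltW.
have r01 n : 0 < nrm w + (r - nrm w) * 2^-1 ^+ n /\
    nrm w + (r - nrm w) * 2^-1 ^+ n < 1.
  have /andP[wn nr] := rgt n; split; first exact: lt_trans w0 wn.
  exact: le_lt_trans nr r1.
have cw := I_cts r01 (nrm_ge0 _) w1 (@geo_cvg _ _).
apply/esym; rewrite -Iw; apply: (ccvg_cst_eq cw) => n.
have /andP[wn nr] := rgt n; apply: I_const => //; first exact: lt_trans w0 wn.
by right.
Qed.

(** The terms of the geometric expansion of [z / (z - w)] in powers of [w / z], at
    [z = r * expi t]. *)
Let kernel (r t : R) (n : nat) : C := w ^+ n * (r%:C * expi t)^-1 ^+ n.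

Let kernelE r t : 0 < r -> nrm w < r -> [/\ csummable (kernel r t),
  forall n, nrm (kernel r t n) = (nrm w / r) ^+ n &
  csum (kernel r t) = r%:C * expi t / (r%:C * expi t - w)].
Proof.
move=> r0 wr; have nz : nrm (r%:C * expi t) = r by rewrite nrm_circ// ltW.
set z := r%:C * expi t in nz *.
have z0 : z != 0 by rewrite -nrm_eq0 nz gt_eqF.
have kE : kernel r t = fun n => (w / z) ^+ n.
  by apply/funext => n; rewrite /kernel -exprMn.
have q1 : nrm (w / z) < 1 by rewrite nrmM nrmV nz ltr_pdivrMr// mul1r.
have q01 : 0 <= nrm (w / z) < 1 by rewrite nrm_ge0.
rewrite kE; split.
- apply: (summable_le (geometric_summable q01)) => n.
  by rewrite nrmX.
- by move=> n; rewrite nrmX nrmM nrmV nz.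
rewrite csum_geometric//.
have zw : z - w != 0.
  by rewrite subr_eq0; apply/eqP => zw; move: wr; rewrite -zw nz ltxx.
have -> : 1 - w / z = (z - w) / z by rewrite mulrBl divff.
by rewrite invf_div.
Qed.

Let kernel_cts (r t : R) n : kernel r x n @[x --> t] --> kernel r t n.
Proof.
rewrite /kernel; apply: cvgM; first exact: cvg_cst.
under eq_fun do rewrite invfM exprMn.
rewrite invfM exprMn; apply: cvgM; first exact: cvg_cst.
exact: cts_expiVX.
Qed.

(** [I r = 0] says that [h z] and the constant [h w] have the same mean against [z / (z - w)]. This
    kernel has mean 1, only its term of index 0 surviving, and its expansion under the mean of [h]
    yields the Taylor series directly. *)
Lemma cauchy_formula (r : R) : nrm w < r -> r < 1 ->
  h w = csum (fun n => cmean (fun t => h (r%:C * expi t) * (r%:C * expi t)^-1 ^+ n) * w ^+ n).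
Proof.
move=> wr r1; have r0 : 0 < r by exact: le_lt_trans (nrm_ge0 _) wr.
have q01 : 0 <= nrm w / r < 1.
  by rewrite divr_ge0 ?nrm_ge0 ?(ltW r0)//= ltr_pdivrMr// mul1r.
have hc (t : R) : h (r%:C * expi x) @[x --> t] --> h (r%:C * expi t).
  apply: (@ccts_comp R R (nbhs t) _ (fun t => r%:C * expi t) h).
    by apply: derivable_cts; apply: dh; rewrite nrm_circ// ltW.
  exact: cts_circ.
have f1i n : cintegrable I0 (fun t => kernel r t n).
  by apply: cintegrable_cts => t; exact: kernel_cts.
have f2i n : cintegrable I0 (fun t => h (r%:C * expi t) * kernel r t n).
  apply: cintegrable_cts => t; apply: cvgM; [exact: hc|exact: kernel_cts].
have f1b n t : nrm (kernel r t n) <= (nrm w / r) ^+ n.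
  by have [_ -> _] := kernelE t r0 wr.
have M0 : 0 <= M := le_trans (nrm_ge0 _) (hM w1).
have f2b n t : nrm (h (r%:C * expi t) * kernel r t n) <= M * (nrm w / r) ^+ n.
  rewrite nrmM; apply: ler_pM; rewrite ?nrm_ge0//.
  by apply: hM; rewrite nrm_circ// ltW.
have gs := geometric_summable q01.
have gs2 : cvgn (series (fun n => M * (nrm w / r) ^+ n)).
  rewrite (_ : series _ = (fun n => M * series (fun n => (nrm w / r) ^+ n) n)).
    by apply: is_cvgM => //; exact: is_cvg_cst.
  by apply/funext => n; rewrite /series/= mulr_sumr.
have [i1 e1] := cmean_csum gs f1i f1b.
have [i2 e2] := cmean_csum gs2 f2i f2b.
have m1 : cmean (fun t => csum (kernel r t)) = 1.
  rewrite e1 (csum_single (k := 0%N)).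
    rewrite (@eq_cmean _ _ (fun=> 1)) ?cmean_cst// => t _.
    by rewrite /kernel !expr0 mulr1.
  move=> n n0.
  rewrite (@eq_cmean _ _ (fun t => (w ^+ n * r%:C^-1 ^+ n) * (expi t)^-1 ^+ n)).
    by rewrite cmeanZ ?cmean_expi_neg ?mulr0 ?lt0n//; exact: cintegrable_expiVX.
  by move=> t _; rewrite /kernel invfM exprMn mulrA.
have := I_eq0 wr r1.
have -> : I r = cmean (fun t => csum (fun n => h (r%:C * expi t) * kernel r t n) -
                        h w * csum (kernel r t)).
  apply: eq_cmean => t _; have [sk _ kE] := kernelE t r0 wr.
  rewrite csumZ// -mulrBl kE /Q; case: eqVneq => [e|_]; last by rewrite mulrAC -mulrA.
  by move: wr; rewrite -e nrm_circ ?ltxx// ltW.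
rewrite cmeanB//; last exact: cintegrableZ.
rewrite cmeanZ// m1 mulr1 e2 => /eqP; rewrite subr_eq0 => /eqP <-.
apply: csum_eq => n.
have i3 : cintegrable I0 (fun t => h (r%:C * expi t) * (r%:C * expi t)^-1 ^+ n).
  apply: cintegrable_cts => t; apply: cvgM; first exact: hc.
  under eq_fun do rewrite invfM exprMn.
  rewrite invfM exprMn; apply: cvgM; first exact: cvg_cst.
  exact: cts_expiVX.
rewrite mulrC -(cmeanZ _ i3); apply: eq_cmean => t _.
by rewrite /kernel mulrCA.
Qed.

End DifferenceQuotient.
End CauchyFormula.

(** * Power series *)

Section PowerSeries.
Variable R : realType.
Local Notation C := (Cx R).
Local Notation nrm := (@Normc.normc R).
Local Notation I0 := [set` `[(0 : R), 2 * pi]].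
Implicit Types (h : C -> C) (z w : C) (c : nat -> C).

Definition pser c z := csum (fun n => c n * z ^+ n).

Lemma cvgn_seriesZ (M : R) (a : nat -> R) : cvgn (series a) ->
  cvgn (series (fun n => M * a n)).
Proof.
move=> ca; rewrite (_ : series _ = (fun n => M * series a n)).
  by apply: is_cvgM => //; exact: is_cvg_cst.
by apply/funext => n; rewrite /series/= mulr_sumr.
Qed.

Lemma pser_term c M z rho n : (forall n, nrm (c n) <= M) -> nrm z <= rho ->
  nrm (c n * z ^+ n) <= M * rho ^+ n.
Proof.
move=> cM zr; rewrite nrmM nrmX; apply: ler_pM; rewrite ?nrm_ge0 ?exprn_ge0 ?nrm_ge0//.
by rewrite lerXn2r// nnegrE ?nrm_ge0// (le_trans (nrm_ge0 z)).
Qed.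

Lemma pser_summable c M z : (forall n, nrm (c n) <= M) -> nrm z < 1 ->
  csummable (fun n => c n * z ^+ n).
Proof.
move=> cM z1; apply: (@summable_le _ _ (fun n => M * nrm z ^+ n)).
  by apply: cvgn_seriesZ; apply: geometric_summable; rewrite nrm_ge0.
by move=> n; exact: pser_term.
Qed.

Lemma cmean_expi_mix (j n : nat) :
  cintegrable I0 (fun t : R => expi t ^+ j * (expi t)^-1 ^+ n) /\
  cmean (fun t : R => expi t ^+ j * (expi t)^-1 ^+ n) = (j == n)%:R.
Proof.
split.
  apply: cintegrable_cts => t; apply: cvgM; [exact: cts_expiX|exact: cts_expiVX].
have [jn|nj|->] := ltngtP j n.
- rewrite (@eq_cmean _ _ (fun t => (expi t)^-1 ^+ (n - j))).
    by rewrite cmean_expi_neg ?subn_gt0.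
  move=> t _; rewrite -{1}(subnK (ltnW jn)) exprD mulrCA exprVn.
  by rewrite [(expi t)^-1 ^+ j]exprVn divff ?mulr1 ?exprVn// expf_neq0// expi_neq0.
- rewrite (@eq_cmean _ _ (fun t => expi t ^+ (j - n))).
    by rewrite cmean_expi_pos ?subn_gt0.
  move=> t _; rewrite -{1}(subnK (ltnW nj)) exprD exprVn mulfK//.
  by rewrite expf_neq0// expi_neq0.
rewrite (@eq_cmean _ _ (fun=> 1)) ?cmean_cst// => t _.
by rewrite exprVn divff// expf_neq0// expi_neq0.
Qed.

Lemma pser_coef c (r : R) n : 0 < r -> cvgn (series (fun j => nrm (c j) * r ^+ j)) ->
  cmean (fun t => pser c (r%:C * expi t) * (r%:C * expi t)^-1 ^+ n) = c n.
Proof.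
move=> r0 cr; have r0' : (r%:C : C) != 0 by rewrite -nrm_eq0 nrm_real normr_eq0 gt_eqF.
pose a j : C := c j * r%:C ^+ j * r%:C^-1 ^+ n.
pose f j (t : R) : C := a j * (expi t ^+ j * (expi t)^-1 ^+ n).
have fi j : cintegrable I0 (f j).
  by apply: cintegrableZ => //; exact: (cmean_expi_mix j n).1.
pose B j := r^-1 ^+ n * (nrm (c j) * r ^+ j).
have cB : cvgn (series B) by exact: cvgn_seriesZ.
have fB j t : nrm (f j t) <= B j.
  have -> : nrm (f j t) = nrm (c j) * r ^+ j * r^-1 ^+ n.
    rewrite /f /a !nrmM !nrmX !nrmV nrm_expi nrm_real gtr0_norm//.
    by rewrite invr1 !expr1n !mulr1.
  by rewrite /B mulrC.
have [_ e] := cmean_csum cB fi fB.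
rewrite (@eq_cmean _ _ (fun t => csum (f ^~ t))); last first.
  move=> t _; rewrite /pser mulrC -csumZ.
    apply: csum_eq => j; rewrite /f /a invfM !exprMn; ring.
  apply: (summable_le cr) => j.
  by rewrite nrmM nrmX nrm_circ// ltW.
rewrite e (csum_single (k := n)).
  rewrite /f cmeanZ; last exact: (cmean_expi_mix n n).1.
  rewrite (cmean_expi_mix n n).2 eqxx mulr1 /a -mulrA exprVn divff ?mulr1//.
  by rewrite expf_neq0.
move=> j jn; rewrite /f cmeanZ; last exact: (cmean_expi_mix j n).1.
by rewrite (cmean_expi_mix j n).2 (negbTE jn) mulr0.
Qed.

Section Expansion.
Variables (h : C -> C) (M : R).
Hypothesis dh : forall z, nrm z < 1 -> derivable h z 1.
Hypothesis hM : forall z, nrm z < 1 -> nrm (h z) <= M.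

Definition taylor_coef (r : R) n : C :=
  cmean (fun t => h (r%:C * expi t) * (r%:C * expi t)^-1 ^+ n).

Let coef_cts (r t : R) n : 0 < r -> r < 1 ->
  (h (r%:C * expi x) * (r%:C * expi x)^-1 ^+ n : C) @[x --> t] -->
  (h (r%:C * expi t) * (r%:C * expi t)^-1 ^+ n : C).
Proof.
move=> r0 r1; apply: cvgM.
  apply: (@ccts_comp R R (nbhs t) _ (fun t => r%:C * expi t) h).
    by apply: derivable_cts; apply: dh; rewrite nrm_circ// ltW.
  exact: cts_circ.
under eq_fun do rewrite invfM exprMn.
rewrite invfM exprMn; apply: cvgM; first exact: cvg_cst.
exact: cts_expiVX.
Qed.

Lemma taylor_coef_integrable (r : R) n : 0 < r -> r < 1 ->
  cintegrable I0 (fun t => h (r%:C * expi t) * (r%:C * expi t)^-1 ^+ n).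
Proof. by move=> r0 r1; apply: cintegrable_cts => t; exact: coef_cts. Qed.

Lemma taylor_coef_le (r : R) n : 0 < r -> r < 1 ->
  nrm (taylor_coef r n) <= M * r^-1 ^+ n.
Proof.
move=> r0 r1; apply: nrm_cmean_le; first exact: taylor_coef_integrable.
move=> t _; rewrite nrmM nrmX nrmV nrm_circ; last exact: ltW.
rewrite ler_wpM2r ?exprn_ge0 ?invr_ge0 ?(ltW r0)//.
by apply: hM; rewrite nrm_circ// ltW.
Qed.

(** On the smaller circle [h] is the sum of the power series with the coefficients taken at [r'],
    and [pser_coef] reads these off again. *)
Lemma taylor_coef_const (r r' : R) n : 0 < r -> r < r' -> r' < 1 ->
  taylor_coef r n = taylor_coef r' n.
Proof.
move=> r0 rr' r'1; have r'0 := lt_trans r0 rr'.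
rewrite -[RHS](@pser_coef (taylor_coef r') r n r0).
  apply: eq_cmean => t _; congr (_ * _).
  have nz : nrm (r%:C * expi t) = r by rewrite nrm_circ// ltW.
  by apply: (cauchy_formula dh hM); rewrite ?nz// (lt_trans rr').
have q : 0 <= r / r' < 1.
  by rewrite divr_ge0 ?(ltW r0) ?(ltW r'0)//= ltr_pdivrMr// mul1r.
apply: (@cvgn_le_summable _ _ (fun j => M * (r / r') ^+ j)) => [j|]; last first.
  by apply: cvgn_seriesZ; exact: geometric_summable.
rewrite mulr_ge0 ?nrm_ge0 ?exprn_ge0 ?(ltW r0)//=.
rewrite exprMn mulrCA mulrC ler_wpM2l ?exprn_ge0 ?(ltW r0)//.
exact: taylor_coef_le.
Qed.

Lemma taylor_expansion : exists c, [/\ forall n, nrm (c n) <= M,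
  forall z, nrm z < 1 -> h z = pser c z & c = taylor_coef 2^-1].
Proof.
exists (taylor_coef 2^-1).
have h0 : 0 < (2 : R)^-1 by rewrite invr_gt0.
have E r : 2^-1 < r -> r < 1 -> taylor_coef 2^-1 = taylor_coef r.
  by move=> ? ?; apply/funext => n; exact: taylor_coef_const.
(* Radii tending to 1 that stay above the reference radius 1/2. Along them the bound [M / r ^ n] for
   the coefficients improves to [M]. *)
pose s k : R := 1 - 4^-1 * 2^-1 ^+ k.
have s_bnd k : 2^-1 < s k /\ s k < 1.
  have /andP[p0 p1] : 0 < (2 : R)^-1 ^+ k <= 1.
    by rewrite exprn_gt0//= exprn_ile1// invf_le1// ler1n.
  by rewrite /s; split; lra.
have s_cvg : s @ \oo --> (1 : R).
  rewrite /s -[X in _ --> X]subr0; apply: cvgB; first exact: cvg_cst.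
  rewrite -[X in _ --> X](mulr0 4^-1); apply: cvgM; first exact: cvg_cst.
  by apply: cvg_expr; rewrite ger0_norm// invf_lt1// ltr1n.
split => // [n|z z1].
  have le k : nrm (taylor_coef 2^-1 n) * s k ^+ n <= M.
    have [s1 s2] := s_bnd k; have s0 := lt_trans h0 s1.
    rewrite (E _ s1 s2) -ler_pdivlMr ?exprn_gt0// -exprVn.
    exact: taylor_coef_le.
  have cv : (fun k => nrm (taylor_coef 2^-1 n) * s k ^+ n) @ \oo -->
      nrm (taylor_coef 2^-1 n) * 1 ^+ n.
    apply: cvgM; first exact: cvg_cst.
    by apply: (@cvg_comp _ _ _ s (fun x => x ^+ n) _ _ _ s_cvg); exact: exprn_continuous.
  rewrite expr1n mulr1 in cv; rewrite -(cvg_lim _ cv)//.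
  by apply: limr_le; [apply: cvgP cv|exact: nearW].
have [k sk] : exists k, nrm z < s k.
  have d0 : 0 < 1 - nrm z by rewrite subr_gt0.
  move/cvgrPdist_lt : s_cvg => /(_ _ d0)[k _ /(_ k (leqnn k))/=].
  move=> /(le_lt_trans (ler_norm _)) ?; exists k; lra.
have [s1 s2] := s_bnd k.
by rewrite (E _ s1 s2); exact: (cauchy_formula dh hM).
Qed.

End Expansion.

(** The first [n] terms of the geometric series are each at least [s ^+ n.-1]. *)
Lemma npow_le (s : R) n : 0 <= s < 1 -> n%:R * s ^+ n.-1 <= (1 - s)^-1.
Proof.
move=> s01; have /andP[s0 s1] := s01.
have cs := geometric_summable s01.
have -> : (1 - s)^-1 = limn (series (fun n => s ^+ n)).
  have -> : (fun n => s ^+ n) = geometric 1 s.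
    by apply/funext => k; rewrite /geometric/= mul1r.
  by rewrite (cvg_lim _ (cvg_geometric_series _))// ?ger0_norm// mul1r.
apply: le_trans (rsum_partial_le n _ cs); last by move=> k; exact: exprn_ge0.
rewrite /series/= mulr_natl -[X in _ *+ X]subn0 -sumr_const_nat.
apply: ler_sum_nat => i /andP[_ iN].
rewrite ler_wiXn2l//; first exact: ltW.
by rewrite -ltnS (ltn_predK iN).
Qed.

(** Since [w ^+ n - z ^+ n = (w - z) * S n w], the difference quotient is itself a series [q w], and
    [tannery] makes it continuous at [z]. The derivative is [q z]. *)
Lemma pser_cderiv c M z : (forall n, nrm (c n) <= M) -> nrm z < 1 ->
  exists A, cderiv (pser c) z A.
Proof.
move=> cM z1.
have M0 : 0 <= M := le_trans (nrm_ge0 _) (cM 0%N).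
pose rho : R := (1 + nrm z) / 2.
have nz := nrm_ge0 z.
have zr : nrm z < rho by rewrite /rho; lra.
have rho1 : rho < 1 by rewrite /rho; lra.
(* For this midpoint [rho <= s * s]: one factor [s ^+ n] absorbs the number [n + 1] of terms of
   [S n.+1], the other keeps the geometric decay. *)
pose s : R := (1 + rho) / 2.
have s1 : s < 1 by rewrite /s; lra.
have shalf : 2^-1 <= s by rewrite /s; lra.
have s0 : 0 <= s by lra.
have rs : rho <= s * s.
  have : 0 <= (1 - rho) ^+ 2 by rewrite sqr_ge0.
  by rewrite /s; nra.
pose S n w : C := \sum_(i < n) w ^+ (n.-1 - i) * z ^+ i.
have SE n w : w ^+ n - z ^+ n = (w - z) * S n w by rewrite subrXX.
have pw (x : R) k : 0 <= x -> x <= rho -> x ^+ k <= rho ^+ k.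
  by move=> x0 xr; rewrite lerXn2r// nnegrE// (le_trans x0).
have Sb n w : nrm w <= rho -> nrm (S n w) <= 2 * (1 - s)^-1 * s ^+ n.
  move=> wr; case: n => [|n].
    by rewrite /S big_ord0 nrm0 mulr_ge0// mulr_ge0// invr_ge0 subr_ge0 ltW.
  apply: (@le_trans _ _ (n.+1%:R * rho ^+ n)).
    apply: le_trans (le_nrm_sum _ _ _) _.
    rewrite mulr_natl -[X in _ *+ X]card_ord -sumr_const; apply: ler_sum => i _.
    have iN : (i <= n)%N by rewrite -ltnS ltn_ord.
    rewrite nrmM !nrmX -[X in rho ^+ X](subnK iN) exprD.
    by apply: ler_pM; rewrite ?exprn_ge0 ?nrm_ge0// pw ?nrm_ge0// ltW.
  have r0 : 0 <= rho by exact: le_trans (nrm_ge0 w) wr.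
  apply: (@le_trans _ _ (n.+1%:R * (s ^+ n * s ^+ n))).
    rewrite ler_wpM2l// -exprMn lerXn2r ?nnegrE//.
    exact: mulr_ge0.
  rewrite mulrA; apply: (@le_trans _ _ ((1 - s)^-1 * s ^+ n)).
    by rewrite ler_wpM2r ?exprn_ge0//; apply: (@npow_le s n.+1); rewrite s0.
  have sS : s ^+ n <= 2 * s ^+ n.+1.
    by rewrite exprS mulrA ler_peMl ?exprn_ge0// -ler_pdivrMl// mulr1.
  rewrite [2 / _]mulrC -[leRHS]mulrA ler_wpM2l// invr_ge0 subr_ge0.
  exact: ltW.
have gs : cvgn (series (fun n => M * (2 * (1 - s)^-1) * s ^+ n)).
  by apply: cvgn_seriesZ; apply: geometric_summable; rewrite s0.
pose q w := csum (fun n => c n * S n w).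
have qsum w : nrm w <= rho -> csummable (fun n => c n * S n w).
  move=> wr; apply: (summable_le gs) => n.
  by rewrite nrmM -mulrA; apply: ler_pM; rewrite ?nrm_ge0//; exact: Sb.
have near_rho w : nrm (w - z) < rho - nrm z -> nrm w < rho.
  by move=> h; have := nrmD (w - z) z; rewrite subrK; lra.
have qc : q w @[w --> z] --> q z.
  apply: (@tannery R C (nbhs z) _ (fun n w => c n * S n w) _
      (fun n => M * (2 * (1 - s)^-1) * s ^+ n) gs).
    apply/near_nrmP; exists (rho - nrm z); first by rewrite subr_gt0.
    move=> w /near_rho/ltW wr n.
    by rewrite nrmM -mulrA; apply: ler_pM; rewrite ?nrm_ge0//; exact: Sb.
  move=> n; apply: cvgM; first exact: cvg_cst.
  apply: ccvg_sum => i; apply: cvgM; last exact: cvg_cst.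
  by apply: derivable_cts; exact: derivable_expn.
exists (q z) => e e0.
move/(@ccvg_lt R _ (nbhs z)) : qc => /(_ e e0)/near_nrmP[d d0 dP].
exists (Num.min d (rho - nrm z)); first by rewrite lt_min d0 subr_gt0.
move=> w; rewrite lt_min => /andP[wd /near_rho wr].
have -> : pser c w - pser c z = (w - z) * q w.
  have sw := pser_summable cM (lt_trans wr rho1).
  have sz := pser_summable cM z1.
  rewrite /pser -[- csum _]mulN1r -csumZ// -csumD//; last exact: summableZ.
  rewrite /q -csumZ; last by apply: qsum; exact: ltW.
  by apply: csum_eq => n; rewrite mulN1r -mulrBr SE mulrCA.
rewrite [q z * _]mulrC -mulrBr nrmM mulrC ler_wpM2r ?nrm_ge0//.
by apply: ltW; exact: dP.
Qed.

Lemma eq_cderiv (k h : C -> C) z A (d : R) : 0 < d ->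
  (forall w, nrm (w - z) < d -> k w = h w) -> cderiv k z A -> cderiv h z A.
Proof.
move=> d0 kh kA e e0; have [d' d'0 dP] := kA e e0.
exists (Num.min d d'); first by rewrite lt_min d0.
move=> w; rewrite lt_min => /andP[wd wd'].
by rewrite -kh// -(kh z) ?subrr ?nrm0//; exact: dP.
Qed.

Lemma pser_derivable h c M : (forall n, nrm (c n) <= M) ->
  (forall z, nrm z < 1 -> h z = pser c z) ->
  forall z, nrm z < 1 -> derivable h z 1.
Proof.
move=> cM hc z z1; apply/cderivP; have [A cA] := pser_cderiv cM z1; exists A.
apply: (@eq_cderiv (pser c) h z A (1 - nrm z)) => //; first by rewrite subr_gt0.
move=> w wz; rewrite hc//.
by have := nrmD (w - z) z; rewrite subrK; lra.
Qed.

(** Dominated convergence on the circle of radius 1/2 makes the Taylor coefficients converge. They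
    are all bounded by [M], so [tannery] sums the limits to [h], which is therefore a power series
    with bounded coefficients. *)
Lemma bounded_limit_derivable (f : nat -> C -> C) h M :
  (forall k z, nrm z < 1 -> derivable (f k) z 1) ->
  (forall k z, nrm z < 1 -> nrm (f k z) <= M) ->
  (forall z, nrm z < 1 -> f k z @[k --> \oo] --> h z) ->
  forall z, nrm z < 1 -> derivable h z 1.
Proof.
move=> df fM fh; pose r : R := 2^-1.
have r0 : 0 < r by rewrite invr_gt0.
have r1 : r < 1 by rewrite invf_lt1// ltr1n.
pose c n : C := taylor_coef h r n.
have fc n : taylor_coef (f k) r n @[k --> \oo] --> c n.
  pose g k (t : R) : C := f k (r%:C * expi t) * (r%:C * expi t)^-1 ^+ n.
  have gi k : cintegrable I0 (g k) by apply: (taylor_coef_integrable (df k)).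
  have nz (t : R) : nrm (r%:C * expi t) = r by rewrite nrm_circ// ltW.
  apply: (@cmean_dct R g _ (M * r^-1 ^+ n) gi _ _).2.
    by move=> t; apply: cvgM; [apply: fh; rewrite nz|exact: cvg_cst].
  move=> k t; rewrite nrmM nrmX nrmV nz.
  by rewrite ler_wpM2r ?exprn_ge0 ?invr_ge0 ?(ltW r0)// fM// nz.
have fkM k n : nrm (taylor_coef (f k) r n) <= M.
  by have [c' [cM _ <-]] := taylor_expansion (df k) (fM k).
have cM n : nrm (c n) <= M.
  rewrite -(cvg_lim _ (ccvg_nrm (fc n)))//; apply: limr_le.
    by apply: cvgP (ccvg_nrm (fc n)).
  exact: nearW.
apply: (pser_derivable cM) => z z1.
have : f k z @[k --> \oo] --> pser c z.
  have -> : (fun k => f k z) = (fun k => csum (fun n => taylor_coef (f k) r n * z ^+ n)).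
    apply/funext => k; have [c' [_ fE c'E]] := taylor_expansion (df k) (fM k).
    by rewrite fE// /pser c'E.
  apply: (@tannery R nat _ _ (fun n k => taylor_coef (f k) r n * z ^+ n) _
      (fun n => M * nrm z ^+ n)).
  - by apply: cvgn_seriesZ; apply: geometric_summable; rewrite nrm_ge0.
  - apply: nearW => k n; rewrite nrmM nrmX ler_wpM2r ?exprn_ge0 ?nrm_ge0//.
  - by move=> n; apply: cvgM; [exact: fc|exact: cvg_cst].
by move=> /ccvg_lim <-; apply/esym/ccvg_lim; exact: fh.
Qed.

End PowerSeries.

(** * Poisson representation *)

Section PoissonRepresentation.
Variable R : realType.
Local Notation C := (Cx R).
Local Notation nrm := (@Normc.normc R).
Local Notation I0 := [set` `[(0 : R), 2 * pi]].
Implicit Types (z w : C) (a c : nat -> C).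

Lemma cmean_csumM (f : nat -> R -> C) (M : nat -> R) (g : R -> C) (B : R) :
  cvgn (series M) ->
  (forall n (t : R), f n x @[x --> t] --> f n t) ->
  (forall n t, nrm (f n t) <= M n) ->
  (forall t : R, g x @[x --> t] --> g t) -> (forall t, nrm (g t) <= B) ->
  cintegrable I0 (fun t => csum (f ^~ t) * g t) /\
  cmean (fun t => csum (f ^~ t) * g t) = csum (fun n => cmean (fun t => f n t * g t)).
Proof.
move=> cM fc fM gc gB.
have sf t : csummable (f ^~ t) by apply: (summable_le cM).
have fi n : cintegrable I0 (fun t => f n t * g t).
  by apply: cintegrable_cts => t; apply: cvgM; [exact: fc|exact: gc].
have fb n t : nrm (f n t * g t) <= B * M n.
  by rewrite nrmM mulrC; apply: ler_pM; rewrite ?nrm_ge0.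
have [i e] := cmean_csum (cvgn_seriesZ cM) fi fb.
have E : (fun t => csum (fun n => f n t * g t)) = (fun t => csum (f ^~ t) * g t).
  apply/funext => t; rewrite mulrC -csumZ//.
  by apply: csum_eq => n; rewrite mulrC.
by rewrite -E.
Qed.

Lemma pser_mean a (g : R -> C) (B : R) : csummable a ->
  (forall t : R, g x @[x --> t] --> g t) -> (forall t, nrm (g t) <= B) ->
  cintegrable I0 (fun t => pser a (expi t) * g t) /\
  cmean (fun t => pser a (expi t) * g t) =
    csum (fun n => a n * cmean (fun t => expi t ^+ n * g t)).
Proof.
move=> sa gc gB.
have [||||i e] := @cmean_csumM (fun n t => a n * expi t ^+ n) (fun n => nrm (a n)) g B sa.
- by move=> n t; apply: cvgM; [exact: cvg_cst|exact: cts_expiX].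
- by move=> n t; rewrite nrmM nrmX nrm_expi expr1n mulr1.
- exact: gc.
- exact: gB.
split; first exact: i.
rewrite [LHS]e; apply: csum_eq => n; rewrite -cmeanZ.
  by apply: eq_cmean => t _; rewrite mulrA.
by apply: cintegrable_cts => t; apply: cvgM; [exact: cts_expiX|exact: gc].
Qed.

Lemma pser_cts1 a (t : R) : csummable a ->
  pser a (expi x) @[x --> t] --> pser a (expi t).
Proof.
move=> sa; apply: (@tannery R R (nbhs t) _ (fun n x => a n * expi x ^+ n) _
  (fun n => nrm (a n))) => //.
  by apply: nearW => x n; rewrite nrmM nrmX nrm_expi expr1n mulr1.
by move=> n; apply: cvgM; [exact: cvg_cst|exact: cts_expiX].
Qed.

Lemma csum_real (b : nat -> R) : cvgn (series b) ->
  csum (fun n => (b n)%:C : C) = (limn (series b))%:C.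
Proof.
move=> cb; apply: csumP.
have -> : series (fun n => (b n)%:C : C) = (fun n => (series b n)%:C : C).
  by apply/funext => n; rewrite /series/= rmorph_sum.
exact: ccvg_real.
Qed.

Lemma ccvg_conj (T : Type) (F : set_system T) (FF : Filter F) (f : T -> C) l :
  f x @[x --> F] --> l -> Num.conj (f x) @[x --> F] --> Num.conj l.
Proof.
move=> fl; apply: ccvg_ReIm.
  by under eq_fun do rewrite cReJ; rewrite cReJ; exact: ccvg_Re.
by under eq_fun do rewrite cImJ; rewrite cImJ; apply: cvgN; exact: ccvg_Im.
Qed.

Lemma mulcJ z : z * Num.conj z = (nrm z ^+ 2)%:C.
Proof. by apply: complex_eq; rewrite ?cReM ?cImM cReJ cImJ sqr_nrm /=; ring. Qed.

(** Absolute summability justifies the termwise means. It holds for the coefficients of a bounded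
    function on each circle of radius below 1, which is where the identity is applied. *)
Lemma parseval a : csummable a -> [/\ cvgn (series (fun n => nrm (a n) ^+ 2)),
  cintegrable I0 (fun t => (nrm (pser a (expi t)) ^+ 2)%:C : C) &
  cmean (fun t => (nrm (pser a (expi t)) ^+ 2)%:C) =
    (limn (series (fun n => nrm (a n) ^+ 2)))%:C].
Proof.
move=> sa.
have sq : cvgn (series (fun n => nrm (a n) ^+ 2)).
  apply: (@cvgn_le_summable _ _
      (fun n => limn (series (fun n => nrm (a n))) * nrm (a n))); last first.
    exact: cvgn_seriesZ.
  move=> n; rewrite sqr_ge0 expr2 ler_wpM2r ?nrm_ge0//.
  by apply: (rsum_term_le (a := fun n => nrm (a n))) => // k; exact: nrm_ge0.
have ub t : nrm (pser a (expi t)) <= limn (series (fun n => nrm (a n))).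
  by apply: nrm_csum => // n; rewrite nrmM nrmX nrm_expi expr1n mulr1.
have [||i e] := @pser_mean a (fun t => Num.conj (pser a (expi t)))
    (limn (series (fun n => nrm (a n)))) sa.
- by move=> t; apply: ccvg_conj; exact: (pser_cts1 sa).
- by move=> t; rewrite nrmJ.
have E : (fun t => pser a (expi t) * Num.conj (pser a (expi t))) =
    (fun t => (nrm (pser a (expi t)) ^+ 2)%:C).
  by apply/funext => t; rewrite mulcJ.
rewrite -E; split=> //; rewrite [LHS]e -csum_real//; apply: csum_eq => n.
rewrite -mulcJ; congr (_ * _).
have [||j e2] := @pser_mean a (fun t => (expi t)^-1 ^+ n) 1 sa.
- by move=> t; exact: cts_expiVX.
- by move=> t; rewrite nrmX nrmV nrm_expi invr1 expr1n.
have -> : (fun t => expi t ^+ n * Num.conj (pser a (expi t))) =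
    (fun t => Num.conj (pser a (expi t) * (expi t)^-1 ^+ n)).
  apply/funext => t; rewrite -expiX mulrC [RHS]rmorphM; congr (_ * _).
  exact/esym/conjCK.
rewrite cmeanJ//; congr Num.conj; rewrite e2 (csum_single (k := n)).
  by rewrite (cmean_expi_mix _ n n).2 eqxx mulr1.
by move=> k kn; rewrite (cmean_expi_mix _ k n).2 (negbTE kn) mulr0.
Qed.

Definition poisson w z : R := (1 - nrm w ^+ 2) / nrm (z - w) ^+ 2.

Section Kernel.
Variable w : C.
Hypothesis w1 : nrm w < 1.

Lemma expi_sub_neq0 (t : R) : expi t - w != 0.
Proof.
by rewrite subr_eq0; apply: contraTneq w1 => <-; rewrite nrm_expi ltxx.
Qed.

Lemma poisson_ge0 (z : C) : 0 <= poisson w z.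
Proof.
apply: divr_ge0; last exact: sqr_ge0.
by rewrite subr_ge0 exprn_ile1// ?nrm_ge0// ltW.
Qed.

Lemma poisson_cts (t : R) :
  ((poisson w (expi x))%:C : C) @[x --> t] --> ((poisson w (expi t))%:C : C).
Proof.
apply: ccvg_real; rewrite /poisson; apply: cvgM; first exact: cvg_cst.
apply: cvgV; first by rewrite expf_neq0// nrm_eq0 expi_sub_neq0.
have nc : nrm (expi x - w) @[x --> t] --> nrm (expi t - w).
  by apply: ccvg_nrm; apply: cvgB; [exact: cts_expi|exact: cvg_cst].
by under eq_fun do rewrite expr2; rewrite expr2; exact: cvgM.
Qed.

Lemma nrm_poisson (t : R) :
  nrm ((poisson w (expi t))%:C : C) <= (1 - nrm w ^+ 2) / (1 - nrm w) ^+ 2.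
Proof.
rewrite nrm_real ger0_norm ?poisson_ge0//.
have d0 : 0 < 1 - nrm w by rewrite subr_gt0.
have d : 1 - nrm w <= nrm (expi t - w).
  rewrite lerBlDr; have := nrmD (expi t - w) w; rewrite subrK nrm_expi//.
rewrite ler_wpM2l//; first by rewrite subr_ge0 exprn_ile1// ?nrm_ge0// ltW.
rewrite lef_pV2 ?posrE ?exprn_gt0//; last exact: lt_le_trans d.
by rewrite lerXn2r ?nnegrE ?nrm_ge0// ltW.
Qed.

(** With [q = w / expi t] and its conjugate [p], the two geometric sums give [(1 - q)^-1 + (1 -
    p)^-1 - 1 = (1 - q p) / ((1 - q) (1 - p))]. *)
Lemma poissonE (t : R) : (poisson w (expi t))%:C =
  csum (fun n => w ^+ n * (expi t)^-1 ^+ n) +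
  csum (fun n => Num.conj w ^+ n * expi t ^+ n) - 1 :> C.
Proof.
pose q : C := w / expi t; pose p : C := Num.conj w * expi t.
have nq : nrm q = nrm w by rewrite nrmM nrmV nrm_expi invr1 mulr1.
have np : nrm p = nrm w by rewrite nrmM nrmJ nrm_expi mulr1.
have E1 : csum (fun n => w ^+ n * (expi t)^-1 ^+ n) = (1 - q)^-1.
  by rewrite -csum_geometric ?nq//; apply: csum_eq => n; rewrite -exprMn.
have E2 : csum (fun n => Num.conj w ^+ n * expi t ^+ n) = (1 - p)^-1.
  by rewrite -csum_geometric ?np//; apply: csum_eq => n; rewrite -exprMn.
transitivity ((1 - q)^-1 + (1 - p)^-1 - 1 : C); last first.
  by congr (_ + _ - 1); apply/esym; [exact: E1|exact: E2].
have q0 : 1 - q != 0.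
  by rewrite subr_eq0; apply: contraTneq w1 => q1; rewrite -nq -q1 nrm1 ltxx.
have p0 : 1 - p != 0.
  by rewrite subr_eq0; apply: contraTneq w1 => p1; rewrite -np -p1 nrm1 ltxx.
have cp : Num.conj (1 - q) = 1 - p.
  have -> : p = Num.conj q.
    have eJ : Num.conj (expi t)^-1 = expi t by rewrite -expiN -expiJ conjCK.
    by rewrite /q [RHS]rmorphM; congr (_ * _); exact/esym/eJ.
  by rewrite rmorphB rmorph1.
have e1 : (nrm (expi t - w) ^+ 2)%:C = (1 - q) * (1 - p) :> C.
  have -> : expi t - w = expi t * (1 - q).
    by rewrite mulrBr mulr1 /q mulrCA divff ?mulr1// expi_neq0.
  by rewrite nrmM nrm_expi mul1r -mulcJ cp.
have e2 : (nrm w ^+ 2)%:C = q * p :> C.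
  rewrite -mulcJ /q /p mulrACA [(expi t)^-1 * _]mulrC divff ?mulr1//.
  exact: expi_neq0.
have -> : (poisson w (expi t))%:C =
    (1 - (nrm w ^+ 2)%:C) / (nrm (expi t - w) ^+ 2)%:C :> C.
  by rewrite /poisson rmorphM fmorphV rmorphB rmorph1.
rewrite e1 e2; field.
by rewrite q0 p0.
Qed.

(** In the expansion [poissonE] the first series contributes [w ^+ j]. The second contributes only
    its term of index 0, the mean of [expi t ^+ j], and the final [- 1] takes this away. *)
Lemma cmean_poisson j :
  cmean (fun t => expi t ^+ j * (poisson w (expi t))%:C) = w ^+ j.
Proof.
have w01 : 0 <= nrm w < 1 by rewrite nrm_ge0.
have gs := geometric_summable w01.
have [||||i1 e1] := @cmean_csumM (fun n t => w ^+ n * (expi t)^-1 ^+ n)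
    (fun n => nrm w ^+ n) (fun t => expi t ^+ j) 1 gs.
- by move=> n t; apply: cvgM; [exact: cvg_cst|exact: cts_expiVX].
- by move=> n t; rewrite nrmM !nrmX nrmV nrm_expi invr1 expr1n mulr1.
- by move=> t; exact: cts_expiX.
- by move=> t; rewrite nrmX nrm_expi expr1n.
have [||||i2 e2] := @cmean_csumM (fun n t => Num.conj w ^+ n * expi t ^+ n)
    (fun n => nrm w ^+ n) (fun t => expi t ^+ j) 1 gs.
- by move=> n t; apply: cvgM; [exact: cvg_cst|exact: cts_expiX].
- by move=> n t; rewrite nrmM !nrmX nrmJ nrm_expi expr1n mulr1.
- by move=> t; exact: cts_expiX.
- by move=> t; rewrite nrmX nrm_expi expr1n.
have i3 := cintegrable_expiX R j.
rewrite (@eq_cmean _ _ (fun t => (csum (fun n => w ^+ n * (expi t)^-1 ^+ n) * expi t ^+ j +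
  csum (fun n => Num.conj w ^+ n * expi t ^+ n) * expi t ^+ j) - expi t ^+ j)); last first.
  by move=> t _; rewrite mulrC poissonE mulrBl mulrDl mul1r.
rewrite cmeanB//; last exact: cintegrableD.
rewrite cmeanD//.
transitivity (w ^+ j + cmean (fun t : R => expi t ^+ j) - cmean (fun t : R => expi t ^+ j));
  last by rewrite addrK.
congr (_ + _ - _); [rewrite [LHS]e1|rewrite [LHS]e2].
  have E n : cmean (fun t => w ^+ n * (expi t)^-1 ^+ n * expi t ^+ j) =
      w ^+ n * (j == n)%:R.
    rewrite -(cmean_expi_mix _ j n).2 -cmeanZ; last exact: (cmean_expi_mix _ j n).1.
    by apply: eq_cmean => t _; rewrite -mulrA [(expi t)^-1 ^+ n * _]mulrC.
  rewrite (csum_single (k := j)) ?E ?eqxx ?mulr1// => n nj.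
  by rewrite E eq_sym (negbTE nj) mulr0.
have E n : cmean (fun t => Num.conj w ^+ n * expi t ^+ n * expi t ^+ j) =
    Num.conj w ^+ n * cmean (fun t => expi t ^+ (n + j)).
  rewrite -cmeanZ; last exact: cintegrable_expiX.
  by apply: eq_cmean => t _; rewrite -mulrA -exprD.
rewrite (csum_single (k := 0%N)) ?E ?expr0 ?mul1r// => n n0.
by rewrite E cmean_expi_pos ?mulr0// addn_gt0 lt0n n0.
Qed.

Lemma pser_poisson a : csummable a ->
  cmean (fun t => pser a (expi t) * (poisson w (expi t))%:C) = pser a w.
Proof.
move=> sa; have [_ ->] := pser_mean sa poisson_cts nrm_poisson.
by apply: csum_eq => n; rewrite cmean_poisson.
Qed.

End Kernel.
End PoissonRepresentation.

(** * The boundary function of a bounded power series *)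

Section BoundaryFunction.
Variable R : realType.
Local Notation C := (Cx R).
Local Notation nrm := (@Normc.normc R).
Local Notation Re := (@complex.Re R).
Local Notation mu := (@lebesgue_measure R).
Local Notation I0 := [set` `[(0 : R), 2 * pi]].
Implicit Types (z w : C).

Lemma Re_cmean_real (f : R -> R) :
  Re (cmean (fun t => (f t)%:C)) = (2 * pi)^-1 * \int[mu]_(t in I0) f t.
Proof. by rewrite /cmean cReZ. Qed.

Lemma rcvg_series (f : nat -> nat -> R) (l : nat -> R) N :
  (forall n, f n k @[k --> \oo] --> l n) ->
  series (f ^~ k) N @[k --> \oo] --> series l N.
Proof.
have S0 g : series g 0 = 0 :> R by rewrite /series/= big_geq.
have S g n : series g n.+1 = series g n + g n :> R.
  by rewrite /series/= big_nat_recr.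
move=> fl; elim: N => [|N IHN].
  by under eq_fun do rewrite S0; rewrite S0; exact: cvg_cst.
under eq_fun do rewrite S.
by rewrite S; apply: cvgD; [exact: IHN|exact: fl].
Qed.

Definition rho_seq (k : nat) : R := 1 - 2^-1 ^+ k.+1.

Lemma rho_seq_bnd k : 0 < rho_seq k < 1.
Proof.
rewrite /rho_seq; have p : 0 < (2 : R)^-1 ^+ k.+1 < 1.
  by rewrite exprn_gt0//= exprn_ilt1// invf_lt1// ltr1n.
by case/andP: p => p1 p2; apply/andP; split; lra.
Qed.

Lemma rho_seq_cvg : rho_seq k @[k --> \oo] --> (1 : R).
Proof.
rewrite /rho_seq -[X in _ --> X]subr0; apply: cvgB; first exact: cvg_cst.
have := @cvg_expr R 2^-1; rewrite ger0_norm// invf_lt1// ltr1n => /(_ isT) h.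
by move: h; rewrite -(cvg_shiftS (fun k => (2 : R)^-1 ^+ k : R)).
Qed.

Lemma rho_seqX_cvg n : rho_seq k ^+ n @[k --> \oo] --> (1 : R).
Proof.
elim: n => [|n IH]; first by under eq_fun do rewrite expr0; exact: cvg_cst.
rewrite -[X in _ --> X](mulr1 1); under eq_fun do rewrite exprS.
by apply: cvgM; [exact: rho_seq_cvg|exact: IH].
Qed.

Section Function.
Variables (h : C -> C) (c : nat -> C) (M : R).
Hypothesis hM : forall z, nrm z < 1 -> nrm (h z) <= M.
Hypothesis cM : forall n, nrm (c n) <= M.
Hypothesis hc : forall z, nrm z < 1 -> h z = pser c z.

Let H (r t : R) : C := h (r%:C * expi t).
Let a (r : R) n : C := c n * r%:C ^+ n.

Let M0 : 0 <= M := le_trans (nrm_ge0 _) (cM 0%N).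

Let a_sum (r : R) : 0 < r < 1 -> csummable (a r).
Proof.
move=> /andP[r0 r1]; apply: (@pser_summable R c M r%:C cM).
by rewrite nrm_real gtr0_norm.
Qed.

Let HE (r t : R) : 0 < r < 1 -> H r t = pser (a r) (expi t).
Proof.
move=> /andP[r0 r1]; rewrite /H hc; last by rewrite nrm_circ// ltW.
by apply: csum_eq => n; rewrite /a exprMn mulrA.
Qed.

Let HM (r t : R) : 0 < r < 1 -> nrm (H r t) <= M.
Proof. by move=> /andP[r0 r1]; apply: hM; rewrite nrm_circ// ltW. Qed.

Let H_cts (r t : R) : 0 < r < 1 -> H r x @[x --> t] --> H r t.
Proof.
move=> r01; rewrite HE//; under eq_fun do rewrite HE//.
by apply: pser_cts1; exact: a_sum.
Qed.

Let H_int (r : R) : 0 < r < 1 -> cintegrable I0 (H r).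
Proof. by move=> r01; apply: cintegrable_cts => t; exact: H_cts. Qed.

(** By [parseval] a partial sum at radius [r] is at most the mean of [|H r| ^ 2], hence at most
    [M ^ 2]; in finitely many terms [r] may tend to 1. *)
Let bessel : cvgn (series (fun n => nrm (c n) ^+ 2)).
Proof.
apply: (@rsum_bounded _ _ (M ^+ 2)) => [n|N]; first exact: sqr_ge0.
have le k : series (fun n => nrm (a (rho_seq k) n) ^+ 2) N <= M ^+ 2.
  have rk := rho_seq_bnd k.
  have [sq i e] := parseval (a_sum rk).
  apply: le_trans (rsum_partial_le N _ sq) _; first by move=> n; exact: sqr_ge0.
  have -> : limn (series (fun n => nrm (a (rho_seq k) n) ^+ 2)) =
    Re (cmean (fun t => (nrm (pser (a (rho_seq k)) (expi t)) ^+ 2)%:C)) by rewrite e.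
  apply: le_trans (ler_norm _) _; apply: le_trans (Re_le_nrm _) _.
  apply: (nrm_cmean_le i) => t _; rewrite -HE//.
  by rewrite nrm_real ger0_norm ?sqr_ge0// lerXn2r ?nnegrE ?nrm_ge0// HM.
have cv : series (fun n => nrm (a (rho_seq k) n) ^+ 2) N @[k --> \oo] -->
    series (fun n => nrm (c n) ^+ 2) N.
  apply: rcvg_series => n.
  have -> : (fun k => nrm (a (rho_seq k) n) ^+ 2) =
      (fun k => nrm (c n) ^+ 2 * rho_seq k ^+ (n * 2)).
    apply/funext => k; have /andP[r0 _] := rho_seq_bnd k.
    by rewrite /a nrmM nrmX nrm_real gtr0_norm// exprMn exprM.
  rewrite -[X in _ --> X]mulr1; apply: cvgM; first exact: cvg_cst.
  exact: rho_seqX_cvg.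
by rewrite -(cvg_lim _ cv)//; apply: limr_le; [apply: cvgP cv|exact: nearW].
Qed.

Let d (r : R) n : R := nrm (c n) ^+ 2 * (1 - r ^+ n) ^+ 2.
(** The squared L^2 distance from [H r] to the boundary function, written in coefficients because
    that function is still to be constructed. *)
Let D (r : R) : R := limn (series (d r)).

Let pow01 (r : R) n : 0 < r < 1 -> 0 <= 1 - r ^+ n <= 1.
Proof.
move=> /andP[r0 r1]; rewrite subr_ge0 exprn_ile1 ?(ltW r0) ?(ltW r1)//=.
by rewrite gerBl exprn_ge0// ltW.
Qed.

Let d_bnd (r : R) n : 0 < r < 1 -> 0 <= d r n <= nrm (c n) ^+ 2.
Proof.
move=> /(pow01 n)/andP[p0 p1]; rewrite /d mulr_ge0 ?sqr_ge0//=.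
by rewrite ler_piMr ?sqr_ge0// exprn_ile1.
Qed.

Let d_sum (r : R) : 0 < r < 1 -> cvgn (series (d r)).
Proof. by move=> r01; apply: cvgn_le_summable bessel => n; exact: d_bnd. Qed.

Let D_cvg : D (rho_seq k) @[k --> \oo] --> (0 : R).
Proof.
have T : csum (fun n => (d (rho_seq k) n)%:C : C) @[k --> \oo] -->
    csum (fun n => 0 : C).
  apply: (@tannery R nat _ _ (fun n k => (d (rho_seq k) n)%:C) _
      (fun n => nrm (c n) ^+ 2) bessel).
    apply: nearW => k n; have /andP[? ?] := d_bnd n (rho_seq_bnd k).
    by rewrite nrm_real ger0_norm.
  move=> n; apply: ccvg_real; rewrite /d -[X in _ --> X](mulr0 (nrm (c n) ^+ 2)).
  apply: cvgM; first exact: cvg_cst.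
  have p : 1 - rho_seq k ^+ n @[k --> \oo] --> (0 : R).
    rewrite -[X in _ --> X](subrr 1); apply: cvgB; first exact: cvg_cst.
    exact: rho_seqX_cvg.
  by rewrite -[X in _ --> X](mulr0 0); under eq_fun do rewrite expr2; exact: cvgM.
have c0 : csum (fun n => 0 : C) = 0 by rewrite (csum_single (k := 0%N)).
rewrite c0 in T; have := ccvg_Re T.
have -> : (fun k => Re (csum (fun n => (d (rho_seq k) n)%:C : C))) =
    (fun k => D (rho_seq k)).
  apply/funext => k; rewrite csum_real//.
  by apply: d_sum; exact: rho_seq_bnd.
exact.
Qed.

(** [parseval] for the coefficients [c n * (r ^ n - s ^ n)]. As [x = 1 - r ^ n] and [y = 1 - s ^ n]
    are nonnegative, [(y - x) ^ 2 <= x ^ 2 + y ^ 2]. *)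
Let mean_sqr_diff (r s : R) : 0 < r < 1 -> 0 < s < 1 ->
  cintegrable I0 (fun t => (nrm (H r t - H s t) ^+ 2)%:C : C) /\
  Re (cmean (fun t => (nrm (H r t - H s t) ^+ 2)%:C)) <= D r + D s.
Proof.
move=> r01 s01; pose b n := a r n - a s n.
have sb : csummable b.
  have sN : csummable (fun n => -1 * a s n) by apply: summableZ; exact: a_sum.
  have := summableD (a_sum r01) sN; rewrite (_ : (fun n => _) = b)//.
  by apply/funext => n; rewrite mulN1r.
have bE t : pser b (expi t) = H r t - H s t.
  rewrite !HE// /pser -[- csum _]mulN1r.
  have st (x : R) : 0 < x < 1 -> csummable (fun n => a x n * expi t ^+ n).
    by move=> /a_sum sx; apply: (summable_le sx) => n; rewrite nrmM nrmX nrm_expi expr1n mulr1.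
  rewrite -(csumZ _ (st s s01)) -(csumD (st r r01) (summableZ (a := -1) (st s s01))).
  by apply: csum_eq => n; rewrite mulN1r -mulrBl.
have [sq i e] := parseval sb.
have E : (fun t => (nrm (pser b (expi t)) ^+ 2)%:C : C) =
    (fun t => (nrm (H r t - H s t) ^+ 2)%:C) by apply/funext => t; rewrite bE.
rewrite -E; split; first exact: i.
rewrite e /=; apply: rsum_le => // N.
apply: (@le_trans _ _ (series (d r) N + series (d s) N)); last first.
  have d0 x n : 0 < x < 1 -> 0 <= d x n by move=> /(d_bnd n)/andP[].
  apply: lerD; apply: rsum_partial_le.
  - by move=> n; exact: d0.
  - exact: d_sum.
  - by move=> n; exact: d0.
  - exact: d_sum.
rewrite /series/= -big_split; apply: ler_sum => n _ /=.
have -> : b n = c n * (r ^+ n - s ^+ n)%:C.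
  by rewrite /b /a -mulrBr rmorphB !rmorphXn.
rewrite nrmM exprMn nrm_real real_normK ?num_real// /d -mulrDr.
rewrite ler_wpM2l ?sqr_ge0//.
have /andP[x0 x1] := pow01 n r01; have /andP[y0 y1] := pow01 n s01.
move: x0 y0; set x := 1 - r ^+ n; set y := 1 - s ^+ n => x0 y0.
have -> : r ^+ n - s ^+ n = y - x by rewrite /x /y; ring.
have -> : x ^+ 2 + y ^+ 2 = (y - x) ^+ 2 + 2 * (x * y) by ring.
by rewrite lerDl mulr_ge0// mulr_ge0.
Qed.

Let int_diff (r s e : R) : 0 < r < 1 -> 0 < s < 1 -> 0 < e ->
  D r <= e ^+ 2 -> D s <= e ^+ 2 ->
  \int[mu]_(t in I0) nrm (H r t - H s t) <= 2 * pi * (2 * e).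
Proof.
move=> r01 s01 e0 Dr Ds; have [iq q] := mean_sqr_diff r01 s01.
have iN : cintegrable I0 (fun t => H r t - H s t).
  by apply: cintegrableB => //; exact: H_int.
have iN' := integrable_nrm (measurable_itv _) iN.
rewrite -ler_pdivrMl ?pi2_gt0// -Re_cmean_real.
(* The inequality [x <= e / 2 + x ^ 2 / (2 e)] takes the place of Cauchy-Schwarz. The two summands
   have means at most [e / 2] and [e], together below [2 e]. *)
pose g t : R := e / 2 + (2 * e)^-1 * nrm (H r t - H s t) ^+ 2.
have gE t : (g t)%:C = (e / 2)%:C +
    ((2 * e)^-1)%:C * (nrm (H r t - H s t) ^+ 2)%:C :> C.
  by apply: complex_eq; rewrite ?cReD ?cImD ?cReZ ?cImZ /= ?mulr0 ?addr0.
have ic : cintegrable I0 (fun=> (e / 2)%:C : C).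
  by apply: cts_cintegrable => t _; exact: cvg_cst.
have iq2 : cintegrable I0 (fun t => ((2 * e)^-1)%:C * (nrm (H r t - H s t) ^+ 2)%:C : C).
  exact: cintegrableZ.
have ig : cintegrable I0 (fun t => (g t)%:C : C).
  rewrite (_ : (fun t => _) = (fun t => (e / 2)%:C +
    ((2 * e)^-1)%:C * (nrm (H r t - H s t) ^+ 2)%:C)); last exact/funext/gE.
  exact: cintegrableD.
apply: (@le_trans _ _ (Re (cmean (fun t => (g t)%:C)))).
  rewrite !Re_cmean_real ler_wpM2l ?invr_ge0 ?pi2_ge0//.
  apply: le_Rintegral => //; first by case: ig.
  move=> t _; rewrite /g; set x := nrm _.
  have -> : e / 2 + (2 * e)^-1 * x ^+ 2 = x + (x - e) ^+ 2 / (2 * e).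
    by field; rewrite gt_eqF.
  by rewrite lerDl divr_ge0 ?sqr_ge0// mulr_ge0// ltW.
have -> : cmean (fun t => (g t)%:C : C) = (e / 2)%:C +
    ((2 * e)^-1)%:C * cmean (fun t => (nrm (H r t - H s t) ^+ 2)%:C).
  rewrite -cmeanZ// -[X in X + _](cmean_cst (e / 2)%:C) -cmeanD//.
  by apply: eq_cmean => t _; exact: gE.
rewrite cReD cReZ /=; apply: (@le_trans _ _ (e / 2 + (2 * e)^-1 * (e ^+ 2 + e ^+ 2))).
  rewrite lerD2l ler_wpM2l ?invr_ge0 ?mulr_ge0 ?(ltW e0)//.
  by apply: le_trans q _; exact: lerD.
have -> : e / 2 + (2 * e)^-1 * (e ^+ 2 + e ^+ 2) = e / 2 + e.
  by field; rewrite gt_eqF.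
rewrite [leRHS]mulr_natl mulr2n lerD2r ler_pdivrMr//.
by rewrite mulrDr mulr1 lerDl ltW.
Qed.

Let radii : exists r : nat -> R, [/\ forall k, 0 < r k < 1,
  r k @[k --> \oo] --> (1 : R) & forall k, D (r k) <= (2^-1 ^+ k) ^+ 2].
Proof.
have ex k : exists j, (k <= j)%N /\ D (rho_seq j) <= (2^-1 ^+ k) ^+ 2.
  have e0 : 0 < ((2 : R)^-1 ^+ k) ^+ 2 by rewrite !exprn_gt0.
  move/cvgrPdist_lt : D_cvg => /(_ _ e0)[j _ jP].
  exists (maxn j k); split; first exact: leq_maxr.
  have := jP (maxn j k) (leq_maxl _ _); rewrite /= sub0r normrN.
  by move=> /(le_lt_trans (ler_norm _))/ltW.
have [j jP] := choice ex; exists (rho_seq \o j); split => [k||k].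
- exact: rho_seq_bnd.
- apply/cvgrPdist_lt => e e0; move/cvgrPdist_lt : rho_seq_cvg => /(_ _ e0)[N _ NP].
  near=> k; apply: NP; rewrite /= (leq_trans _ (jP k).1)//.
  by near: k; exact: nbhs_infty_ge.
- exact: (jP k).2.
Unshelve. all: by end_near. Qed.

(* The boundary function is the a.e. limit of [h (r_k .)] along a sequence of
   radii for which these functions form a rapidly convergent Cauchy sequence in
   L^2, hence in L^1. *)
Lemma boundary_function : exists F : R -> C, cintegrable I0 F /\
  forall w, nrm w < 1 ->
    cintegrable I0 (fun t => F t * (poisson w (expi t))%:C) /\
    h w = cmean (fun t => F t * (poisson w (expi t))%:C).
Proof.
have [r [r01 r1 rD]] := radii.
pose f k (t : R) : C := if k is j.+1 then H (r k) t - H (r j) t else H (r 0%N) t.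
have fi k : cintegrable I0 (f k).
  by case: k => [|k]; [exact: H_int|apply: cintegrableB => //; exact: H_int].
have fS n t : series (f ^~ t) n.+1 = H (r n) t.
  elim: n => [|n IH]; first by rewrite /series/= big_nat1.
  have -> : series (f ^~ t) n.+2 = series (f ^~ t) n.+1 + f n.+1 t.
    by rewrite /series/= big_nat_recr.
  by rewrite IH /f addrC subrK.
(* [2 pi M] is for the first term. At index [k + 1] the bound from [int_diff] is [2 pi (2 * 2^-k)],
   that is [2 pi * 4] times [2^-(k + 1)]. *)
pose K : R := 2 * pi * M + 2 * pi * 4.
have K0 : 0 <= K by rewrite addr_ge0// mulr_ge0// pi2_ge0.
have half01 : 0 <= (2 : R)^-1 < 1 by rewrite invr_ge0 ler0n/= invf_lt1// ltr1n.
have fK k : \int[mu]_(t in I0) nrm (f k t) <= K * 2^-1 ^+ k.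
  case: k => [|k].
    rewrite expr0 mulr1; apply: (@le_trans _ _ (2 * pi * M)); last first.
      by rewrite lerDl mulr_ge0// pi2_ge0.
    rewrite -ler_pdivrMl ?pi2_gt0// -Re_cmean_real.
    apply: le_trans (ler_norm _) (le_trans (Re_le_nrm _) _).
    apply: nrm_cmean_le => [|t _].
      have [in' _] := conj (integrable_nrm (measurable_itv _) (fi 0%N)) I.
      by split => //; exact: integrable0.
    by rewrite nrm_real ger0_norm ?nrm_ge0//; exact: HM.
  apply: (@le_trans _ _ (2 * pi * (2 * 2^-1 ^+ k))).
    apply: int_diff; [exact: r01|exact: r01|by rewrite exprn_gt0| |exact: rD].
    apply: le_trans (rD _) _; rewrite lerXn2r ?nnegrE ?exprn_ge0//.
    by rewrite exprS ler_piMl ?exprn_ge0// invf_le1// ler1n.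
  rewrite /K [leRHS]mulrDl -[leLHS]add0r; apply: lerD.
    by rewrite !mulr_ge0 ?exprn_ge0 ?pi_ge0.
  rewrite -[leRHS]mulrA ler_wpM2l ?pi2_ge0// exprS mulrA ler_wpM2r ?exprn_ge0//.
  by rewrite ler_pdivlMr// -natrM.
have gs := cvgn_seriesZ (M := K) (geometric_summable half01).
have [|g] := @ae_cvg_series_L1 R I0 (measurable_itv _) f
    (limn (series (fun k => K * 2^-1 ^+ k))) fi.
  move=> n; apply: le_trans (rsum_partial_le n _ gs).
    by apply: ler_sum => k _; exact: fK.
  by move=> k; rewrite mulr_ge0// exprn_ge0.
set F := fun t => _ => -[mF ig aeF].
have HF : {ae mu, forall t, I0 t -> H (r n) t @[n --> \oo] --> F t}.
  apply: lebesgue_aeS aeF => t tF It; have [cF _] := tF It.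
  have -> : (fun n => H (r n) t) = (fun n => series (f ^~ t) n.+1).
    by apply/funext => n; rewrite fS.
  by rewrite (cvg_shiftS (series (f ^~ t))).
exists F; split.
  have [] := @cint_dct R I0 (measurable_itv _) (fun n => H (r n)) F (fun=> M) => //.
  - by move=> n; apply: cintegrable_meas; exact: H_int.
  - exact: integrable_cst.
  - by apply: aeW => t _ n; exact: HM.
move=> w w1.
have mP : cmeas I0 (fun t => (poisson w (expi t))%:C : C).
  apply: cintegrable_meas; apply: cintegrable_cts => t; exact: poisson_cts.
pose B := (1 - nrm w ^+ 2) / (1 - nrm w) ^+ 2.
have [iFP cFP] : cintegrable I0 (fun t => F t * (poisson w (expi t))%:C) /\
    cint I0 (fun t => H (r n) t * (poisson w (expi t))%:C) @[n --> \oo] -->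
    cint I0 (fun t => F t * (poisson w (expi t))%:C).
  apply: (@cint_dct R I0 (measurable_itv _)
     (fun n t => H (r n) t * (poisson w (expi t))%:C) _ (fun=> M * B)).
  - move=> n; apply: cmeasM mP; apply: cintegrable_meas; exact: H_int.
  - exact: cmeasM.
  - apply: lebesgue_aeS HF => t tF It; apply: cvgM; last exact: cvg_cst.
    exact: tF.
  - exact: integrable_cst.
  - apply: aeW => t _ n; rewrite nrmM; apply: ler_pM; rewrite ?nrm_ge0//.
      exact: HM.
    exact: nrm_poisson.
split; first exact: iFP.
(* [h (r n * w)] is the Poisson integral of [H (r n)]. Its limit is computed here by dominated
   convergence and below by continuity of [h] at [w]. *)
have lim1 : h ((r n)%:C * w) @[n --> \oo] -->
    cmean (fun t => F t * (poisson w (expi t))%:C).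
  have -> : (fun n => h ((r n)%:C * w)) =
      (fun n => cmean (fun t => H (r n) t * (poisson w (expi t))%:C)).
    apply/funext => n; have /andP[r0 rn1] := r01 n.
    have rw1 : nrm ((r n)%:C * w) < 1.
      rewrite nrmM nrm_real gtr0_norm//; apply: le_lt_trans w1.
      by rewrite ler_piMl ?nrm_ge0// ltW.
    rewrite hc// -[RHS](@eq_cmean _ (fun t => pser (a (r n)) (expi t) * (poisson w (expi t))%:C)).
      rewrite (pser_poisson w1 (a_sum (r01 n))).
      by apply: csum_eq => k; rewrite /a exprMn mulrA.
    by move=> t _; rewrite HE.
  by apply: cvgM; [exact: cvg_cst|exact: cFP].
have lim2 : h ((r n)%:C * w) @[n --> \oo] --> h w.
  apply: (@ccts_comp R nat _ _ (fun n => (r n)%:C * w) h w).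
    by apply: derivable_cts; exact: (pser_derivable cM hc).
  rewrite -[X in _ --> X]mul1r; apply: cvgM; last exact: cvg_cst.
  exact: (ccvg_real r1).
by rewrite -(ccvg_lim lim1) -(ccvg_lim lim2).
Qed.

End Function.
End BoundaryFunction.

(** * Fatou's theorem *)

Section Fatou.
Variable R : realType.
Local Notation C := (Cx R).
Local Notation nrm := (@Normc.normc R).
Local Notation mu := (@lebesgue_measure R).
Local Notation I0 := [set` `[(0 : R), 2 * pi]].
Implicit Types (z w : C).

Lemma nrm_expi_sub_sqr (t x : R) :
  nrm (expi t - expi x) ^+ 2 = 2 - 2 * cos (t - x).
Proof.
rewrite sqr_nrm cReB cImB /= cosB.
have := cos2Dsin2 t; have := cos2Dsin2 x.
move: (cos t) (cos x) (sin t) (sin x) => a b c d h1 h2.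
have -> : (a - b) ^+ 2 + (c - d) ^+ 2 =
  (a ^+ 2 + c ^+ 2) + (b ^+ 2 + d ^+ 2) - 2 * (a * b + c * d) by ring.
by rewrite h1 h2; ring.
Qed.

Lemma expi_dist_near (x : R) : exists2 d : R, 0 < d &
  forall t, `|t - x| < d -> `|t - x| <= 2 * nrm (expi t - expi x).
Proof.
have h0 : 0 < (2 : R)^-1 by rewrite invr_gt0.
have [d d0 dP] := expR_expi_expansion h0; exists d => // t td.
have := dP 0 (t - x); rewrite normr0 expR0 add0r => /(_ d0 td).
set y := t - x.
have -> : nrm (expi t - expi x) = nrm (expi y - 1).
  have -> : t = x + y by rewrite /y addrC subrK.
  by rewrite expiD -[X in _ - X]mulr1 -mulrBr nrmM nrm_expi mul1r.
rewrite ?rmorph0 rmorph1 mul1r ?add0r => h.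
have : nrm ('i%C * y%:C : C) <= nrm (expi y - 1) + nrm (expi y - 1 - 'i%C * y%:C).
  have e : 'i%C * y%:C = (expi y - 1) - (expi y - 1 - 'i%C * y%:C) :> C by ring.
  rewrite {1}e; by apply: le_trans (nrmD _ _) _; rewrite nrmN.
rewrite nrmM nrm_i mul1r nrm_real => h2.
by lra.
Qed.

Lemma expi_dist_far (x d : R) : 0 < x < 2 * pi -> 0 < d -> exists2 k : R, 0 < k &
  forall t, 0 <= t <= 2 * pi -> d <= `|t - x| -> k <= nrm (expi t - expi x) ^+ 2.
Proof.
move=> /andP[x0 x2] d0.
(* Besides [e <= |t - x|] this choice ensures [|t - x| <= 2 pi - e], so the angle stays away from
   both zeros of [1 - cos] on [[0, 2 pi]]. *)
pose e := Num.min d (Num.min x (2 * pi - x)).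
have e0 : 0 < e by rewrite !lt_min d0 x0 subr_gt0.
have ed : e <= d by rewrite ge_min lexx.
have ex : e <= x by rewrite !ge_min lexx orbT.
have ex2 : e <= 2 * pi - x by rewrite !ge_min lexx !orbT.
have epi : e <= pi by lra.
have pi0 := pi_gt0 R.
have cos_le (y : R) : e <= y -> y <= pi -> cos y <= cos e.
  move=> ey yp; rewrite leNgt; apply/negP.
  rewrite ltr_cos ?in_itv/= ?yp ?epi ?(ltW e0) ?(le_trans (ltW e0) ey)//.
  by rewrite ltNge ey.
exists (2 - 2 * cos e).
  have : cos e < cos 0.
    by rewrite ltr_cos// in_itv/= ?lexx ?(ltW pi0)// epi ltW.
  by rewrite cos0 => ?; lra.
move=> t /andP[t0 t2] dt; rewrite nrm_expi_sub_sqr -(cos_norm (t - x)).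
have es : e <= `|t - x| by exact: le_trans dt.
have s2 : `|t - x| <= 2 * pi - e by rewrite ler_norml; apply/andP; split; lra.
have [sp|sp] := leP `|t - x| pi.
  by have := cos_le _ es sp => ?; lra.
have -> : cos `|t - x| = cos (2 * pi - `|t - x|).
  by rewrite cosB mulr_natl cos2pi sin2pi mul1r mul0r addr0.
have h : cos (2 * pi - `|t - x|) <= cos e by apply: cos_le; lra.
by lra.
Qed.

Section RadialKernel.
Variables (x r : R).
Hypothesis r01 : 0 < r < 1.
Local Notation w := ((r%:C : C) * expi x).

Let nw : nrm w = r.
Proof. by case/andP: r01 => r0 _; rewrite nrm_circ// ltW. Qed.

Let rad t : 1 - r <= nrm (expi t - w).
Proof.
by have := nrmD (expi t - w) w; rewrite subrK nrm_expi nw lerBlDr.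
Qed.

Let tau0 : 0 < 1 - r. Proof. by case/andP: r01 => _; rewrite subr_gt0. Qed.

Let num_le : 1 - nrm w ^+ 2 <= 2 * (1 - r).
Proof. by rewrite nw; have := sqr_ge0 (1 - r); rewrite !expr2; lra. Qed.

Lemma radial_poisson_le t : poisson w (expi t) <= 2 / (1 - r).
Proof.
rewrite /poisson ler_pdivrMr; last first.
  by rewrite exprn_gt0//; exact: lt_le_trans tau0 (rad t).
apply: le_trans num_le _; rewrite -mulrA ler_wpM2l//.
rewrite ler_pdivlMl// -expr2 lerXn2r ?nnegrE ?nrm_ge0//.
exact: ltW.
Qed.

(** [|w - expi x| = 1 - r] is at most [|expi t - w|], so [|expi t - expi x|] is at most twice the
    distance in the denominator of the kernel. The numerator is at most [2 (1 - r)]. *)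
Lemma radial_poisson_dist t :
  poisson w (expi t) * nrm (expi t - expi x) ^+ 2 <= 8 * (1 - r).
Proof.
have n0 : 0 < nrm (expi t - w) := lt_le_trans tau0 (rad t).
rewrite /poisson mulrAC ler_pdivrMr ?exprn_gt0//.
have le2 : nrm (expi t - expi x) <= 2 * nrm (expi t - w).
  have -> : expi t - expi x = (expi t - w) + (w - expi x) by ring.
  apply: le_trans (nrmD _ _) _; rewrite mulr_natl mulr2n lerD2l.
  have -> : w - expi x = - ((1 - r)%:C * expi x).
    by rewrite rmorphB rmorph1; ring.
  by rewrite nrmN nrmM nrm_expi nrm_real mulr1 gtr0_norm.
have -> : 8 * (1 - r) * nrm (expi t - w) ^+ 2 =
    2 * (1 - r) * (2 * nrm (expi t - w)) ^+ 2 by ring.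
apply: ler_pM => //; last by rewrite lerXn2r ?nnegrE ?nrm_ge0// mulr_ge0// nrm_ge0.
  by rewrite nw subr_ge0 exprn_ile1//; case/andP: r01 => /ltW ? /ltW.
exact: sqr_ge0.
Qed.

Lemma radial_poisson_near t : `|t - x| <= 2 * nrm (expi t - expi x) ->
  poisson w (expi t) * `|t - x| ^+ 2 <= 32 * (1 - r).
Proof.
move=> h; have -> : 32 * (1 - r) = 4 * (8 * (1 - r)) by ring.
apply: (@le_trans _ _ (4 * (poisson w (expi t) * nrm (expi t - expi x) ^+ 2))).
  rewrite [leRHS]mulrCA ler_wpM2l//; first by apply: poisson_ge0; rewrite nw; case/andP: r01.
  have -> : 4 * nrm (expi t - expi x) ^+ 2 = (2 * nrm (expi t - expi x)) ^+ 2 by ring.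
  by rewrite lerXn2r ?nnegrE// mulr_ge0// nrm_ge0.
by rewrite ler_wpM2l// radial_poisson_dist.
Qed.

End RadialKernel.
Let sum_iotaS (f : nat -> R) n :
  \sum_(j <- iota 0 n.+1) f j = \sum_(j <- iota 0 n) f j + f n.
Proof. by rewrite -[in LHS]addn1 iotaD big_cat big_seq1 add0n. Qed.

Section LebesguePoint.
Variables (u : R -> R) (x : R).
Hypothesis iu : mu.-integrable I0 (EFin \o u).
Hypothesis x02 : 0 < x < 2 * pi.
Hypothesis ux : lebesgue_pt (u \_ I0) x.

Let v t : R := `|u t - u x|.

Let v0 t : 0 <= v t. Proof. exact: normr_ge0. Qed.

Let mu_ : measurable_fun I0 u.
Proof. by case/integrableP : iu => /measurable_EFinP. Qed.

Let mv : measurable_fun I0 v.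
Proof.
by apply: measurableT_comp => //; exact: measurable_funB.
Qed.

Let iv : mu.-integrable I0 (EFin \o v).
Proof.
apply: (@le_integrable_real _ _ _ _ (fun t => `|u t| + `|u x|)) => //.
  have -> : EFin \o (fun t => `|u t| + `|u x|) =
    (abse \o (EFin \o u)) \+ (EFin \o (fun=> `|u x|)) by apply/funext.
  apply: integrableD => //; first exact: integrable_abse.
  exact: integrable_cst.
by move=> t _; rewrite /v normr_id ler_normB.
Qed.

Let ball_I0 (d : R) : d <= Num.min x (2 * pi - x) -> ball x d `<=` I0.
Proof.
rewrite le_min => /andP[dx dx2] t; rewrite /ball /= in_itv /= => h.
move: h; rewrite ltr_distlC => /andP[h1 h2]; apply/andP; split; lra.
Qed.

(** The Lebesgue point property concerns the extension of [u] by 0; the balls are taken so small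
    that they lie in [I0], where the extension equals [u]. *)
Let small_mean (e : R) : 0 < e -> exists2 d : R, 0 < d & forall s, 0 < s -> s <= d ->
  (\int[mu]_(t in ball x s) (v t)%:E <= (e * (2 * s))%:E)%E.
Proof.
move=> e0.
have m0 : 0 < Num.min x (2 * pi - x).
  by case/andP: x02 => ? ?; rewrite lt_min subr_gt0; apply/andP.
have [d d0 dP] : exists2 d : R, 0 < d & forall s, 0 < s -> s < d ->
    (davg (u \_ I0) x s <= e%:E)%E.
  have /fine_cvgP[fin /cvgrPdist_lt/(_ _ e0) lt] := ux.
  have : nbhs (0 : R) [set s | 0 < s -> davg (u \_ I0) x s \is a fin_num /\
      `|0 - fine (davg (u \_ I0) x s)| < e] by exact: filterI fin lt.
  move=> /nbhs_ballP[d /= d0 dP].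
  exists d => // s s0 sd; have := dP s.
  have s0d : `|0 - s| < d by rewrite sub0r normrN gtr0_norm.
  move=> /(_ s0d s0)[fs].
  by rewrite sub0r normrN => /(le_lt_trans (ler_norm _))/ltW; rewrite -lee_fin fineK.
exists (Num.min (d / 2) (Num.min x (2 * pi - x))).
  by rewrite lt_min m0 divr_gt0.
move=> s s0; rewrite le_min => /andP[sd sm].
have sd' : s < d.
  by apply: le_lt_trans sd _; rewrite ltr_pdivrMr// ltr_pMr// ltr1n.
have := dP s s0 sd'; rewrite /davg /iavg lebesgue_measure_ball ?(ltW s0)//.
have s2 : 0 < s *+ 2 by rewrite mulrn_wgt0.
rewrite inver gt_eqF// lee_pdivrMl//.
have -> : (e * (2 * s))%:E = ((s *+ 2)%:E * e%:E)%E.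
  by rewrite -EFinM; congr EFin; rewrite -[s *+ 2]mulr_natl mulrC.
apply: le_trans; rewrite le_eqVlt; apply/orP; left; apply/eqP.
apply: eq_integral => t /set_mem tB.
have It : I0 t by exact: ball_I0 tB.
have Ix : I0 x by rewrite /= in_itv/=; case/andP: x02 => /ltW -> /ltW ->.
by rewrite /v /= !patchE !mem_set.
Qed.

Let vB (s : R) t : R := (v \_ (ball x s)) t.

Let vB0 s t : 0 <= vB s t.
Proof. by rewrite /vB patchE; case: ifP. Qed.

Let mvB s : measurable_fun I0 (vB s).
Proof.
apply/measurable_restrict => //.
  exact: measurable_ball.
exact: measurable_funS mv.
Qed.

Let int_vB s : s <= Num.min x (2 * pi - x) ->
  (\int[mu]_(t in I0) (vB s t)%:E = \int[mu]_(t in ball x s) (v t)%:E)%E.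
Proof.
move=> sm; have -> : ball x s = I0 `&` ball x s.
  by apply/esym/setIidPr; exact: ball_I0.
by rewrite integral_mkcondr restrict_EFin.
Qed.

(** With [tau = 1 - r], a bound of the kernel on the ring [2 ^ (j - 1) tau <= |t - x| < 2 ^ j tau],
    where [32 tau / |t - x| ^ 2 <= 128 / (4 ^ j tau)]. At [j = 0] it exceeds the global bound
    [2 / tau]. *)
Let b (tau : R) (j : nat) : R := 128 / (4 ^+ j * tau).

Let b0 tau j : 0 < tau -> 0 <= b tau j.
Proof. by move=> t0; rewrite divr_ge0// mulr_ge0 ?exprn_ge0// ltW. Qed.

(** The point [t] is charged to the smallest dyadic ball that contains it, and the other terms are
    nonnegative. Balls replace rings because a Lebesgue point controls integrals over balls. *)
Let near_bound (tau d : R) n t : 0 < tau < 1 -> 2 ^+ n * tau <= d ->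
  (forall t, `|t - x| < d -> `|t - x| <= 2 * nrm (expi t - expi x)) ->
  `|t - x| < 2 ^+ n * tau ->
  poisson ((1 - tau)%:C * expi x) (expi t) * v t <=
    \sum_(j <- iota 0 n.+1) b tau j * vB (2 ^+ j * tau) t.
Proof.
move=> /andP[tau0 tau1] + dP.
have r01 : 0 < 1 - tau < 1 by rewrite subr_gt0 tau1 gtrBl.
have ballE (s : R) : `|t - x| < s -> vB s t = v t.
  by move=> ts; rewrite /vB patchE mem_set// /ball /= distrC.
have sum0 n' : 0 <= \sum_(j <- iota 0 n') b tau j * vB (2 ^+ j * tau) t.
  by apply: sumr_ge0 => j _; rewrite mulr_ge0// b0.
elim: n => [|n IH] nd tn.
  rewrite sum_iotaS big_nil add0r ballE// ler_wpM2r//.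
  apply: le_trans (radial_poisson_le x r01 t) _.
  rewrite /b expr0 mul1r (_ : 1 - (1 - tau) = tau); last by ring.
  by rewrite ler_pM2r ?invr_gt0// ler_nat.
have [tn'|tn'] := ltP `|t - x| (2 ^+ n * tau).
  rewrite sum_iotaS; apply: le_trans (IH _ tn') _.
    by apply: le_trans nd; rewrite exprS ler_pM2r// ler_peMl ?exprn_ge0// ler1n.
  by rewrite lerDl mulr_ge0// b0.
rewrite sum_iotaS -[leLHS]add0r; apply: lerD; first exact: sum0.
rewrite ballE// ler_wpM2r//.
have nz : 0 < `|t - x| by apply: lt_le_trans tn'; rewrite mulr_gt0// exprn_gt0.
have := radial_poisson_near r01 (dP t (lt_le_trans tn nd)).
rewrite (_ : 1 - (1 - tau) = tau); last by ring.
rewrite -ler_pdivlMr ?exprn_gt0// => /le_trans; apply.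
have -> : b tau n.+1 = 32 * tau / (2 ^+ n * tau) ^+ 2.
  rewrite /b exprS (_ : (4 : R) ^+ n = (2 ^+ n) ^+ 2); last first.
    by rewrite -exprM mulnC exprM; congr (_ ^+ _); ring.
  by field; rewrite gt_eqF//= expf_neq0.
rewrite ler_pM2l ?mulr_gt0// lef_pV2 ?posrE ?exprn_gt0 ?mulr_gt0 ?exprn_gt0//.
by rewrite lerXn2r ?nnegrE ?normr_ge0// mulr_ge0 ?exprn_ge0// ltW.
Qed.

Let scale (tau d : R) : 0 < tau -> tau <= d ->
  exists n, 2 ^+ n * tau <= d /\ d / 2 < 2 ^+ n * tau.
Proof.
move=> tau0 taud.
have ex : exists n, d < 2 ^+ n.+1 * tau.
  exists (Num.bound (d / tau)).
  rewrite -ltr_pdivrMr//; apply: (@lt_le_trans _ _ (Num.bound (d / tau))%:R).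
    by apply: archi_boundP; rewrite divr_ge0 ?(ltW tau0) ?(le_trans (ltW tau0) taud).
  rewrite -natrX ler_nat ltnW// (ltn_trans (ltn_expl _ (isT : 1 < 2)%N))//.
  by rewrite ltn_exp2l.
case: (ex_minnP ex) => n nP nmin; exists n; split.
  case: n nP nmin => [|n] nP nmin; first by rewrite expr0 mul1r.
  by rewrite leNgt; apply/negP => /nmin; rewrite ltnn.
by rewrite ltr_pdivrMr// mulrAC -exprSr.
Qed.

Lemma poisson_lebesgue_pt (e : R) : 0 < e -> exists2 s : R, 0 < s &
  forall r, 0 < r -> 1 - s < r -> r < 1 ->
  (\int[mu]_(t in I0) (poisson (r%:C * expi x) (expi t) * v t)%:E <= e%:E)%E.
Proof.
(* The ball of index [j] contributes [128 / (4 ^ j tau)] times [e1 * 2 * 2 ^ j tau], that is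
   [256 e1 / 2 ^ j]. These add up to at most [512 e1 = e / 2]. *)
move=> e0; pose e1 := e / (32 * 32).
have e10 : 0 < e1 by rewrite divr_gt0// mulr_gt0.
have [d1 d10 d1P] := small_mean e10.
have [d2 d20 d2P] := expi_dist_near x.
have m0 : 0 < Num.min x (2 * pi - x).
  by case/andP: x02 => ? ?; rewrite lt_min subr_gt0; apply/andP.
have [d [d0 dd1 dd2 dm]] : exists d : R, [/\ 0 < d, d <= d1, d <= d2 &
    d <= Num.min x (2 * pi - x)].
  exists (Num.min (Num.min d1 d2) (Num.min x (2 * pi - x))); split.
  - by rewrite lt_min m0 lt_min d10 d20.
  - by rewrite !ge_min lexx.
  - by rewrite !ge_min lexx !orbT.
  - by rewrite ge_min lexx orbT.
have dh : 0 < d / 2 by rewrite divr_gt0.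
have [k k0 kP] := expi_dist_far x02 dh.
have Vfin : (\int[mu]_(t in I0) (v t)%:E)%E \is a fin_num by exact: integrable_fin_num.
pose V := \int[mu]_(t in I0) v t.
have V0 : 0 <= V by apply: Rintegral_ge0.
have VE : (\int[mu]_(t in I0) (v t)%:E = V%:E)%E by rewrite /V /Rintegral fineK.
(* The last entry is for the points beyond the dyadic balls: the kernel is at most [8 tau / k]
   there, and its contribution [8 tau V / k] at most [e / 2]. [V + 1] is positive even if
   [V = 0]. *)
pose s := Num.min (Num.min d 1) (e / 2 / (8 / k * (V + 1))).
have V1 : 0 < V + 1 by rewrite ltr_wpDl.
have C0 : 0 < 8 / k * (V + 1) by rewrite mulr_gt0// divr_gt0.
exists s; first by rewrite !lt_min d0 ltr01 !divr_gt0.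
move=> r r0 rs r1; pose tau := 1 - r.
have tau0 : 0 < tau by rewrite subr_gt0.
have taus : tau < s by rewrite /tau ltrBlDr addrC -ltrBlDr.
have {}rE : r = 1 - tau by rewrite /tau; ring.
have [taud [tau1 taue]] : tau <= d /\ tau < 1 /\ tau < e / 2 / (8 / k * (V + 1)).
  by move: taus; rewrite !lt_min => /andP[/andP[/ltW ? ?] ?].
have tau01 : 0 < tau < 1 by rewrite tau0.
have r01 : 0 < 1 - tau < 1 by rewrite -rE r0.
have [n [nd dn]] := scale tau0 taud.
rewrite rE; set P := poisson _.
have P0 t : 0 <= P t.
  by apply: poisson_ge0; rewrite nrm_circ; case/andP: r01 => // /ltW.
have mP : measurable_fun I0 (fun t => P (expi t)).
  have := @cts_cintegrable R 0 (2 * pi) (fun t => (P (expi t))%:C).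
  case=> [t _|]; last by move=> /integrableP[/measurable_EFinP].
  by apply: poisson_cts; rewrite nrm_circ; case/andP: r01 => // /ltW.
pose S t := \sum_(j <- iota 0 n.+1) b tau j * vB (2 ^+ j * tau) t.
have S0 t : 0 <= S t by apply: sumr_ge0 => j _; rewrite mulr_ge0// b0.
have mS : measurable_fun I0 S.
  by apply: measurable_sum => j; apply: measurable_funM.
have kt0 : 0 <= 8 / k * tau by rewrite mulr_ge0 ?divr_ge0// ltW.
have bound t : I0 t -> P (expi t) * v t <= S t + 8 / k * tau * v t.
  move=> It; have [tn|tn] := ltP `|t - x| (2 ^+ n * tau).
    apply: le_trans (near_bound tau01 nd _ tn) _.
      by move=> t' ht; apply: d2P; exact: lt_le_trans dd2.
    by rewrite lerDl mulr_ge0.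
  rewrite -[leLHS]add0r; apply: lerD => //; rewrite ler_wpM2r//.
  have It' : 0 <= t <= 2 * pi by move: It; rewrite /= in_itv.
  have kt := kP t It' (ltW (lt_le_trans dn tn)).
  have := radial_poisson_dist x r01 t; rewrite -/P (_ : 1 - (1 - tau) = tau); last by ring.
  move=> h; rewrite mulrAC ler_pdivlMr//; apply: le_trans h.
  by rewrite ler_wpM2l.
apply: (@le_trans _ _ (\int[mu]_(t in I0) ((S t)%:E + (8 / k * tau)%:E * (v t)%:E))%E).
  apply: ge0_le_integral => //.
  - by move=> t _; rewrite lee_fin mulr_ge0.
  - by apply/measurable_EFinP; exact: measurable_funM.
  - apply: emeasurable_funD; first exact/measurable_EFinP.
    by apply: measurable_funeM; exact/measurable_EFinP.
rewrite ge0_integralD//; first last.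
- by apply: measurable_funeM; exact/measurable_EFinP.
- by move=> t _; rewrite mule_ge0// lee_fin.
- exact/measurable_EFinP.
- by move=> t _; rewrite lee_fin.
rewrite ge0_integralZl_EFin//; [|by move=> t _; rewrite lee_fin|exact/measurable_EFinP].
rewrite VE -EFinM.
have SE : (\int[mu]_(t in I0) (S t)%:E <= (e / 2)%:E)%E.
  have -> : (\int[mu]_(t in I0) (S t)%:E =
      \int[mu]_(t in I0) (\sum_(j <- iota 0 n.+1) (b tau j * vB (2 ^+ j * tau) t)%:E))%E.
    by apply: eq_integral => t _; rewrite sumEFin.
  rewrite ge0_integral_sum//; first last.
  - by move=> j t _; rewrite lee_fin mulr_ge0// b0.
  - move=> j; apply/measurable_EFinP.
    by apply: measurable_funM; [exact: measurable_cst|exact: mvB].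
  have term j : (j <= n)%N -> (\int[mu]_(t in I0) (b tau j * vB (2 ^+ j * tau) t)%:E <=
      (128 * (2 * e1) * 2^-1 ^+ j)%:E)%E.
    move=> jn; have jd : 2 ^+ j * tau <= d.
      by apply: le_trans nd; rewrite ler_pM2r// ler_weXn2l// ler1n.
    under eq_integral do rewrite EFinM.
    have mvj : measurable_fun I0 (EFin \o vB (2 ^+ j * tau)).
      by apply/measurable_EFinP; exact: mvB.
    rewrite ge0_integralZl_EFin//; first last.
    - exact: b0.
    - by move=> t _; rewrite lee_fin; exact: vB0.
    rewrite int_vB; last exact: le_trans dm.
    have s0 : 0 < 2 ^+ j * tau by rewrite mulr_gt0// exprn_gt0.
    apply: (@le_trans _ _ ((b tau j)%:E * (e1 * (2 * (2 ^+ j * tau)))%:E)%E).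
      apply: lee_wpmul2l; first by rewrite lee_fin b0.
      by apply: d1P => //; exact: le_trans dd1.
    rewrite -EFinM lee_fin /b (_ : (4 : R) ^+ j = (2 ^+ j) ^+ 2); last first.
      by rewrite -exprM mulnC exprM; congr (_ ^+ _); ring.
    rewrite exprVn le_eqVlt; apply/orP; left; apply/eqP.
    have p0 : (2 : R) ^+ j != 0 by rewrite expf_neq0.
    have t0 : tau != 0 by rewrite gt_eqF.
    move: (2 ^+ j) p0 => p p0.
    by field; rewrite ?p0 ?t0.
  apply: (@le_trans _ _ (\sum_(j <- iota 0 n.+1) (128 * (2 * e1) * 2^-1 ^+ j)%:E)%E).
    rewrite big_seq_cond [leRHS]big_seq_cond; apply: lee_sum => j.
    by rewrite mem_iota andbT add0n ltnS => jn; exact: term.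
  rewrite sumEFin lee_fin -mulr_sumr.
  have g2 : \sum_(j <- iota 0 n.+1) (2 : R)^-1 ^+ j <= 2.
    have -> : \sum_(j <- iota 0 n.+1) (2 : R)^-1 ^+ j = 2 - 2 * 2^-1 ^+ n.+1.
      elim: n {nd dn S S0 mS bound term} => [|n IH].
        by rewrite sum_iotaS big_nil add0r expr0 expr1; field.
      rewrite sum_iotaS IH.
      by rewrite [in RHS]exprS; field.
    by rewrite gerBl mulr_ge0// exprn_ge0.
  apply: (@le_trans _ _ (128 * (2 * e1) * 2)).
    by rewrite ler_wpM2l// mulr_ge0// mulr_ge0// ltW.
  have -> : 128 * (2 * e1) * 2 = e / 2 by rewrite /e1; field.
  exact: lexx.
apply: (@le_trans _ _ ((e / 2)%:E + (e / 2)%:E)%E); last first.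
  by rewrite -EFinD lee_fin; lra.
apply: leeD => //; rewrite lee_fin.
have : tau * (8 / k * (V + 1)) <= e / 2 by rewrite -ler_pdivlMr// ltW.
apply: le_trans.
have -> : 8 / k * tau * V = tau * (8 / k * V) by ring.
rewrite ler_wpM2l ?(ltW tau0)//.
by rewrite ler_pM2l ?divr_gt0// lerDl.
Qed.

End LebesguePoint.
End Fatou.

(** * Integrals of functions that agree almost everywhere *)

Section IntegralAE.
Context d (T : measurableType d) (R : realType) (mu : {measure set T -> \bar R}).
Implicit Types (D : set T) (f g : T -> \bar R).

Import HBNNSimple.

(** No measurability is assumed: the integral is a supremum over simple functions below [f], and
    such a function, set to 0 on the null set [N], is below [g] with the same integral. This matters
    for [boundary_value], which is identified with a measurable function only almost everywhere. *)
Let ge0_integral_ae_le f g : (forall x, 0 <= f x)%E -> (forall x, 0 <= g x)%E ->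
  {ae mu, forall x, f x = g x} -> (\int[mu]_x f x <= \int[mu]_x g x)%E.
Proof.
move=> f0 g0 [N [mN N0 fgN]].
rewrite (ge0_integralTE mu f0) (ge0_integralTE mu g0).
apply: ge_ereal_sup => _ [h /= hf <-].
pose h' := proj_nnsfun h (measurableC mN).
apply: le_ereal_sup_tmp; exists (sintegral mu h'); last first.
  rewrite -!integralT_nnsfun le_eqVlt; apply/orP; left; apply/eqP.
  apply: ae_eq_integral => //; [exact/measurable_EFinP|exact/measurable_EFinP|].
  exists N; split => // x /= hx; apply: contrapT => Nx; apply: hx => _.
  by rewrite mindicE mem_set// mulr1.
exists h' => // x; rewrite /= mindicE.
have [Nx|Nx] := pselect (N x).
  by rewrite memNset ?mulr0//; exact.
rewrite mem_set// mulr1; have <- : f x = g x; last exact: hf.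
by apply: contrapT => fgx; apply: Nx; exact: fgN.
Qed.

Lemma integral_ae_eq D f g : {ae mu, forall x, D x -> f x = g x} ->
  (\int[mu]_(x in D) f x = \int[mu]_(x in D) g x)%E.
Proof.
move=> fg; rewrite integralE [RHS]integralE; congr (_ - _)%E;
  rewrite integral_mkcond [RHS]integral_mkcond; apply/eqP; rewrite eq_le;
  apply/andP; split; apply: ge0_integral_ae_le;
  do ?[by move=> x; apply: erestrict_ge0 => *];
  case: fg => N [mN N0 fgN]; exists N; split => // x /= hx; apply: fgN => /= e;
  by apply: hx; rewrite !patchE; case: ifPn => // /set_mem Dx;
    rewrite ?funeposE ?funenegE e.
Qed.

End IntegralAE.

(** * Radial limits of Poisson integrals and of bounded analytic functions *)

Section FatouTheorem.
Variable R : realType.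
Local Notation C := (Cx R).
Local Notation nrm := (@Normc.normc R).
Local Notation Re := (@complex.Re R).
Local Notation Im := (@complex.Im R).
Local Notation mu := (@lebesgue_measure R).
Local Notation I0 := [set` `[(0 : R), 2 * pi]].
Implicit Types (z w : C).

Lemma cint_ae (D : set R) (u v : R -> C) :
  {ae mu, forall t, D t -> u t = v t} -> cint D u = cint D v.
Proof.
move=> uv; rewrite /cint /Rintegral; congr (fine _ +i* fine _);
  apply: integral_ae_eq; apply: lebesgue_aeS uv => t uv Dt; by rewrite uv.
Qed.

Lemma cmean_ae (u v : R -> C) :
  {ae mu, forall t, I0 t -> u t = v t} -> cmean u = cmean v.
Proof. by move=> uv; rewrite /cmean (cint_ae uv). Qed.

Lemma near_left1 (P : R -> Prop) (s : R) : 0 < s ->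
  (forall r, 0 < r -> 1 - s < r -> r < 1 -> P r) -> \forall r \near (1 : R)^'-, P r.
Proof.
move=> s0 sP; near=> r; apply: sP; near: r.
- by apply: nbhs_left_gt; exact: ltr01.
- by apply: nbhs_left_gt; rewrite ltrBlDr ltrDl.
- exact: nbhs_left_lt.
Unshelve. all: by end_near. Qed.

Lemma cintegrable_poisson (F : R -> C) w : nrm w < 1 -> cintegrable I0 F ->
  cintegrable I0 (fun t => F t * (poisson w (expi t))%:C).
Proof.
move=> w1 iF; pose B := (1 - nrm w ^+ 2) / (1 - nrm w) ^+ 2.
have mP : cmeas I0 (fun t => (poisson w (expi t))%:C : C).
  apply: cintegrable_meas; apply: cintegrable_cts => t; exact: poisson_cts.
apply: (cintegrable_le (measurable_itv _) (g := fun t => nrm (B%:C * F t))).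
- exact: cmeasM (cintegrable_meas iF) mP.
- by apply: integrable_nrm => //; exact: cintegrableZ.
- move=> t _; rewrite !nrmM mulrC ler_wpM2r ?nrm_ge0//.
  apply: le_trans (nrm_poisson w1 t) _; rewrite nrm_real; exact: ler_norm.
Qed.

Lemma poisson_radial_limit (F : R -> C) (x : R) : cintegrable I0 F ->
  0 < x < 2 * pi -> lebesgue_pt ((Re \o F) \_ I0) x ->
  lebesgue_pt ((Im \o F) \_ I0) x ->
  cmean (fun t => F t * (poisson (r%:C * expi x) (expi t))%:C) @[r --> 1^'-] --> F x.
Proof.
move=> iF x02 lr li; apply/ccvg_lt => e e0.
(* The real and the imaginary part each cost [e1], and the mean divides by [2 pi], so the total is
   [e / 2]. *)
pose e1 := e * pi / 2.
have e10 : 0 < e1 by rewrite divr_gt0// mulr_gt0// pi_gt0.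
have [sr sr0 srP] := poisson_lebesgue_pt iF.1 x02 lr e10.
have [si si0 siP] := poisson_lebesgue_pt iF.2 x02 li e10.
apply: (@near_left1 _ (Num.min sr si)) => [|r r0 rs r1]; first by rewrite lt_min sr0.
have {srP} := srP r r0 _ r1; have {siP} := siP r r0 _ r1.
have {}rs : 1 - sr < r /\ 1 - si < r.
  by split; apply: le_lt_trans rs; rewrite lerD2l lerN2 ge_min lexx ?orbT.
move=> /(_ rs.2) + /(_ rs.1).
set w := _ * expi x; have w1 : nrm w < 1 by rewrite nrm_circ// ltW.
set P := fun t => poisson w (expi t).
have P0 t : 0 <= P t by exact: poisson_ge0.
have mP : measurable_fun I0 P.
  by have [] := cintegrable_meas (cintegrable_cts (poisson_cts w1)).
set vr := fun t => `|(Re \o F) t - (Re \o F) x|.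
set vi := fun t => `|(Im \o F) t - (Im \o F) x|.
have [mr mi] := cintegrable_meas iF.
have mvr : measurable_fun I0 vr.
  by apply: measurableT_comp => //; exact: measurable_funB.
have mvi : measurable_fun I0 vi.
  by apply: measurableT_comp => //; exact: measurable_funB.
move=> hi hr.
have iFx : cintegrable I0 (fun t => F t - F x).
  by apply: cintegrableB => //; apply: cintegrable_cts => t; exact: cvg_cst.
have iu := cintegrable_poisson w1 iFx.
(* The kernel has mean 1, by [cmean_poisson] with exponent 0, so the constant [F x] can be moved
   under the mean. *)
have -> : cmean (fun t => F t * (P t)%:C) - F x = cmean (fun t => (F t - F x) * (P t)%:C).
  rewrite -[X in _ - X]mulr1 -[X in _ - _ * X](expr0 w) -(cmean_poisson w1) -cmeanZ; last first.
    apply: (@eq_cintegrable R I0 (measurable_itv _) (fun t => 1 * (P t)%:C)) => [t _|].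
      by rewrite expr0.
    by apply: cintegrable_poisson => //; apply: cintegrable_cts => t; exact: cvg_cst.
  rewrite -cmeanB.
  - by apply: eq_cmean => t _; rewrite expr0 mul1r mulrBl.
  - exact: cintegrable_poisson.
  - apply: (@eq_cintegrable R I0 (measurable_itv _) (fun t => F x * (P t)%:C)) => [t _|].
      by rewrite expr0 mul1r.
    by apply: cintegrable_poisson => //; apply: cintegrable_cts => t; exact: cvg_cst.
rewrite /cmean nrmM nrm_real gtr0_norm ?invr_gt0 ?pi2_gt0// ltr_pdivrMl ?pi2_gt0//.
have pi0 := pi_gt0 R.
apply: (@le_lt_trans _ _ (e1 + e1)); last by rewrite /e1; nra.
apply: le_trans (nrm_cint_le (measurable_itv _) iu (integrable_nrm (measurable_itv _) iu)
  (fun t _ => lexx _)) _.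
have inu := integrable_nrm (measurable_itv _) iu.
rewrite -lee_fin /Rintegral fineK; last exact: integrable_fin_num.
apply: (@le_trans _ _ (\int[mu]_(t in I0) ((P t * vr t)%:E + (P t * vi t)%:E))%E).
  apply: ge0_le_integral => //.
  - by move=> t _; rewrite lee_fin nrm_ge0.
  - by case/integrableP: inu.
  - by apply: emeasurable_funD; apply/measurable_EFinP; exact: measurable_funM.
  - move=> t _; rewrite -EFinD lee_fin -mulrDr nrmM mulrC nrm_real ger0_norm; last exact: P0.
    apply: ler_wpM2l; first exact: P0.
    apply: le_trans (nrm_le_ReIm _) _.
    by rewrite cReB cImB.
rewrite EFinD ge0_integralD//.
- exact: leeD.
- by move=> t _; rewrite lee_fin; exact: mulr_ge0 (P0 t) (normr_ge0 _).
- by apply/measurable_EFinP; exact: measurable_funM.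
- by move=> t _; rewrite lee_fin; exact: mulr_ge0 (P0 t) (normr_ge0 _).
- by apply/measurable_EFinP; exact: measurable_funM.
Qed.

Lemma ae_interior : {ae mu, forall t : R, I0 t -> 0 < t < 2 * pi}.
Proof.
exists [set 0; 2 * pi]; split.
- by apply: measurableU; exact: measurable_set1.
- by rewrite measureU0//; exact: lebesgue_measure_set1.
- move=> t /= h; apply: contrapT => /not_orP[/eqP t0 /eqP t2]; apply: h.
  by rewrite in_itv/= => /andP[h1 h2]; rewrite !lt_neqAle h1 h2 eq_sym t0 t2.
Qed.

Lemma fatou_theorem (F : R -> C) : cintegrable I0 F ->
  {ae mu, forall x, I0 x ->
    cmean (fun t => F t * (poisson (r%:C * expi x) (expi t))%:C) @[r --> 1^'-] --> F x}.
Proof.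
move=> iF.
have lr := lebesgue_differentiation (integrable_locally_restrict (measurable_itv _) iF.1).
have li := lebesgue_differentiation (integrable_locally_restrict (measurable_itv _) iF.2).
apply: lebesgue_aeS (lebesgue_aeI ae_interior (lebesgue_aeI lr li)) => x [x02 [l1 l2]] Ix.
by apply: poisson_radial_limit => //; exact: x02.
Qed.

Lemma HinfP (h : Hinf R) : [/\ forall z, nrm z < 1 -> derivable h z 1,
   exists M : R, forall z, nrm z < 1 -> nrm (h z) <= M &
   forall z, ~ disk z -> h z = 0].
Proof.
case: h => h /= /asboolP[dh [M hM] h0]; split => //.
  by move=> z z1; apply: dh; rewrite diskE.
by exists (Re M) => z z1; apply: nrm_le_bound; apply: hM; rewrite diskE.
Qed.

Lemma boundary_value_lim (h : Hinf R) z (l : C) :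
  h (r%:C * z) @[r --> 1^'-] --> l -> boundary_value h z = l.
Proof. exact: ccvg_lim. Qed.

(** [boundary_function] obtains [F] along a special sequence of radii. As [h] is the Poisson
    integral of [F], Fatou's theorem then identifies [F] with the full radial limit almost
    everywhere. *)
Lemma Hinf_boundary (h : Hinf R) : exists F : R -> C, [/\ cintegrable I0 F,
   {ae mu, forall t, I0 t -> h (r%:C * expi t) @[r --> 1^'-] --> F t},
   {ae mu, forall t, I0 t -> boundary_value h (expi t) = F t} &
   forall w, nrm w < 1 -> h w = cmean (fun t => F t * (poisson w (expi t))%:C)].
Proof.
have [dh [M hM] _] := HinfP h.
have [c [cM hc _]] := taylor_expansion dh hM.
have [F [iF FP]] := boundary_function hM cM hc.
have lim : {ae mu, forall t, I0 t -> h (r%:C * expi t) @[r --> 1^'-] --> F t}.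
  apply: lebesgue_aeS (fatou_theorem iF) => t lt It.
  apply: cvg_trans (lt It); apply: near_eq_cvg.
  apply: (near_left1 ltr01) => r r0 _ r1.
  by apply/esym; apply: (FP _ _).2; rewrite nrm_circ// ltW.
exists F; split => //.
- apply: lebesgue_aeS lim => t lt It; apply: boundary_value_lim; exact: lt.
- by move=> w /FP[].
Qed.

End FatouTheorem.

(** * Weak-star topologies *)

Lemma closed_eq_fun (R : realType) (X : topologicalType) (f g : X -> Cx R) :
  continuous f -> continuous g -> closed [set v | f v = g v].
Proof.
move=> cf cg; rewrite (_ : [set v | _] = (fun v => f v - g v) @^-1` [set 0]).
  have c : continuous (fun v => f v - g v).
    by move=> v; apply: cvgB; [exact: cf|exact: cg].
  apply: ((continuous_closedP _).1 c).
  by apply: accessible_closed_set1; apply: hausdorff_accessible; exact: norm_hausdorff.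
apply/seteqP; split => v /=; first by move=> ->; rewrite subrr.
by move/eqP; rewrite subr_eq0 => /eqP.
Qed.

Section WeakStar.
Variables (R : realType) (V : choiceType) (P : Type) (pairing : P -> V -> Cx R).
Local Notation C := (Cx R).

Lemma weak_star_pairing_continuous p :
  continuous (pairing p : weak_star pairing -> C).
Proof.
move=> v.
pose F : weak_star pairing -> prod_topology (fun _ : P => C) := fun v p => pairing p v.
have cF : continuous F by exact: initial_continuous.
exact: (cvg_comp _ _ (cF v) (@proj_continuous {classic P} (fun _ => C) p (F v))).
Qed.

Lemma continuous_weak_star (X : topologicalType) (f : X -> weak_star pairing) :
  (forall p, continuous (fun x => pairing p (f x))) -> continuous f.
Proof.
move=> cf; apply: continuous_comp_initial => x; apply/cvg_sup => p.
move=> U [W /= [[Z oZ <-]]] /= Zx /filterS; apply; apply: (cf p x).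
exact: open_nbhs_nbhs.
Qed.

End WeakStar.

(** * Weighted sums of point evaluations as weak-star continuous functionals *)

Section PointEvaluations.
Variable R : realType.
Local Notation C := (Cx R).
Local Notation nrm := (@Normc.normc R).
Local Notation Re := (@complex.Re R).
Local Notation mu := (@lebesgue_measure R).
Local Notation I0 := [set` `[(0 : R), 2 * pi]].
Implicit Types (z w : C).

Lemma L1circle_cintegrable (f : L1circle R) : cintegrable I0 (fun t => sval f (expi t)).
Proof. by case: f. Qed.

Lemma pairing_ae (f : L1circle R) (h : Hinf R) (F : R -> C) :
  {ae mu, forall t, I0 t -> boundary_value h (expi t) = F t} ->
  Hinf_pairing f h = cmean (fun t => sval f (expi t) * F t).
Proof.
move=> hF; rewrite -[LHS]/(cmean (fun t => sval f (expi t) * boundary_value h (expi t))).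
by apply: cmean_ae; apply: lebesgue_aeS hF => t + It => /(_ It) ->.
Qed.

Lemma radial_limit_le (h : Hinf R) (M : R) z (l : C) : nrm z <= 1 ->
  (forall z, nrm z < 1 -> nrm (h z) <= M) ->
  h (r%:C * z) @[r --> 1^'-] --> l -> nrm l <= M.
Proof.
move=> z1 hM hl.
have c : nrm (h (r%:C * z)) @[r --> (1 : R)^'-] --> nrm l by exact: ccvg_nrm.
rewrite -(cvg_lim _ c)//; apply: limr_le; first by apply: cvgP c.
apply: (near_left1 (ltr01 : 0 < (1 : R))) => r r0 _ r1; apply: hM.
rewrite nrmM nrm_real gtr0_norm//; apply: le_lt_trans r1.
by rewrite ler_piMr// ltW.
Qed.

Lemma cmean_dct_ae (f : nat -> R -> C) (u : R -> C) (g : R -> R) :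
  (forall n, cintegrable I0 (f n)) -> cmeas I0 u -> mu.-integrable I0 (EFin \o g) ->
  {ae mu, forall t, I0 t -> f n t @[n --> \oo] --> u t} ->
  {ae mu, forall t, I0 t -> forall n, nrm (f n t) <= g t} ->
  cintegrable I0 u /\ cmean (f n) @[n --> \oo] --> cmean u.
Proof.
move=> fi mu' ig fu fg.
have [h1 h2] := cint_dct (measurable_itv _) (fun n => cintegrable_meas (fi n)) mu' fu ig fg.
split; first exact: h1.
by apply: cvgM; [exact: cvg_cst|exact: h2].
Qed.

(** The k-th term [y k] times the Poisson kernel of [b k] has L^1 norm [|y k|] for the normalized
    measure, so the series converges in L^1 however close the [b k] come to the circle. *)
Lemma csum_point_evaluation (y b : nat -> C) : csummable y ->
  (forall n, nrm (b n) < 1) ->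
  exists f : L1circle R, forall h, Hinf_pairing f h = csum (fun n => y n * h (b n)).
Proof.
move=> sy b1.
pose fk k z : C := y k * (poisson (b k) z)%:C.
(* [ae_cvg_series_L1] gives its limit by this very formula. So the limit is [G] composed with
   [expi], as an element of [L1circle] has to come from a function of [z]. *)
pose G z := if `[< csummable (fk ^~ z) >] then csum (fk ^~ z) else 0.
have iP k : cintegrable I0 (fun t => (poisson (b k) (expi t))%:C).
  apply: cintegrable_cts => t; exact: poisson_cts.
have ik k : cintegrable I0 (fun t => fk k (expi t)) by exact: cintegrableZ.
have ink k : \int[mu]_(t in I0) nrm (fk k (expi t)) = 2 * pi * nrm (y k).
  have E : cmean (fun t => (poisson (b k) (expi t))%:C) = 1.
    rewrite -[RHS](expr0 (b k)) -(cmean_poisson (b1 k)).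
    by apply: eq_cmean => t _; rewrite expr0 mul1r.
  have := congr1 Re E; rewrite Re_cmean_real => /(congr1 (fun x => 2 * pi * x)).
  rewrite mulrA divff ?gt_eqF ?pi2_gt0// mul1r mulr1 => e.
  transitivity (\int[mu]_(t in I0) (nrm (y k) * poisson (b k) (expi t))).
    apply: eq_Rintegral => t _.
    by rewrite /fk nrmM nrm_real ger0_norm// poisson_ge0.
  by rewrite (@RintegralZl _ _ R mu _ _ _ (measurable_itv _) (iP k).1) e mulrC.
have [|g] := @ae_cvg_series_L1 R I0 (measurable_itv _) (fun k t => fk k (expi t))
    (2 * pi * limn (series (fun k => nrm (y k)))) ik.
  move=> n; rewrite /series/=; under eq_bigr do rewrite ink.
  rewrite -mulr_sumr ler_wpM2l ?pi2_ge0//.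
  by apply: rsum_partial_le => // k; exact: nrm_ge0.
move=> /= [mG ig aeG].
have sk n := cint_series (measurable_itv _) n ik.
have [||iG _] := @cmean_dct_ae (fun n t => series (fun k => fk k (expi t)) n)
  (fun t => G (expi t)) g (fun n => (sk n).1) mG ig.
- by apply: lebesgue_aeS aeG => t gt It; exact: (gt It).1.
- by apply: lebesgue_aeS aeG => t gt It; exact: (gt It).2.
exists (exist _ G iG) => h.
have [F [iF limF bF hF]] := Hinf_boundary h.
have [dh [M hM] _] := HinfP h.
rewrite (pairing_ae _ bF) /=; apply/esym/csumP.
(* Radial limits inherit the bound [M], so [M * g] dominates the partial sums multiplied by [F]. *)
have aeM : {ae mu, forall t, I0 t -> nrm (F t) <= M}.
  apply: lebesgue_aeS limF => t /[apply]; apply: radial_limit_le => //.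
  by rewrite nrm_expi.
have iFP k : cintegrable I0 (fun t => fk k (expi t) * F t).
  apply: (@eq_cintegrable R I0 (measurable_itv _)
    (fun t => y k * (F t * (poisson (b k) (expi t))%:C))) => [t _|].
    by rewrite /fk; ring.
  by apply: cintegrableZ => //; exact: cintegrable_poisson.
have skF n := cint_series (measurable_itv _) n iFP.
have SE n t : series (fun k => fk k (expi t)) n * F t =
    series (fun k => fk k (expi t) * F t) n.
  by rewrite /series/= mulr_suml.
have mE n : cmean (fun t => series (fun k => fk k (expi t)) n * F t) =
    series (fun k => y k * h (b k)) n.
  under [X in cmean X]eq_fun do rewrite SE.
  rewrite /cmean (skF n).2 /series/= mulr_sumr; apply: eq_bigr => k _.
  rewrite (hF _ (b1 k)) -cmeanZ; last exact: cintegrable_poisson.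
  by apply: eq_cmean => t _; rewrite /fk; ring.
have [|||||_] := @cmean_dct_ae (fun n t => series (fun k => fk k (expi t)) n * F t)
   (fun t => G (expi t) * F t) (fun t => M * g t).
- move=> n; apply: (@eq_cintegrable R I0 (measurable_itv _) _ _ _ (skF n).1) => t _.
  by rewrite SE.
- by apply: cmeasM; [exact: mG|exact: cintegrable_meas].
- exact: (@integrableZl _ _ R mu I0 (measurable_itv _) M _ ig).
- apply: lebesgue_aeS aeG => t gt It; apply: cvgM; last exact: cvg_cst.
  exact: (gt It).1.
- apply: lebesgue_aeS (lebesgue_aeI aeG aeM) => t [gt Mt] It n.
  rewrite nrmM mulrC; apply: ler_pM; rewrite ?nrm_ge0//; first exact: Mt.
  exact: (gt It).2.
by under eq_fun do rewrite mE.
Qed.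

Lemma csum_evaluation_continuous (y b : nat -> C) : csummable y ->
  (forall n, nrm (b n) < 1) ->
  continuous ((fun h => csum (fun n => y n * h (b n))) : Hinf_ws R -> C).
Proof.
move=> sy b1; have [f fP] := csum_point_evaluation sy b1.
have -> : (fun h : Hinf_ws R => csum (fun n => y n * h (b n))) = Hinf_pairing f.
  by apply/funext => h; rewrite fP.
exact: weak_star_pairing_continuous.
Qed.

Lemma evaluation_continuous z : nrm z < 1 ->
  continuous ((fun h : Hinf R => h z) : Hinf_ws R -> C).
Proof.
move=> z1.
have s0 : csummable (fun n => (n == 0%N)%:R : C).
  apply: (summable_le (M := fun n => 2^-1 ^+ n)).
    by apply: geometric_summable; rewrite invr_ge0 ler0n invf_lt1// ltr1n.
  by case=> [|n]; rewrite ?nrm1 ?nrm0 ?expr0// exprn_ge0.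
have c := @csum_evaluation_continuous _ (fun=> z) s0 (fun=> z1).
have E : (fun h : Hinf_ws R => csum (fun n => (n == 0%N)%:R * h z)) =
   (fun h : Hinf R => h z).
  apply/funext => h; rewrite (csum_single (k := 0%N)) ?mul1r//.
  by move=> n /negbTE ->; rewrite mul0r.
by rewrite E in c.
Qed.

End PointEvaluations.

(** * Free interpolation *)

Section FreeInterpolation.
Variable R : realType.
Local Notation C := (Cx R).
Local Notation nrm := (@Normc.normc R).
Local Notation Re := (@complex.Re R).
Local Notation mu := (@lebesgue_measure R).
Local Notation I0 := [set` `[(0 : R), 2 * pi]].
Implicit Types (z w : C).

Lemma l1_csummable (y : l1 R) : csummable (sval y).
Proof.
case: y => y /= ys.
have E : series (fun n => nrm (y n)) = (fun n => Re ([normed series y] n)).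
  by apply/funext => n; rewrite /series/= cReS; apply: eq_bigr => k _; rewrite normCE.
rewrite /csummable E; apply: cvgP (Re (limn [normed series y])) _.
exact: ccvg_Re ys.
Qed.

Lemma csummable_l1 (y : nat -> C) : csummable y -> cvgn [normed series y].
Proof.
move=> ys.
have E : [normed series y] = (fun n => (series (fun n => nrm (y n)) n)%:C : C).
  by apply/funext => n; rewrite /series/= rmorph_sum; apply: eq_bigr => k _; rewrite normCE.
rewrite E; apply: cvgP ((limn (series (fun n => nrm (y n))))%:C : C) _.
exact: ccvg_real ys.
Qed.

Lemma linf_bound (x : linf R) : exists2 X : R, 0 <= X & forall n, nrm (x n) <= X.
Proof.
case: x => x /= /asboolP[M hM]; exists (Re M) => [|n].
  by apply: le_trans (nrm_ge0 (x 0%N)) _; exact: nrm_le_bound.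
exact: nrm_le_bound.
Qed.

Lemma linf_val_lin (a : C) (x y : linf R) n : (a *: x + y) n = a * x n + y n.
Proof. by []. Qed.

Lemma Hinf_val_lin (a : C) (f h : Hinf R) z : (a *: f + h) z = a * f z + h z.
Proof. by []. Qed.

Lemma linf_eq (x y : linf R) : (forall n, x n = y n) -> x = y.
Proof. by move=> xy; apply: val_inj; apply/funext. Qed.

Lemma Hinf_eq (f h : Hinf R) : (forall z, nrm z < 1 -> f z = h z) -> f = h.
Proof.
move=> fh; apply: val_inj; apply/funext => z /=.
have [z1|z1] := pselect (disk z); first by apply: fh; rewrite -diskE.
have [_ _ f0] := HinfP f; have [_ _ h0] := HinfP h.
by rewrite [LHS]f0// [RHS]h0.
Qed.

Variables (b : nat -> C) (g : nat -> Hinf R) (K : C -> nat -> R) (A : R).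
Hypothesis b1 : forall n, nrm (b n) < 1.
Hypothesis gb : forall n k, g n (b k) = (n == k)%:R.
Hypothesis K0 : forall z n, 0 <= K z n.
Hypothesis gK : forall z n, nrm z < 1 -> nrm (g n z) <= K z n.
(** The majorant at an end point controls [g n] along its whole radius. This is the domination under
    which radial limits of [sum_n x_n g_n] are taken term by term. *)
Hypothesis gKr : forall z (r : R) n, nrm z = 1 -> 0 < r < 1 ->
  nrm (g n (r%:C * z)) <= K z n.
Hypothesis KA : forall z N, nrm z <= 1 -> series (K z) N <= A.

Let A0 : 0 <= A.
Proof.
have z1 : nrm (0 : C) <= 1 by rewrite nrm0.
by have := KA 0%N z1; rewrite /series/= big_geq.
Qed.

Let sumK z : nrm z <= 1 -> cvgn (series (K z)).
Proof. by move=> z1; apply: (@rsum_bounded _ _ A) => // n; exact: KA. Qed.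

Let gout n z : ~ (nrm z < 1) -> g n z = 0.
Proof. by move=> z1; have [_ _] := HinfP (g n); apply; rewrite diskE. Qed.

Let term_le (X : R) (x : linf R) z n : (forall n, nrm (x n) <= X) ->
  nrm z < 1 -> nrm (x n * g n z) <= X * K z n.
Proof. by move=> xX z1; rewrite nrmM; apply: ler_pM; rewrite ?nrm_ge0// gK. Qed.

Let sumXK X z : nrm z <= 1 -> cvgn (series (fun n => X * K z n)).
Proof. by move=> /sumK h; exact: (cvgn_seriesZ (M := X) h). Qed.

Let XKA X z : 0 <= X -> nrm z <= 1 -> limn (series (fun n => X * K z n)) <= X * A.
Proof.
move=> X0 z1; apply: rsum_le; first exact: sumXK.
by move=> N; rewrite /series/= -mulr_sumr ler_wpM2l// KA.
Qed.

Let summ (x : linf R) z : csummable (fun n => x n * g n z).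
Proof.
have [X X0 xX] := linf_bound x.
have [z1|z1] := pselect (nrm z < 1).
  by apply: (summable_le (@sumXK X _ (ltW z1))) => n; exact: term_le.
have -> : (fun n => x n * g n z) = (fun n => 0).
  by apply/funext => n; rewrite (gout _ z1) mulr0.
apply: (summable_le (M := fun=> 0)); last by move=> n; rewrite nrm0.
apply: (@rsum_bounded _ _ 0) => // N; rewrite /series/= big1//.
Qed.

Let ext (x : linf R) z := csum (fun n => x n * g n z).

Let ext_le X (x : linf R) z : 0 <= X -> (forall n, nrm (x n) <= X) -> nrm z < 1 ->
  nrm (ext x z) <= X * A.
Proof.
move=> X0 xX z1; apply: le_trans (XKA X0 (ltW z1)).
by apply: nrm_csum (@sumXK X _ (ltW z1)) _ => n; exact: term_le.
Qed.

(** The partial sums are uniformly bounded by [X * A], so pointwise convergence is enough for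
    analyticity, by [bounded_limit_derivable]. *)
Lemma ext_Hinf (x : linf R) : ext x \in @Hinf_pred R.
Proof.
have [X X0 xX] := linf_bound x.
apply/asboolP; split => [z||z].
- rewrite diskE; move: z.
  apply: (@bounded_limit_derivable _ (fun N z => series (fun n => x n * g n z) N) _ (X * A)).
  + move=> N z z1; elim: N => [|N IH].
      have -> : (fun z => series (fun n => x n * g n z) 0) = (fun=> 0).
        by apply/funext => w; rewrite /series/= big_geq.
      exact: derivable_cst.
    have -> : (fun z => series (fun n => x n * g n z) N.+1) =
        (fun z => series (fun n => x n * g n z) N) + (fun z => x N * g N z).
      by apply/funext => w; rewrite /series/= big_nat_recr.
    apply: derivableD; first exact: IH.
    by apply: derivableZ; have [dg _ _] := HinfP (g N); exact: dg.
  + move=> N z z1; apply: le_trans (nrm_series _ _) _.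
    apply: (@le_trans _ _ (X * series (K z) N)); last by rewrite ler_wpM2l// KA// ltW.
    rewrite /series/= mulr_sumr; apply: ler_sum => n _; exact: term_le.
  + by move=> z z1; apply: csum_cvg; exact: summ.
- exists (X * A)%:C => z; rewrite diskE => z1; rewrite normCE lecR; exact: ext_le.
- rewrite diskE => z1; rewrite /ext (csum_single (k := 0%N)).
    by rewrite gout ?mulr0.
  by move=> n _; rewrite gout ?mulr0.
Qed.

Definition extension (x : linf R) : Hinf R := HInf (ext_Hinf x).

Lemma extension_linear : linear extension.
Proof.
move=> a x y; apply: Hinf_eq => z z1; rewrite Hinf_val_lin /extension/= /ext.
rewrite -csumZ; last exact: summ.
rewrite -csumD; [|apply: summableZ; exact: summ|exact: summ].
by apply: csum_eq => n; rewrite linf_val_lin mulrDl mulrA.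
Qed.

HB.instance Definition _ :=
  GRing.isLinear.Build C (linf R) (Hinf R) *:%R extension extension_linear.

Lemma restriction_linf (h : Hinf R) : (fun n => h (b n)) \in @linf_pred R.
Proof.
have [_ [M hM] _] := HinfP h; apply/asboolP; exists M%:C => n.
by rewrite normCE lecR; exact: hM.
Qed.

Definition restriction (h : Hinf R) : linf R := Linf (restriction_linf h).

Lemma extensionK : cancel extension restriction.
Proof.
move=> x; apply: linf_eq => k /=; rewrite /ext (csum_single (k := k)).
  by rewrite gb eqxx mulr1.
by move=> n nk; rewrite gb (negbTE nk) mulr0.
Qed.

Lemma interpolating_of_extension : interpolating b.
Proof.
move=> x; exists (extension x) => n.
exact: (congr1 (fun y : linf R => y n) (extensionK x)).
Qed.

Lemma restriction_continuous : continuous (restriction : Hinf_ws R -> linf_ws R).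
Proof.
apply: continuous_weak_star => y.
exact: (csum_evaluation_continuous (@l1_csummable y) b1).
Qed.

Lemma extension_closed : closed (range extension : set (Hinf_ws R)).
Proof.
have -> : (range extension : set (Hinf_ws R)) = \bigcap_(z in [set z | nrm z < 1])
    [set h : Hinf_ws R | (h : Hinf R) z = csum (fun n => g n z * (h : Hinf R) (b n))].
  apply/seteqP; split => [_ [x _ <-] z /= z1|h hP].
    apply: csum_eq => n; rewrite mulrC; congr (_ * _).
    exact/esym/(congr1 (fun y : linf R => y n) (extensionK x)).
  exists (restriction h) => //; apply: Hinf_eq => z z1 /=.
  rewrite [RHS](hP _ z1); apply: csum_eq => n; exact: mulrC.
apply: closed_bigI => z /= z1; apply: closed_eq_fun.
  exact: evaluation_continuous.
apply: csum_evaluation_continuous => //.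
(* For fixed [z] the numbers [g n z] form an l^1 sequence of weights, being dominated by [K z]. *)
by apply: (summable_le (sumK (ltW z1))) => n; exact: gK.
Qed.

(* The boundary functions of the [g n] are replaced by versions that satisfy the
   domination by [K] at every point, not just almost everywhere. *)
Let boundary : exists G : nat -> R -> C, [/\ forall n, cmeas I0 (G n),
  forall n t, I0 t -> nrm (G n t) <= K (expi t) n &
  {ae mu, forall t, I0 t -> forall n, g n (r%:C * expi t) @[r --> 1^'-] --> G n t}].
Proof.
have [F FP] := choice (fun n => Hinf_boundary (g n)).
have : {ae mu, forall t, forall n, I0 t -> g n (r%:C * expi t) @[r --> 1^'-] --> F n t}.
  by apply: lebesgue_ae_nat => n; have [_ + _ _] := FP n.
move=> [N [mN N0 NP]].
have FN t n : ~ N t -> I0 t -> g n (r%:C * expi t) @[r --> 1^'-] --> F n t.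
  by move=> Nt; move: n; apply: contrapT => h; apply: Nt; exact: NP.
exists (fun n t => ((\1_(~` N) t)%:C : C) * F n t); split.
- move=> n; apply: cmeasM.
    by apply: cmeas_real; apply: measurable_indic; exact: measurableC.
  by have [iF _ _ _] := FP n; exact: cintegrable_meas.
- move=> n t It; rewrite indicE; have [Nt|Nt] := pselect (N t).
    by rewrite memNset// mul0r nrm0.
  rewrite mem_set// mul1r.
  have c : nrm (g n (r%:C * expi t)) @[r --> (1 : R)^'-] --> nrm (F n t).
    by apply: ccvg_nrm; exact: FN.
  rewrite -(cvg_lim _ c)//; apply: limr_le; first by apply: cvgP c.
  apply: (near_left1 (ltr01 : 0 < (1 : R))) => r r0 _ r1.
  by apply: gKr; rewrite ?nrm_expi ?r0.
- exists N; split => // t /= h; apply: contrapT => Nt; apply: h => It n.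
  by rewrite indicE mem_set// mul1r; exact: FN.
Qed.

(** On the circle every partial sum for a sequence bounded by [X] is at most [X * A] after passage
    to boundary functions, so [X * A * |f|] dominates. The same bound, for a sequence of suitable
    phases, gives the summability. *)
Lemma pairing_extension (f : L1circle R) :
  csummable (fun n => Hinf_pairing f (g n)) /\
  forall x, Hinf_pairing f (extension x) = csum (fun n => Hinf_pairing f (g n) * x n).
Proof.
have [G [mG GK GP]] := boundary.
pose u t : C := sval f (expi t).
have iu : cintegrable I0 u := L1circle_cintegrable f.
have mu' := cintegrable_meas iu.
have inu := integrable_nrm (measurable_itv _) iu.
have iA X : mu.-integrable I0 (EFin \o (fun t => X * A * nrm (u t))).
  exact: (@integrableZl _ _ R mu I0 (measurable_itv _) (X * A) _ inu).
have K1 t n : I0 t -> K (expi t) n <= A.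
  move=> It; apply: le_trans (KA n.+1 (_ : nrm (expi t) <= 1)); last by rewrite nrm_expi.
  by rewrite /series/= big_nat_recr//= lerDr; apply: sumr_ge0.
have iuG n : cintegrable I0 (fun t => u t * G n t).
  apply: (cintegrable_le (measurable_itv _) (g := fun t => 1 * A * nrm (u t))) => //.
    exact: cmeasM.
  move=> t It; rewrite nrmM mulrC mul1r ler_wpM2r ?nrm_ge0//.
  exact: le_trans (GK n t It) (K1 t n It).
have pE n : Hinf_pairing f (g n) = cmean (fun t => u t * G n t).
  apply: pairing_ae; apply: lebesgue_aeS GP => t tG It.
  apply: boundary_value_lim; exact: tG.
have serX (x : nat -> C) X : 0 <= X -> (forall n, nrm (x n) <= X) -> forall N,
   [/\ cintegrable I0 (fun t => series (fun n => x n * (u t * G n t)) N),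
    cmean (fun t => series (fun n => x n * (u t * G n t)) N) =
      series (fun n => Hinf_pairing f (g n) * x n) N &
    forall t, I0 t -> nrm (series (fun n => x n * (u t * G n t)) N) <= X * A * nrm (u t)].
  move=> X0 xX N.
  have ix n : cintegrable I0 (fun t => x n * (u t * G n t)) by exact: cintegrableZ.
  have [i1 e1] := cint_series (measurable_itv _) N ix; split => [||t It].
  - exact: i1.
  - rewrite /cmean e1 /series/= mulr_sumr; apply: eq_bigr => n _.
    rewrite pE [RHS]mulrC -(cmeanZ (x n) (iuG n)); exact: erefl.
  - apply: le_trans (nrm_series _ _) _.
    apply: (@le_trans _ _ (X * series (K (expi t)) N * nrm (u t))).
      rewrite /series/= mulr_sumr mulr_suml; apply: ler_sum => n _.
      rewrite !nrmM mulrA mulrAC ler_wpM2r ?nrm_ge0//.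
      by apply: ler_pM; rewrite ?nrm_ge0// GK.
    by rewrite ler_wpM2r ?nrm_ge0// ler_wpM2l// KA// nrm_expi.
pose L := (2 * pi)^-1 * \int[mu]_(t in I0) (1 * A * nrm (u t)).
have sumP : csummable (fun n => Hinf_pairing f (g n)).
  apply: (@rsum_bounded _ _ L) => [n|N]; first exact: nrm_ge0.
  pose p n := Hinf_pairing f (g n).
  (* Phases that turn [p n] into its modulus. Where [p n = 0] the value is 0, and the bound by 1
     still holds. *)
  pose x n : C := Num.conj (p n) / (nrm (p n))%:C.
  have x1 n : nrm (x n) <= 1.
    rewrite /x nrmM nrmV nrmJ nrm_real ger0_norm ?nrm_ge0//.
    by have [->|h] := eqVneq (nrm (p n)) 0; rewrite ?mul0r// divff.
  have px n : p n * x n = (nrm (p n))%:C.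
    rewrite /x mulrA mulcJ -fmorphV -rmorphM; congr (_%:C).
    have [->|h] := eqVneq (nrm (p n)) 0; first by rewrite invr0 mulr0.
    by rewrite expr2 mulfK.
  have [i1 e1 le1] := serX x 1 ler01 x1 N.
  have E : series (fun n => nrm (p n)) N = nrm (series (fun n => p n * x n) N).
    have -> : series (fun n => p n * x n) N = (series (fun n => nrm (p n)) N)%:C.
      by rewrite /series/= rmorph_sum; apply: eq_bigr => n _; rewrite px.
    have S0 : 0 <= series (fun n => nrm (p n)) N.
      by rewrite /series; apply: sumr_ge0 => n _; exact: nrm_ge0.
    by rewrite nrm_real (ger0_norm S0).
  rewrite -/p E -e1 /cmean nrmM nrm_real ger0_norm ?invr_ge0 ?pi2_ge0//.
  rewrite ler_wpM2l ?invr_ge0 ?pi2_ge0//.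
  exact: (nrm_cint_le (measurable_itv _) i1 (iA 1)).
split => // x; have [X X0 xX] := linf_bound x.
have sx t : I0 t -> csummable (fun n => x n * G n t).
  move=> It; apply: (summable_le (@sumXK X _ (_ : nrm (expi t) <= 1))); first by rewrite nrm_expi.
  by move=> n; rewrite nrmM; apply: ler_pM; rewrite ?nrm_ge0// GK.
have lim : {ae mu, forall t, I0 t -> boundary_value (extension x) (expi t) =
    csum (fun n => x n * G n t)}.
  apply: lebesgue_aeS GP => t tG It; apply: boundary_value_lim.
  apply: (tannery _ (@sumXK X _ (_ : nrm (expi t) <= 1))); first by rewrite nrm_expi.
    apply: (near_left1 (ltr01 : 0 < (1 : R))) => r r0 _ r1 n.
    rewrite nrmM; apply: ler_pM; rewrite ?nrm_ge0//.
    by apply: gKr; rewrite ?nrm_expi ?r0.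
  by move=> n; apply: cvgM; [exact: cvg_cst|exact: tG].
rewrite (pairing_ae _ lim).
have sE t N : series (fun n => x n * (u t * G n t)) N =
    u t * series (fun n => x n * G n t) N.
  by rewrite /series/= mulr_sumr; apply: eq_bigr => n _; rewrite mulrCA.
have [||||_ c] := @cint_dct_pt R I0 (measurable_itv _)
   (fun N t => series (fun n => x n * (u t * G n t)) N)
   (fun t => u t * csum (fun n => x n * G n t)) (fun t => X * A * nrm (u t)).
- by move=> N; apply: cintegrable_meas; have [] := serX x X X0 xX N.
- move=> t It; under eq_fun do rewrite sE.
  by apply: cvgM; [exact: cvg_cst|exact: csum_cvg (sx t It)].
- exact: iA.
- by move=> N t It; have [_ _] := serX x X X0 xX N; apply.
apply/esym/csumP.
have -> : series (fun n => Hinf_pairing f (g n) * x n) =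
    (fun N => cmean (fun t => series (fun n => x n * (u t * G n t)) N)).
  by apply/funext => N; have [_ ->] := serX x X X0 xX N.
by apply: cvgM; [exact: cvg_cst|exact: c].
Qed.

Lemma extension_continuous : continuous (extension : linf_ws R -> Hinf_ws R).
Proof.
apply: continuous_weak_star => f; have [sf fP] := pairing_extension f.
pose y : l1 R := exist _ (fun n => Hinf_pairing f (g n)) (csummable_l1 sf).
have -> : (fun x : linf_ws R => Hinf_pairing f (extension x)) = linf_pairing y.
  by apply/funext => x; rewrite fP.
exact: weak_star_pairing_continuous.
Qed.

Lemma weak_star_copy_of_extension (g' : nat -> C -> C) :
  (forall n z, nrm z < 1 -> g n z = g' n z) -> weak_star_copy_of_linf g'.
Proof.
move=> gg'; exists extension; split.
- move=> n z; rewrite diskE => z1; rewrite -gg'//= /ext (csum_single (k := n)).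
    by rewrite /= eqxx mul1r.
  by move=> k kn; rewrite /= (negbTE kn) mul0r.
- exact: extension_continuous.
- exists restriction; split; first exact: extensionK.
  by apply: continuous_subspaceT; exact: restriction_continuous.
- exact: extension_closed.
Qed.

End FreeInterpolation.

(** * Blaschke products *)

Section BlaschkeFactor.
Variable R : realType.
Local Notation C := (Cx R).
Local Notation nrm := (@Normc.normc R).
Local Notation Re := (@complex.Re R).
Local Notation Im := (@complex.Im R).
Local Notation kernel w z := ((1 - `|w| ^+ 2) / (1 - Num.conj w * z)).
Implicit Types (z w : C).

Lemma nrm_blaschke_identity w z : nrm (1 - Num.conj w * z) ^+ 2 - nrm (w - z) ^+ 2 =
  (1 - nrm w ^+ 2) * (1 - nrm z ^+ 2).
Proof.
rewrite !sqr_nrm !cReB !cImB cReM cImM cReJ cImJ.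
rewrite (_ : Re (1 : C) = 1)// (_ : Im (1 : C) = 0)//.
by move: (Re w) (Im w) (Re z) (Im z) => p q r s; ring.
Qed.

Lemma one_sub_conj_ge w z : nrm z <= 1 -> 1 - nrm w <= nrm (1 - Num.conj w * z).
Proof.
move=> z1; have := nrmD (1 - Num.conj w * z) (Num.conj w * z).
rewrite subrK nrm1 nrmM nrmJ.
have : nrm w * nrm z <= nrm w by rewrite ler_piMr// nrm_ge0.
by move: (nrm (1 - _)) (nrm w * nrm z) (nrm w) => p q r; lra.
Qed.

Lemma one_sub_conj_neq0 w z : nrm w < 1 -> nrm z <= 1 -> 1 - Num.conj w * z != 0.
Proof.
move=> w1 z1; rewrite -nrm_gt0; apply: lt_le_trans (one_sub_conj_ge w z1).
by rewrite subr_gt0.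
Qed.

Lemma nrm_blaschke_factor w z : w != 0 ->
  nrm (blaschke_factor w z) = nrm (w - z) / nrm (1 - Num.conj w * z).
Proof.
move=> w0; rewrite /blaschke_factor (negbTE w0) normCE !nrmM !nrmV nrm_real.
by rewrite ger0_norm ?nrm_ge0// divff ?mul1r// nrm_eq0.
Qed.

Lemma nrm_blaschke_factor_le1 w z : nrm w < 1 -> nrm z <= 1 ->
  nrm (blaschke_factor w z) <= 1.
Proof.
move=> w1 z1; have [->|w0] := eqVneq w 0; first by rewrite /blaschke_factor eqxx.
have D0 : 0 < nrm (1 - Num.conj w * z) by rewrite nrm_gt0 one_sub_conj_neq0.
rewrite nrm_blaschke_factor// ler_pdivrMr// mul1r -(@ler_pXn2r _ 2)// ?nnegrE ?nrm_ge0//.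
rewrite -subr_ge0 nrm_blaschke_identity; apply: mulr_ge0.
  by rewrite subr_ge0 exprn_ile1// ?nrm_ge0// ltW.
by rewrite subr_ge0 exprn_ile1// nrm_ge0.
Qed.

Lemma inv_one_sub_derivable w z : nrm w < 1 -> nrm z < 1 ->
  derivable (fun z : C => (1 - Num.conj w * z)^-1) z 1.
Proof.
move=> w1; move: z; apply: (@pser_derivable _ _ (fun n => Num.conj w ^+ n) 1).
  by move=> n; rewrite nrmX nrmJ exprn_ile1// ?nrm_ge0// ltW.
move=> z z1; rewrite /pser -csum_geometric; last first.
  rewrite nrmM nrmJ; apply: le_lt_trans z1.
  by rewrite ler_piMl ?nrm_ge0// ltW.
by apply: csum_eq => n; rewrite exprMn.
Qed.

Lemma blaschke_factor_derivable w z : nrm w < 1 -> nrm z < 1 ->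
  derivable (blaschke_factor w) z 1.
Proof.
move=> w1 z1; have [->|w0] := eqVneq w 0.
  have -> : blaschke_factor (0 : C) = id.
    by apply/funext => x; rewrite /blaschke_factor eqxx.
  exact: derivable_id.
have -> : blaschke_factor w =
    (fun z => (`|w| / w) * (w - z)) * (fun z => (1 - Num.conj w * z)^-1).
  apply/funext => x; rewrite /blaschke_factor (negbTE w0) mulrA; exact: erefl.
apply: derivableM; last exact: inv_one_sub_derivable.
apply: derivableZ; apply: derivableB; [exact: derivable_cst|exact: derivable_id].
Qed.

Lemma nrm_kernel w z : nrm w < 1 ->
  nrm (kernel w z) = (1 - nrm w ^+ 2) / nrm (1 - Num.conj w * z).
Proof.
move=> w1; rewrite nrmM nrmV; congr (_ / _).
have -> : 1 - `|w| ^+ 2 = (1 - nrm w ^+ 2)%:C :> C.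
  by rewrite normCE rmorphB rmorph1 rmorphXn.
rewrite nrm_real ger0_norm//.
by rewrite subr_ge0 exprn_ile1// ?nrm_ge0// ltW.
Qed.

Lemma nrm_kernel_le2 w z : nrm w < 1 -> nrm z <= 1 -> nrm (kernel w z) <= 2.
Proof.
move=> w1 z1; rewrite nrm_kernel// ler_pdivrMr; last first.
  by rewrite nrm_gt0 one_sub_conj_neq0.
apply: (@le_trans _ _ (2 * (1 - nrm w))); last by rewrite ler_wpM2l// one_sub_conj_ge.
have := nrm_ge0 w; move: (nrm w) w1 => t t1 t0; rewrite expr2; nra.
Qed.

Section NearCircle.
Variables (a w : C) (d e : R).
Hypothesis a1 : nrm a = 1.
Hypothesis d0 : 0 < d.
Hypothesis d1 : d <= 2^-1.
Hypothesis e0 : 0 < e.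
Hypothesis e1 : e <= 1.
Hypothesis w1 : nrm w < 1.
Hypothesis wa : nrm (w - a) < d * e / 8.

Let tail : 1 - nrm w <= d * e / 8.
Proof.
have := nrmD (a - w) w; rewrite subrK a1 nrmB.
by move: wa; move: (d * e / 8) (nrm (w - a)) (nrm w) => p q r; lra.
Qed.

Let half_le : d * e / 8 <= d / 2.
Proof.
have h : d * e <= d by rewrite ler_piMr// ltW.
have aux (p q : R) : 0 < q -> p <= q -> p / 8 <= q / 2 by lra.
exact: aux.
Qed.

(** [1 - |w| <= d * e / 8 <= d / 2 <= 1 / 4]. It places [w] in the second branch of
    [blaschke_factor]. *)
Lemma near_circle_neq0 : w != 0.
Proof.
rewrite -nrm_gt0; have := tail; have := half_le; move: d1.
by move: (d * e / 8) (nrm w) => p q; lra.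
Qed.

(** With [a] in place of [w] the right-hand side is [|a - z| >= d], as [a] is on the circle.
    Replacing [a] by [w] costs at most [|w - a| < d / 2]. *)
Lemma one_sub_conj_far z : nrm z <= 1 -> d <= nrm (z - a) ->
  d / 2 <= nrm (1 - Num.conj w * z).
Proof.
move=> z1 dz.
have aa : Num.conj a * a = 1 by rewrite mulrC mulcJ a1 expr1n.
have E : Num.conj a * (a - z) = (1 - Num.conj w * z) + (Num.conj w - Num.conj a) * z.
  by rewrite mulrBr aa; ring.
have := nrmD (1 - Num.conj w * z) ((Num.conj w - Num.conj a) * z).
rewrite -E nrmM nrmJ a1 mul1r [nrm (a - z)]nrmB => h.
have h2 : nrm ((Num.conj w - Num.conj a) * z) <= nrm (w - a).
  by rewrite -rmorphB nrmM nrmJ ler_piMr// nrm_ge0.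
have aux (p q r s t : R) : r <= s + p -> p <= q -> q < t -> t <= d / 2 -> d <= r ->
  d / 2 <= s by lra.
exact: aux h h2 wa half_le dz.
Qed.

Lemma nrm_kernel_far z : nrm z <= 1 -> d <= nrm (z - a) -> nrm (kernel w z) <= e.
Proof.
move=> z1 dz; have D := one_sub_conj_far z1 dz.
have d20 : 0 < d / 2 by rewrite divr_gt0.
rewrite nrm_kernel// ler_pdivrMr; last exact: lt_le_trans D.
apply: (@le_trans _ _ (e * (d / 2))); last by rewrite ler_wpM2l// ltW.
apply: (@le_trans _ _ (2 * (d * e / 8))).
  have := tail; have := nrm_ge0 w; move: (nrm w) w1 (d * e / 8) => t t1 x t0 tx.
  by rewrite expr2; nra.
have : 0 <= d * e by rewrite mulr_ge0// ltW.
by lra.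
Qed.

Lemma one_sub_blaschke_factor_far z : nrm z <= 1 -> d <= nrm (z - a) ->
  nrm (1 - blaschke_factor w z) <= e.
Proof.
move=> z1 dz; have D := one_sub_conj_far z1 dz.
have d20 : 0 < d / 2 by rewrite divr_gt0.
have w0 := near_circle_neq0.
have D0 := one_sub_conj_neq0 w1 z1.
(* Over the common denominator, the product of [w] and its conjugate being [|w| ^ 2], the factor
   [1 - |w|] splits off; it is small near the circle. *)
have E : 1 - blaschke_factor w z =
    (1 - (nrm w)%:C) * (w + (nrm w)%:C * z) / (w * (1 - Num.conj w * z)).
  have -> : (1 - (nrm w)%:C) * (w + (nrm w)%:C * z) =
      w * (1 - Num.conj w * z) - (nrm w)%:C * (w - z).
    have wq := mulcJ w; rewrite rmorphXn in wq.
    have -> : w * (1 - Num.conj w * z) = w - w * Num.conj w * z by ring.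
    by rewrite wq; ring.
  rewrite /blaschke_factor (negbTE w0) normCE.
  move: D0; move: (Num.conj w) (nrm w)%:C => q p D0; field.
  by rewrite w0 D0.
rewrite E !nrmM nrmV nrmM.
have nw0 : 0 < nrm w by rewrite nrm_gt0.
have Dp : 0 < nrm (1 - Num.conj w * z) by rewrite nrm_gt0.
rewrite ler_pdivrMr ?mulr_gt0//.
have -> : nrm (1 - (nrm w)%:C) = 1 - nrm w.
  have -> : 1 - (nrm w)%:C = (1 - nrm w)%:C :> C by rewrite rmorphB rmorph1.
  by rewrite nrm_real ger0_norm// subr_ge0 ltW.
have N : nrm (w + (nrm w)%:C * z) <= 2 * nrm w.
  apply: le_trans (nrmD _ _) _; rewrite nrmM nrm_real ger0_norm ?nrm_ge0//.
  have : nrm w * nrm z <= nrm w by rewrite ler_piMr// nrm_ge0.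
  by move: (nrm w * nrm z) (nrm w) => p q; lra.
apply: (@le_trans _ _ (d * e / 8 * (2 * nrm w))).
  by apply: ler_pM => //; rewrite ?nrm_ge0// subr_ge0 ltW.
apply: (@le_trans _ _ (e * (nrm w * (d / 2)))); last first.
  by rewrite ler_wpM2l ?(ltW e0)// ler_wpM2l// ltW.
have : 0 <= d * e * nrm w by rewrite !mulr_ge0// ltW.
move: (nrm w) => t.
have -> : d * e / 8 * (2 * t) = (d * e * t) / 4 by field.
have -> : e * (t * (d / 2)) = (d * e * t) / 2 by field.
by lra.
Qed.

End NearCircle.
End BlaschkeFactor.

Lemma prod_ord_neqS (T : nzRingType) (f : nat -> T) (k N : nat) :
  \prod_(n < N.+1 | n != k :> nat) f n =
  \prod_(n < N | n != k :> nat) f n * (if N != k then f N else 1).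
Proof. by rewrite big_mkcond big_ord_recr/= -big_mkcond. Qed.

(** * Separated sequences and finite products *)

Section Separation.
Variable R : realType.
Local Notation C := (Cx R).
Local Notation nrm := (@Normc.normc R).

Lemma separated_seq_dist (a : nat -> C) : separated_seq a ->
  exists d : nat -> R, forall n, [/\ 0 < d n, d n <= 2^-1 &
    forall j, j != n -> 4 * d n <= nrm (a j - a n)].
Proof.
move=> [inj iso].
suff /choice[d dP] : forall n, exists d : R, [/\ 0 < d, d <= 2^-1 &
    forall j, j != n -> 4 * d <= nrm (a j - a n)] by exists d.
move=> n; have [_ [V /near_nrmP[e e0 eV] Va]] := iso n.
have h0 : 0 < (2 : R)^-1 by rewrite invr_gt0.
(* The factor 4 makes the discs of radius [2 * d n] disjoint; the bound 1/2 keeps the [b n] away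
   from 0. *)
exists (Num.min (e / 4) 2^-1); split.
- by rewrite lt_min h0 divr_gt0.
- by rewrite ge_min lexx orbT.
- move=> j jn; apply: (@le_trans _ _ e).
    have : Num.min (e / 4) 2^-1 <= e / 4 by rewrite ge_min lexx.
    by move: (Num.min _ _) => p; lra.
  rewrite leNgt; apply/negP => /eV Vj.
  have : (V `&` range a) (a j) by split => //; exists j.
  by rewrite Va => /inj/eqP; rewrite (negbTE jn).
Qed.

(** The Weierstrass product inequality. The upper bound is part of the induction: a new factor
    lowers the product [p] by at most [p * e N], and [p <= 1]. *)
Lemma prod_ge_one_sub (x e : nat -> R) (k N : nat) :
  (forall n, 0 <= e n) -> (forall n, n != k -> 0 <= x n <= 1) ->
  (forall n, n != k -> 1 - e n <= x n) ->
  1 - series e N <= \prod_(n < N | n != k :> nat) x n <= 1.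
Proof.
move=> e0 x01 ex; elim: N => [|N /andP[IH1 IH2]].
  by rewrite big_ord0 /series/= big_geq// subr0 lexx.
have -> : series e N.+1 = series e N + e N by rewrite /series/= big_nat_recr.
rewrite prod_ord_neqS; have := e0 N.
have p0 : 0 <= \prod_(n < N | n != k :> nat) x n by apply: prodr_ge0 => n /x01/andP[].
have [Nk|Nk] := eqVneq N k.
  by rewrite mulr1 => h; rewrite IH2 andbT; move: IH1; move: (\prod_(_ < _ | _) _) => p; lra.
have := ex _ Nk; have /andP[] := x01 _ Nk; rewrite /=.
move: IH1 IH2 p0; move: (\prod_(_ < _ | _) _) (x N) (e N) (series e N) => p q r s.
by move=> *; apply/andP; split; nra.
Qed.

End Separation.

(** * The Blaschke products of a sequence close to [a] *)

Section BlaschkeSequence.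
Variable R : realType.
Local Notation C := (Cx R).
Local Notation nrm := (@Normc.normc R).
Local Notation kernel w z := ((1 - `|w| ^+ 2) / (1 - Num.conj w * z)).
Implicit Types (z w : C).

Variables (a : nat -> C) (d e : nat -> R) (m : R) (b : nat -> C).
Hypothesis a1 : forall n, nrm (a n) = 1.
Hypothesis dP : forall n, [/\ 0 < d n, d n <= 2^-1 &
    forall j, j != n -> 4 * d n <= nrm (a j - a n)].
Hypothesis m0 : 0 < m.
Hypothesis e0 : forall n, 0 < e n.
Hypothesis e1 : forall n, e n <= 1.
Hypothesis em : forall N, series e N <= 1 - m.
Hypothesis b1 : forall n, nrm (b n) < 1.
Hypothesis ba : forall n, nrm (b n - a n) < d n * e n / 8.

Let d0 n : 0 < d n. Proof. by have [] := dP n. Qed.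
Let d1 n : d n <= 2^-1. Proof. by have [] := dP n. Qed.

Let b0 n : b n != 0.
Proof. exact: near_circle_neq0 (a1 n) (d0 n) (d1 n) (e1 n) (ba n). Qed.

(** On the closed disk 2 bounds the modulus of the kernel of [b n] and of 1 minus its Blaschke
    factor, and [e n] bounds both off the disc of radius [d n]. Up to the factor [m^-1] it is the
    majorant of [g_n]. *)
Let K z n : R := if nrm (z - a n) < 2 * d n then 2 else e n.

Let K0 z n : 0 <= K z n.
Proof. by rewrite /K; case: ifP => // _; exact: ltW. Qed.

(* The discs |z - a n| < 2 * d n are pairwise disjoint, so at most one term of
   the series is exceptional. *)
Let K_sum z N : series (K z) N <= 3.
Proof.
have exc n j : nrm (z - a n) < 2 * d n -> nrm (z - a j) < 2 * d j -> n = j.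
  move=> zn zj; apply/eqP; apply: contraT => nj.
  have [_ _ /(_ n nj) h1] := dP j.
  have [_ _ /(_ j)] := dP n; rewrite eq_sym => /(_ nj) h2.
  have := nrmD (z - a j) (- (z - a n)); rewrite nrmN.
  have -> : z - a j - (z - a n) = a n - a j by ring.
  rewrite nrmB in h2 *; rewrite nrmB in h1.
  move: h1 h2 zn zj; rewrite (nrmB (a n) (a j)).
  move: (nrm (a j - a n)) (nrm (z - a j)) (nrm (z - a n)) (d n) (d j).
  by move=> p q r s t *; lra.
have [[k kz]|nk] := pselect (exists k, nrm (z - a k) < 2 * d k); last first.
  apply: (@le_trans _ _ (series e N)); last by have := em N; move: (series e N) m0 => p; lra.
  apply: ler_sum => n _; rewrite /K; case: ifP => // h; case: nk; exists n; exact: h.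
have delta : \sum_(0 <= n < N) (n == k)%:R <= (1 : R).
  have -> : \sum_(0 <= n < N) (n == k)%:R = (k < N)%N%:R :> R.
    elim: N => [|N IH]; first by rewrite big_geq.
    rewrite big_nat_recr//= IH ltnS [(k <= N)%N]leq_eqVlt eq_sym.
    by have [->|_] := eqVneq; rewrite ?ltnn ?add0r ?addr0.
  by case: (k < N)%N.
apply: (@le_trans _ _ (series e N + 2 * \sum_(0 <= n < N) (n == k)%:R)).
  rewrite /series/= mulr_sumr -big_split/=; apply: ler_sum => n _.
  rewrite /K; case: ifPn => h.
    by rewrite (exc n k h kz) eqxx mulr1 lerDr ltW.
  by rewrite lerDl mulr_ge0.
have := em N; move: (series e N) (\sum_(0 <= n < N) _) delta m0 => p q; lra.
Qed.

(** The function is evaluated at [z] and the majorant is read at [w]: either [w] is [z] itself, or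
    it is the end point of the radius through [z]. *)
Let K_near z w n : (nrm (z - a n) < d n -> nrm (w - a n) < 2 * d n) ->
  K w n = 2 \/ (K w n = e n /\ d n <= nrm (z - a n)).
Proof.
move=> h; rewrite /K; case: ifPn => h2; first by left.
by right; split => //; rewrite leNgt; apply/negP => /h; exact/negP.
Qed.

Let K_self z n : nrm (z - a n) < d n -> nrm (z - a n) < 2 * d n.
Proof. by move=> h; apply: lt_trans h _; have := d0 n; move: (d n) => p; lra. Qed.

Let K_radial z (r : R) n : nrm z = 1 -> 0 < r < 1 ->
  nrm (r%:C * z - a n) < d n -> nrm (z - a n) < 2 * d n.
Proof.
move=> z1 /andP[r0 r1] h.
have h1 : 1 - r <= nrm (r%:C * z - a n).
  have := nrmD (a n - r%:C * z) (r%:C * z); rewrite subrK a1 nrmM z1 mulr1.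
  by rewrite nrm_real gtr0_norm// nrmB -lerBlDr.
have -> : z - a n = (r%:C * z - a n) + (1 - r%:C) * z by ring.
apply: le_lt_trans (nrmD _ _) _.
have -> : 1 - r%:C = (1 - r)%:C :> C by rewrite rmorphB rmorph1.
rewrite nrmM z1 mulr1 nrm_real ger0_norm ?subr_ge0 ?ltW//.
by move: h h1; move: (nrm _) (d n) => p q; lra.
Qed.

Let kernel_K z w n : nrm z <= 1 ->
  (nrm (z - a n) < d n -> nrm (w - a n) < 2 * d n) -> nrm (kernel (b n) z) <= K w n.
Proof.
move=> z1 /K_near[->|[-> dz]]; first exact: nrm_kernel_le2.
exact: (nrm_kernel_far (a1 n) (d0 n) (e0 n) (e1 n) (b1 n) (ba n) z1 dz).
Qed.

Let factor_K z n : nrm z <= 1 -> nrm (1 - blaschke_factor (b n) z) <= K z n.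
Proof.
move=> z1; have [->|[-> dz]] := K_near (@K_self z n).
  apply: le_trans (nrmD _ _) _; rewrite nrm1 nrmN.
  by have := nrm_blaschke_factor_le1 (b1 n) z1; move: (nrm _) => p; lra.
exact: (one_sub_blaschke_factor_far (a1 n) (d0 n) (d1 n) (e0 n) (e1 n) (b1 n) (ba n) z1 dz).
Qed.

Let pp k N z : C := \prod_(n < N | n != k :> nat) blaschke_factor (b n) z.

Let ppS k N z : pp k N.+1 z = pp k N z * (if N != k then blaschke_factor (b N) z else 1).
Proof. exact: (prod_ord_neqS (fun n => blaschke_factor (b n) z)). Qed.

Let pp_le1 k N z : nrm z <= 1 -> nrm (pp k N z) <= 1.
Proof.
move=> z1; elim: N => [|N IH]; first by rewrite /pp big_ord0 nrm1.
rewrite ppS nrmM.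
apply: mulr_ile1; rewrite ?nrm_ge0//; case: ifP => _; last by rewrite nrm1.
exact: nrm_blaschke_factor_le1.
Qed.

(** Consecutive partial products differ by at most [|1 - blaschke_factor (b N) z|], which [K z]
    dominates, so the telescoping series converges absolutely. *)
Let pp_cvg k z : nrm z <= 1 -> pp k N z @[N --> \oo] --> blaschke_except b k z.
Proof.
move=> z1; pose u N : C := pp k N.+1 z - pp k N z.
have su : csummable u.
  apply: (summable_le (M := K z)) => [|N].
    by apply: (@rsum_bounded _ _ 3) => // N; exact: K_sum.
  rewrite /u ppS; case: ifP => _; last by rewrite mulr1 subrr nrm0.
  have -> : pp k N z * blaschke_factor (b N) z - pp k N z =
     - (pp k N z * (1 - blaschke_factor (b N) z)) by ring.
  rewrite nrmN nrmM; apply: le_trans (factor_K N z1).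
  by rewrite ler_piMl ?nrm_ge0// pp_le1.
have E N : pp k N z = 1 + series u N.
  elim: N => [|N IH]; first by rewrite /pp big_ord0 /series/= big_geq// addr0.
  have -> : series u N.+1 = series u N + u N by rewrite /series/= big_nat_recr.
  by rewrite addrA -IH /u addrC subrK.
have c : pp k N z @[N --> \oo] --> 1 + csum u.
  have -> : (fun N => pp k N z) = (fun N => 1 + series u N) by apply/funext.
  by apply: cvgD; [exact: cvg_cst|exact: csum_cvg].
rewrite /blaschke_except (ccvg_lim c); exact: c.
Qed.

Let B_le1 k z : nrm z <= 1 -> nrm (blaschke_except b k z) <= 1.
Proof.
move=> z1; have c : nrm (pp k N z) @[N --> \oo] --> nrm (blaschke_except b k z).
  by apply: ccvg_nrm; exact: pp_cvg.
rewrite -(cvg_lim _ c)//; apply: limr_le; first by apply: cvgP c.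
by apply: nearW => N; exact: pp_le1.
Qed.

Let B_zero k j : j != k -> blaschke_except b k (b j) = 0.
Proof.
move=> jk; apply: (ccvg_lim (F := \oo)).
have Z N : (j < N)%N -> pp k N (b j) = 0.
  move=> jN; rewrite /pp (bigD1 (Ordinal jN))//=.
  by rewrite /blaschke_factor (negbTE (b0 j)) subrr mul0r mulr0 mul0r.
apply: cvg_near_cst; exists j.+1 => // N /= jN; apply/eqP; exact: Z.
Qed.

(** [|a k - a j|] is at least [4 d k] and [4 d j], while [|b k - a k|] is less than [d k / 8]. *)
Let far k j : j != k -> d j <= nrm (b k - a j).
Proof.
move=> jk; have [_ _ /(_ j jk) h1] := dP k.
have [_ _ /(_ k)] := dP j; rewrite eq_sym => /(_ jk) h2.
have h3 : nrm (a k - a j) <= nrm (b k - a j) + nrm (b k - a k).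
  have -> : a k - a j = (b k - a j) + (- (b k - a k)) by ring.
  by apply: le_trans (nrmD _ _) _; rewrite nrmN.
rewrite nrmB in h1; have h4 := ba k.
have h5 : d k * e k <= d k by rewrite ler_piMr// ltW.
have := d0 j; have := d0 k; move: h1 h2 h3 h4 h5.
move: (d k * e k) (d k) (d j) (nrm (a k - a j)) (nrm (b k - a j)) (nrm (b k - a k)).
by move=> p q r s t u; lra.
Qed.

Let prod_nrm k N : nrm (pp k N (b k)) =
    \prod_(n < N | n != k :> nat) nrm (blaschke_factor (b n) (b k)).
Proof. exact: (big_morph _ (@nrmM R) (@nrm1 R)). Qed.

Let nrm_pp_ge k N : m <= nrm (pp k N (b k)).
Proof.
have z1 := ltW (b1 k); rewrite prod_nrm.
have [||lo _] := andP (@prod_ge_one_sub R (fun n => nrm (blaschke_factor (b n) (b k))) e k N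
  (fun n => ltW (e0 n)) _ _).
- by move=> n _; rewrite nrm_ge0 nrm_blaschke_factor_le1.
- move=> n nk.
  have h1 : nrm (1 - blaschke_factor (b n) (b k)) <= e n.
    exact: (one_sub_blaschke_factor_far (a1 n) (d0 n) (d1 n) (e0 n) (e1 n) (b1 n) (ba n) z1 (far nk)).
  have := nrmD (1 - blaschke_factor (b n) (b k)) (blaschke_factor (b n) (b k)).
  rewrite subrK nrm1; move: h1.
  move: (nrm (1 - _)) (nrm (blaschke_factor _ _)) (e n) => p q r; lra.
- by apply: le_trans lo; have := em N; move: (series e N) => p; lra.
Qed.

Let B_ge k : m <= nrm (blaschke_except b k (b k)).
Proof.
have c : nrm (pp k N (b k)) @[N --> \oo] --> nrm (blaschke_except b k (b k)).
  by apply: ccvg_nrm; apply: pp_cvg; exact: ltW.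
rewrite -(cvg_lim _ c)//; apply: limr_ge; first by apply: cvgP c.
by apply: nearW => N; exact: nrm_pp_ge.
Qed.

Let B_neq0 k : blaschke_except b k (b k) != 0.
Proof. by rewrite -nrm_gt0; exact: lt_le_trans (B_ge k). Qed.

Lemma Carleson_constant_ge : m <= Carleson_constant b.
Proof.
rewrite /Carleson_constant; apply: lb_le_inf; first by eexists; exists 0%N.
move=> _ [k _ <-].
have -> : (fun N => \prod_(j < N | j != k :> nat)
    Normc.normc ((b k - b j) / (1 - conjc (b k) * b j))) =
    (fun N => nrm (pp k N (b k))).
  (* The denominators of the Carleson factor and of the Blaschke factor have [b k] and [b j]
     interchanged; they are conjugate to each other, hence of equal modulus. *)
  apply/funext => N; rewrite prod_nrm; apply: eq_bigr => j _.
  rewrite nrm_blaschke_factor// nrmM nrmV [nrm (b k - _)]nrmB; congr (_ / _).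
  rewrite -nrmJ; congr nrm; rewrite rmorphB rmorph1 rmorphM.
  congr (1 - _); rewrite [LHS]mulrC; congr (_ * _); exact: (conjCK (b k)).
have c : nrm (pp k N (b k)) @[N --> \oo] --> nrm (blaschke_except b k (b k)).
  by apply: ccvg_nrm; apply: pp_cvg; exact: ltW.
by rewrite (cvg_lim _ c)//; exact: B_ge.
Qed.

Let B_derivable k z : nrm z < 1 -> derivable (blaschke_except b k) z 1.
Proof.
move: z; apply: (@bounded_limit_derivable _ (pp k) _ 1).
- move=> N z z1; elim: N => [|N IH].
    have -> : pp k 0 = (fun=> 1) by apply/funext => w; rewrite /pp big_ord0.
    exact: derivable_cst.
  have -> : pp k N.+1 = pp k N * (fun z => if N != k then blaschke_factor (b N) z else 1).
    by apply/funext => w; rewrite ppS.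
  apply: derivableM; first exact: IH.
  by case: (N != k); [exact: blaschke_factor_derivable|exact: derivable_cst].
- by move=> N z z1; apply: pp_le1; exact: ltW.
- by move=> z z1; apply: pp_cvg; exact: ltW.
Qed.

Let gfun_derivable k z : nrm z < 1 -> derivable (gfun b k) z 1.
Proof.
move=> z1.
have -> : gfun b k = (fun z => ((1 - `|b k| ^+ 2) / blaschke_except b k (b k)) *
    ((1 - Num.conj (b k) * z)^-1 * blaschke_except b k z)).
  by apply/funext => w; rewrite /gfun; ring.
apply: derivableZ; apply: derivableM; last exact: B_derivable.
exact: inv_one_sub_derivable.
Qed.

Let gfun_le z w k : nrm z <= 1 ->
  (nrm (z - a k) < d k -> nrm (w - a k) < 2 * d k) -> nrm (gfun b k z) <= m^-1 * K w k.
Proof.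
move=> z1 h; rewrite /gfun nrmM mulrC; apply: ler_pM; rewrite ?nrm_ge0//; last first.
  exact: kernel_K.
rewrite nrmM nrmV ler_pdivrMr ?(lt_le_trans m0 (B_ge k))//.
apply: le_trans (B_le1 k z1) _.
by rewrite ler_pdivlMl// mulr1 B_ge.
Qed.

Let gext k z : C := if `[< nrm z < 1 >] then gfun b k z else 0.

Let gextE k z : nrm z < 1 -> gext k z = gfun b k z.
Proof. by move=> z1; rewrite /gext; case: asboolP. Qed.

Let gext_Hinf k : gext k \in @Hinf_pred R.
Proof.
apply/asboolP; split => [z||z]; rewrite ?diskE.
- move=> z1; have /cderivP[l hl] := @gfun_derivable k z z1; apply/cderivP; exists l.
  apply: (@eq_cderiv _ (gfun b k) _ z l (1 - nrm z)); rewrite ?subr_gt0//.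
  move=> w wz; rewrite gextE//.
  by have := nrmD (w - z) z; rewrite subrK; move: wz; move: (nrm (w - z)) (nrm w) (nrm z) => p q r; lra.
- exists (m^-1 * 2)%:C => z; rewrite diskE => z1; rewrite normCE lecR gextE//.
  apply: le_trans (@gfun_le z z k (ltW z1) (@K_self z k)) _.
  rewrite ler_wpM2l ?invr_ge0 ?(ltW m0)// /K; case: ifP => // _.
  by apply: le_trans (e1 k) _; rewrite ler1n.
- by move=> z1; rewrite /gext; case: asboolP.
Qed.

Let gH k : Hinf R := HInf (gext_Hinf k).

Let gH_b n k : gH n (b k) = (n == k)%:R.
Proof.
rewrite /= gextE// /gfun; have [<-|nk] := eqVneq n k; last first.
  by rewrite B_zero 1?eq_sym// mul0r mulr0.
rewrite divff ?B_neq0// mulr1 normCE.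
have -> : (nrm (b n))%:C ^+ 2 = Num.conj (b n) * b n :> C.
  by rewrite mulrC mulcJ rmorphXn.
by rewrite divff// one_sub_conj_neq0// ltW.
Qed.

Let mK0 z n : 0 <= m^-1 * K z n.
Proof. by rewrite mulr_ge0// invr_ge0 ltW. Qed.

Let gH_le z n : nrm z < 1 -> nrm (gH n z) <= m^-1 * K z n.
Proof. by move=> z1; rewrite /= gextE//; exact: (@gfun_le z z n (ltW z1) (@K_self z n)). Qed.

Let gH_radial z (r : R) n : nrm z = 1 -> 0 < r < 1 ->
  nrm (gH n (r%:C * z)) <= m^-1 * K z n.
Proof.
move=> z1 r01; have rz : nrm (r%:C * z) < 1.
  by case/andP: r01 => r0 r1; rewrite nrmM z1 mulr1 nrm_real gtr0_norm.
by rewrite /= gextE//; apply: (@gfun_le _ z n (ltW rz)); exact: K_radial.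
Qed.

Let mK_sum z N : nrm z <= 1 -> series (fun n => m^-1 * K z n) N <= m^-1 * 3.
Proof.
move=> _; rewrite /series/= -mulr_sumr ler_wpM2l ?invr_ge0 ?(ltW m0)//; exact: K_sum.
Qed.

Lemma interpolating_near_circle : interpolating b.
Proof.
exact: (interpolating_of_extension (K := fun z n => m^-1 * K z n) b1 gH_b mK0 gH_le mK_sum).
Qed.

Lemma gfun_weak_star_copy : weak_star_copy_of_linf (gfun b).
Proof.
apply: (weak_star_copy_of_extension (K := fun z n => m^-1 * K z n) b1 gH_b mK0 gH_le gH_radial mK_sum) => n z z1.
exact: gextE.
Qed.

End BlaschkeSequence.

Theorem theorem3p11 (R : realType) (a : nat -> Cx R) (m : R)
    (ha : forall n, circle (a n)) (hsep : separated_seq a)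
    (hm0 : 0 < m) (hm1 : m < 1) :
  exists eta : nat -> R,
    (forall n, 0 < eta n) /\
    forall b : nat -> Cx R,
      (forall n, disk (b n)) ->
      (forall n, `|b n - a n| < (eta n)%:C) ->
      [/\ interpolating b,
          m <= Carleson_constant b
        & weak_star_copy_of_linf (gfun b)].
Proof.
have a1 n : Normc.normc (a n) = 1 by rewrite -circleE.
have [d dP] := separated_seq_dist hsep.
(* The exponent starts at 1, so that the [e n] add up to [1 - m]. *)
pose e n : R := (1 - m) * 2^-1 ^+ n.+1.
have sm0 : 0 < 1 - m by rewrite subr_gt0.
have e0 n : 0 < e n by rewrite mulr_gt0// exprn_gt0// invr_gt0.
have e1 n : e n <= 1.
  rewrite mulr_ile1 ?(ltW sm0)//; first by rewrite gerBl ltW.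
  by rewrite exprn_ile1// invf_le1// ler1n.
have em N : series e N <= 1 - m.
  have -> : series e N = (1 - m) * (1 - 2^-1 ^+ N).
    elim: N => [|N IH]; first by rewrite /series/= big_geq// expr0 subrr mulr0.
    have -> : series e N.+1 = series e N + e N by rewrite /series/= big_nat_recr.
    by rewrite IH /e exprS; field.
  by rewrite ler_piMr ?(ltW sm0)// gerBl exprn_ge0.
exists (fun n => d n * e n / 8); split.
  by move=> n; have [d0 _ _] := dP n; rewrite divr_gt0// mulr_gt0.
move=> b hb hba.
have b1 n : Normc.normc (b n) < 1 by rewrite -diskE.
have ba n : Normc.normc (b n - a n) < d n * e n / 8.
  by have := hba n; rewrite normCE ltcR.
split.
- exact: (interpolating_near_circle a1 dP hm0 e0 e1 em b1 ba).
- exact: (Carleson_constant_ge a1 dP hm0 e0 e1 em b1 ba).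
- exact: (gfun_weak_star_copy a1 dP hm0 e0 e1 em b1 ba).
Qed.
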